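(* Let $D\subset\mathbf{R}^n$ be a bounded open region. Let $1<p<n$, $\frac np<r\le\infty$, and let $q$ satisfy $\frac1r+\frac pq=1$. Let $\mathcal{G}=\{V\in L^r(D): V(x)\ge0,\ \|V\|_r=1\}$. Then for every pair $(E,V)\in\mathbf{R}^+\times\mathcal{G}$ for which there exists a nontrivial $u\in W_0^{1,p}(D)$ with $$-\Delta_p u=EV|u|^{p-2}u,$$ we have $$E\ge\frac1{K_{q,p}^p}.$$ Equality is attained when $u=u_*$ and $V=u_*^{q-p}/\|u_*^{q-p}\|_r$, where $u_*\in W_0^{1,p}(D)$ is a normalized nonnegative extremal for $K_{q,p}$, i.e. $u_*\ge0$, $\|\nabla u_*\|_p=1$, $\|u_*\|_q=K_{q,p}$.
   Context: $D$ is a bounded open region in $\mathbf{R}^n$; nothing is assumed about its boundary. $\Delta_p u=\mathrm{div}(|\nabla u|^{p-2}\nabla u)$; $u$ may be complex-valued; $\mathbf{R}^+$ denotes the positive reals. The equation is understood in the distribution sense: $\int_D|\nabla u|^{p-2}\nabla u\cdot\nabla\psi\,dx=\int_D EV|u|^{p-2}u\,\psi\,dx$ for all $\psi\in C_0^\infty(D)$ (with $|u|^{p-2}u$ read as $0$ where $u=0$, and likewise for the gradient). The Sobolev constant is $K_{q,p}=\sup_{0\ne u\in W_0^{1,p}(D)}\|u\|_q/\|\nabla u\|_p$, norms being taken over $D$. A normalized nonnegative extremal $u_*$ exists under the stated conditions. When $q=p$, $u_*^{q-p}$ is the constant function $1$. *)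

(* Defs.v *)
From HB Require Import structures.
From mathcomp Require Import all_boot all_order all_algebra.
From mathcomp Require Import all_classical all_reals all_analysis.
From mathcomp Require Import complex.

Set Implicit Arguments.
Unset Strict Implicit.
Unset Printing Implicit Defensive.

Import Order.TTheory GRing.Theory Num.Theory.
Import numFieldNormedType.Exports.

Local Open Scope classical_set_scope.
Local Open Scope ring_scope.
Local Open Scope complex_scope.

(* The product sigma-algebra on matrices, i.e. the one generated by the
   entries; on 'rV[R]_n it is the Borel sigma-algebra. *)
Definition measure_matrix_display : measure_display -> measure_display.
Proof. exact. Qed.

Section measurable_matrix.
Context {d} {T : sigmaRingType d} (m n : nat).

Definition matrix_cylinder : set (set 'M[T]_(m, n)) :=
  [set A | exists (i : 'I_m) (j : 'I_n) (B : set T),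
    measurable B /\ A = [set M : 'M[T]_(m, n) | B (M i j)]].

Let matrix_set0 : <<s matrix_cylinder >> set0.
Proof. exact: sigma_algebra0. Qed.

Let matrix_setC A : <<s matrix_cylinder >> A -> <<s matrix_cylinder >> (~` A).
Proof. exact: sigma_algebraC. Qed.

Let matrix_bigcup (F : _^nat) : (forall i, <<s matrix_cylinder >> (F i)) ->
  <<s matrix_cylinder >> (\bigcup_i F i).
Proof. exact: sigma_algebra_bigcup. Qed.

HB.instance Definition _ := @isMeasurable.Build (measure_matrix_display d)
  'M[T]_(m, n) <<s matrix_cylinder >> matrix_set0 matrix_setC matrix_bigcup.

End measurable_matrix.

Lemma measurable_entry d (T : sigmaRingType d) m n (i : 'I_m) (j : 'I_n) :
  measurable_fun [set: 'M[T]_(m, n)] (fun M => M i j).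
Proof.
move=> _ B mB; rewrite setTI; apply: sub_sigma_algebra.
by exists i, j, B.
Qed.

Lemma measurable_fun_mx d d' (S : measurableType d') (T : measurableType d)
    m n (f : S -> 'M[T]_(m, n)) :
  (forall i j, measurable_fun [set: S] (fun x => f x i j)) ->
  measurable_fun [set: S] f.
Proof.
move=> mf; apply: (@measurability _ _ S 'M[T]_(m, n) setT f (@matrix_cylinder _ T m n)) => // _ [_ [i [j [B [mB ->]]]] <-].
exact: mf.
Qed.

Section lebesgue_rV.
Context {R : realType}.
Local Notation TR := (measurableTypeR R).

Definition cons_rV n (xv : TR * 'rV[R]_n) : 'rV[R]_n.+1 :=
  \row_i (if unlift ord0 i is Some j then xv.2 ord0 j else xv.1).

Definition uncons_rV n (w : 'rV[R]_n.+1) : TR * 'rV[R]_n :=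
  (w ord0 ord0, \row_j w ord0 (lift ord0 j)).

Lemma cons_rVK n : cancel (@cons_rV n) (@uncons_rV n).
Proof.
move=> [x v]; congr pair; first by rewrite mxE unlift_none.
by apply/rowP => j; rewrite !mxE liftK.
Qed.

Lemma uncons_rVK n : cancel (@uncons_rV n) (@cons_rV n).
Proof. by move=> w; apply/rowP => i; rewrite mxE; case: unliftP => [j|] ->; rewrite ?mxE. Qed.

Lemma measurable_cons_rV n : measurable_fun setT (@cons_rV n).
Proof.
apply: measurable_fun_mx => i j; rewrite /cons_rV.
under eq_fun do rewrite mxE.
case: (unlift ord0 j) => [k|].
  exact: (measurableT_comp (measurable_entry ord0 k)).
exact: measurable_fst.
Qed.

Lemma measurable_uncons_rV n : measurable_fun setT (@uncons_rV n).
Proof.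
apply: measurable_fun_pair; first exact: (@measurable_entry _ R).
apply: measurable_fun_mx => i j.
under eq_fun do rewrite mxE.
exact: measurable_entry.
Qed.

Section step.
Variables (n : nat) (m : {sigma_finite_measure set 'rV[R]_n -> \bar R}).

Definition lebesgue_rVS : set 'rV[R]_n.+1 -> \bar R :=
  pushforward (lebesgue_measure \x m)%E (@cons_rV n).

HB.instance Definition _ := Measure.copy lebesgue_rVS
  (measure_function_pushforward__canonical__measure_function_Measure
    (lebesgue_measure \x m)%E (@measurable_cons_rV n)).

Lemma lebesgue_rVSE (A : set R) (B : set 'rV[R]_n) :
  measurable A -> measurable B ->
  lebesgue_rVS [set w | A (w ord0 ord0) /\ B (\row_j w ord0 (lift ord0 j))] =
  (lebesgue_measure A * m B)%E.
Proof.
move=> mA mB; rewrite -product_measure1E//; congr (product_measure1 _ _ _).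
apply/seteqP; rewrite /preimage/=.
by split=> xv; rewrite -[X in (A `*` B) X]cons_rVK.
Qed.

Let lebesgue_rVS_sigma_finite : sigma_finite setT lebesgue_rVS.
Proof.
have /sigma_finiteP[F [TF ndF Ffin]] := sigma_finiteT (@lebesgue_measure R).
have /sigma_finiteP[G [TG ndG Gfin]] := sigma_finiteT m.
exists (fun k => @uncons_rV n @^-1` (F k `*` G k)).
  apply/esym/seteqP; split=> // w _.
  have [i _ Fi] : (\bigcup_i F i) (uncons_rV w).1 by rewrite -TF.
  have [j _ Gj] : (\bigcup_j G j) (uncons_rV w).2 by rewrite -TG.
  exists (maxn i j) => //; split.
  - by apply: (subsetPset _ _ (ndF _ _ (leq_maxl i j))).
  - by apply: (subsetPset _ _ (ndG _ _ (leq_maxr i j))).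
move=> k; have [mF Fk] := Ffin k; have [mG Gk] := Gfin k; split.
  rewrite -[X in measurable X]setTI; apply: measurable_uncons_rV => //.
  exact: measurableX.
rewrite (lebesgue_rVSE mF mG) lte_mul_pinfty//.
by rewrite ge0_fin_numE.
Qed.

HB.instance Definition _ :=
  Measure_isSigmaFinite.Build _ _ _ lebesgue_rVS lebesgue_rVS_sigma_finite.

End step.

(* Iterated product of the Lebesgue measure of the line; lebesgue_rV_box below
   gives its value on boxes. *)
Fixpoint lebesgue_rV n : {sigma_finite_measure set 'rV[R]_n -> \bar R} :=
  match n return {sigma_finite_measure set 'rV[R]_n -> \bar R} with
  | 0 => dirac (0 : 'rV[R]_0)
  | k.+1 => lebesgue_rVS (lebesgue_rV k)
  end.

Lemma measurable_box n (A : 'I_n -> set R) : (forall i, measurable (A i)) ->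
  measurable [set v : 'rV[R]_n | forall i, A i (v ord0 i)].
Proof.
move=> mA.
rewrite (_ : [set _ | _] = \bigcap_(i in setT) [set v : 'rV[R]_n | A i (v ord0 i)]).
  apply: fin_bigcap_measurable; first exact: finite_finset.
  move=> i _; rewrite -[X in measurable X]setTI.
  exact: (measurable_entry ord0 i measurableT (mA i)).
by apply/seteqP; split=> v Av i; [move=> _; exact: Av|exact: Av].
Qed.

Lemma lebesgue_rV_box n (A : 'I_n -> set R) : (forall i, measurable (A i)) ->
  lebesgue_rV n [set v : 'rV[R]_n | forall i, A i (v ord0 i)] =
  (\prod_(i < n) lebesgue_measure (A i))%E.
Proof.
elim: n A => [|n IHn] A mA.
  rewrite big_ord0 /= diracE mem_set//= => -[].
  by case.
rewrite big_ord_recl -IHn//= -lebesgue_rVSE//; last first.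
  exact: (measurable_box (fun i => mA (lift ord0 i))).
congr (lebesgue_rVS _ _); apply/seteqP; split=> w /= Aw.
  by split=> // i; rewrite mxE.
by move=> i; case: (unliftP ord0 i) => [j|] ->; [have := Aw.2 j; rewrite mxE|case: Aw].
Qed.

End lebesgue_rV.

Section p_laplacian.
Context {R : realType} {n : nat}.
Local Notation mu := (@lebesgue_rV R n).
Local Notation Re := (@complex.Re R).
Local Notation Im := (@complex.Im R).
Local Notation cmod := (@ComplexField.Normc.normc R).
Implicit Types (D : set 'rV[R]_n) (p q E : R) (r s : \bar R).
Implicit Types (u phi psi : 'rV[R]_n -> R[i]) (g : 'rV[R]_n -> 'rV[R[i]]_n).
Implicit Types (V : 'rV[R]_n -> R).

Definition vmod (z : 'rV[R[i]]_n) : R := Num.sqrt (\sum_i cmod (z ord0 i) ^+ 2).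

Definition cmeasurable D u : Prop :=
  measurable_fun D (Re \o u) /\ measurable_fun D (Im \o u).

Definition cintegral D u : R[i] :=
  (\int[mu]_(x in D) Re (u x)) +i* (\int[mu]_(x in D) Im (u x)).

Definition ae_on D (P : 'rV[R]_n -> Prop) : Prop :=
  {ae mu, forall x, D x -> P x}.

(* The norm of L^s(D), s being allowed to be +oo. *)
Definition LnormD D s (f : 'rV[R]_n -> R) : \bar R :=
  Lnorm mu s (EFin \o (f \_ D)).

(* Functions on D are represented by functions on the whole space, whose values
   outside D play no role, and equality of classes by equality a.e. on D. *)
Definition in_Lp D p u : Prop :=
  cmeasurable D u /\ (LnormD D p%:E (cmod \o u) < +oo)%E.

Definition in_Lp_vec D p g : Prop :=
  (forall i, cmeasurable D (fun x => g x ord0 i)) /\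
  (LnormD D p%:E (vmod \o g) < +oo)%E.

Definition partial (i : 'I_n) (f : 'rV[R]_n -> R) : 'rV[R]_n -> R :=
  fun x => 'D_(delta_mx ord0 i) f x.

(* All iterated partial derivatives, in any order, exist and are continuous. *)
Definition smooth (f : 'rV[R]_n -> R) : Prop :=
  forall l : seq 'I_n, let h := foldr partial f l in
    continuous h /\ forall i x, derivable h x (delta_mx ord0 i).

Definition test_function D phi : Prop :=
  [/\ smooth (Re \o phi), smooth (Im \o phi) &
   exists K : set 'rV[R]_n,
     [/\ compact K, K `<=` D & forall x, ~ K x -> phi x = 0]].

Definition grad phi : 'rV[R]_n -> 'rV[R[i]]_n :=
  fun x => \row_i (partial i (Re \o phi) x +i* partial i (Im \o phi) x).

Definition weak_gradient D u g : Prop :=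
  forall phi, test_function D phi -> forall i,
    cintegral D (fun x => u x * grad phi x ord0 i) =
    - cintegral D (fun x => g x ord0 i * phi x).

(* [sobolev D p u g]: u belongs to W^{1,p}(D) and its gradient is g. *)
Definition sobolev D p u g : Prop :=
  [/\ in_Lp D p u, in_Lp_vec D p g & weak_gradient D u g].

(* [sobolev0 D p u g]: u belongs to W_0^{1,p}(D), the closure of the test
   functions in W^{1,p}(D), and its gradient is g. *)
Definition sobolev0 D p u g : Prop :=
  sobolev D p u g /\
  forall eps : R, 0 < eps -> exists phi,
    [/\ test_function D phi,
        (LnormD D p%:E (fun x => cmod (u x - phi x)%R) < eps%:E)%E &
        (LnormD D p%:E (fun x => vmod (g x - grad phi x)%R) < eps%:E)%E].

Definition nontrivial D u : Prop := ~ ae_on D (fun x => u x = 0).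

Definition sobolev_constant D q p : \bar R :=
  ereal_sup [set k | exists u g, [/\ sobolev0 D p u g, nontrivial D u &
    k = (LnormD D q%:E (cmod \o u) / LnormD D p%:E (vmod \o g))%E]].

(* -Delta_p u = E V |u|^{p-2} u in the sense of distributions, g being the
   gradient of u. Where u (resp. g) vanishes, so does the factor u x (resp.
   g x ord0 i), hence |u|^{p-2} u and |g|^{p-2} g are 0 there. *)
Definition weak_solution D p E V u g : Prop :=
  forall psi, test_function D psi ->
    cintegral D (fun x =>
      \sum_i (vmod (g x) `^ (p - 2))%:C * g x ord0 i * grad psi x ord0 i) =
    cintegral D (fun x =>
      (E * V x * cmod (u x) `^ (p - 2))%:C * u x * psi x).

Definition has_nontrivial_solution D p E V : Prop :=
  exists u g, [/\ sobolev0 D p u g, nontrivial D u & weak_solution D p E V u g].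

Definition potential_class D r V : Prop :=
  [/\ measurable_fun D V, ae_on D (fun x => 0 <= V x) & LnormD D r V = 1%E].

(* In the order of R[i], 0 <= z means that z is real and nonnegative. *)
Definition normalized_extremal D q p u g : Prop :=
  [/\ sobolev0 D p u g, ae_on D (fun x => 0 <= u x),
      LnormD D p%:E (vmod \o g) = 1%E &
      LnormD D q%:E (cmod \o u) = sobolev_constant D q p].

(* u^{q-p} / ||u^{q-p}||_r for u >= 0. As 0 `^ 0 = 1, the function u^{q-p} is
   constantly 1 when q = p. *)
Definition extremal_potential D q p r u : 'rV[R]_n -> R :=
  let w := fun x => Re (u x) `^ (q - p) in
  fun x => w x / fine (LnormD D r w).

End p_laplacian.

(* Main.v *)
Require Import Defs.
From HB Require Import structures.
From mathcomp Require Import all_boot all_order all_algebra.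
From mathcomp Require Import all_classical all_reals all_analysis measurable_realfun ess_sup_inf.
From mathcomp Require Import complex ring lra.

Set Implicit Arguments.
Unset Strict Implicit.
Unset Printing Implicit Defensive.

Import Order.TTheory GRing.Theory Num.Theory.
Import numFieldNormedType.Exports.

Local Open Scope classical_set_scope.
Local Open Scope ring_scope.

(** Write K for the Sobolev constant. Testing the equation with the conjugate of its
    solution u gives the identity of the integrals of |grad u|^p and of E V |u|^p.
    Hoelder's inequality with the exponents r and q/p bounds the latter by
    E ||u||_q^p, hence by E K^p ||grad u||_p^p, so that E K^p >= 1. As u itself is not
    a test function, [eigenvalue_lower_bound] tests with some phi close to u. The
    right-hand side then involves only ||phi||_q <= K ||grad phi||_p, so nothing but
    the gradient term is passed to the limit. When K is infinite the bound is 0.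

    For the equality case, an extremal u minimizes ||grad v||_p / ||v||_q, and its
    Euler-Lagrange equation is -Delta_p u = K^(-q) |u|^(q-2) u. Since (q - p) r = q,
    the r-norm of u^(q-p) is K^(q-p), and the equation becomes the one of the
    normalized potential with E = K^(-p). The equation is derived in
    [euler_lagrange_le] from convexity: the tangents of the p-th and q-th powers of
    the norm ([dual_tangent]) bound the two integrals from the appropriate sides, and
    dominated convergence is needed only for the slope of one tangent.

    This requires K = ||u||_q to be positive and finite. If K were 0, all test
    functions would vanish, and so would the gradient of u, which has norm 1
    ([extremal_nontrivial]). Finiteness is the Sobolev inequality
    ([sobolev0_Lq]), proved after Gagliardo: on each coordinate line the fundamental
    theorem of calculus bounds a power of a test function by the integral of its
    derivative, the Loomis-Whitney inequality ([loomis_whitney], by induction on the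
    dimension) integrates the product of these bounds, and Hoelder's inequality leaves
    an integral of |phi|^s, s = np/(n-p), bounded by a constant times a power of itself
    with exponent less than one ([sobolev_real]). The condition r > n/p says that
    q < s. Truncation extends the bound from test functions to their closure. *)


(** * Borel sets and Tonelli's theorem on row vectors *)

Section rV_topology.
Context {R : realType} {n : nat}.
Local Notation mu := (@lebesgue_rV R n).

Lemma ball_rV_box (x : 'rV[R]_n) (e : R) : 0 < e ->
  ball x e = [set v : 'rV[R]_n | forall i, `]x ord0 i - e, x ord0 i + e[%classic (v ord0 i)].
Proof.
move=> e0; apply/seteqP; split=> v /=.
  move=> [_ xv] i; have := xv ord0 i.
  by rewrite /ball/= in_itv/= ltr_distlC.
move=> xv; split=> // i j; rewrite (ord1 i).
have := xv j; by rewrite /ball/= in_itv/= ltr_distlC.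
Qed.

Lemma measurable_ball_rV (x : 'rV[R]_n) (e : R) : measurable (ball x e).
Proof.
have [e0|e0] := ltP 0 e; last first.
  rewrite (_ : ball x e = set0)//; apply/seteqP; split=> // v [].
  by rewrite ltNge e0.
rewrite ball_rV_box//.
by apply: (@measurable_box _ _ (fun i => `]x ord0 i - e, x ord0 i + e[%classic)) => i.
Qed.

(** Balls are boxes, and the ones with rational centres and radii 1/(k+1) form a
    countable base of the topology. *)
Lemma open_measurable_rV (U : set 'rV[R]_n) : open U -> measurable U.
Proof.
move=> oU.
pose F (ck : 'rV[rat]_n * nat) : set 'rV[R]_n :=
  let B := ball (map_mx ratr ck.1 : 'rV[R]_n) (ck.2.+1%:R^-1 : R) in
  if `[< B `<=` U >] then B else set0.
rewrite (_ : U = \bigcup_ck F ck); last first.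
  apply/seteqP; split=> [x Ux|x [ck _]]; last first.
    by rewrite /F; case: asboolP => // + ?; exact.
  have /nbhs_ballP[e /= e0 xeU] : nbhs x U by exact: open_nbhs_nbhs.
  have [k /andP[_ ke]] : exists k : nat, true && (k.+1%:R^-1 < e / 2).
    have e20 : 0 < e / 2 by rewrite divr_gt0.
    exists (Num.truncn (e / 2)^-1).
    rewrite /= invf_plt ?posrE//.
    by rewrite truncnS_gt.
  have kpos : 0 < (k.+1%:R^-1 : R) by rewrite invr_gt0.
  have /choice[c cP] : forall j, exists c : rat, ball (x ord0 j) k.+1%:R^-1 (ratr c : R).
    move=> j; have : x ord0 j - k.+1%:R^-1 < x ord0 j + k.+1%:R^-1.
      by rewrite ltrD2l gtrN.
    move=> /rat_in_itvoo[c]; rewrite in_itv/= => ?; exists c.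
    by rewrite /ball/= ltr_distlC.
  exists (\row_j c j, k) => //; rewrite /F/=.
  have cx : ball (map_mx ratr (\row_j c j) : 'rV[R]_n) (k.+1%:R^-1 : R) x.
    split => // i j; rewrite !mxE (ord1 i).
    by apply: ball_sym; exact: cP.
  case: asboolP => // -[] y /= cy; apply: xeU.
  apply: (@le_ball _ _ _ (k.+1%:R^-1 + k.+1%:R^-1)).
    by rewrite [leRHS](splitr e) lerD// ltW.
  apply: ball_triangle cy.
  by apply: ball_sym.
apply: countable_bigcupT_measurable; first exact: countableP.
move=> ck; rewrite /F; case: ifPn => // _.
exact: measurable_ball_rV.
Qed.

Lemma continuous_measurable_rV (f : 'rV[R]_n -> R) :
  continuous f -> measurable_fun setT f.
Proof.
move=> /continuousP cf; apply: (measurability _ (measurable_realfun.RGenOpens.measurableE R)).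
move=> _ [_ [a [b ->] <-]]; rewrite setTI; apply: open_measurable_rV.
exact/cf/interval_open.
Qed.

Lemma lebesgue_ball_gt0 (x : 'rV[R]_n) (e : R) : 0 < e -> (0 < mu (ball x e))%E.
Proof.
move=> e0; rewrite ball_rV_box//.
rewrite (@lebesgue_rV_box _ _ (fun i => `]x ord0 i - e, x ord0 i + e[%classic))//.
apply: (big_ind (fun y => (0 < y)%E)) => //.
  by move=> ? ? ? ?; exact: mule_gt0.
move=> i _; rewrite lebesgue_measure_itv/= lte_fin.
by rewrite ltrD2l gtrN// -EFinD lte_fin; lra.
Qed.

Lemma lebesgue_open_gt0 (U : set 'rV[R]_n) : open U -> U !=set0 -> (0 < mu U)%E.
Proof.
move=> oU [x Ux].
have /nbhs_ballP[e /= e0 xeU] : nbhs x U by exact: open_nbhs_nbhs.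
apply: lt_le_trans (lebesgue_ball_gt0 x e0) _.
apply: le_measure => //; rewrite inE; first exact: measurable_ball_rV.
exact: open_measurable_rV.
Qed.

Lemma lebesgue_ball_lty (x : 'rV[R]_n) (e : R) : 0 < e ->
  (mu (ball x e) < +oo)%E.
Proof.
move=> e0; rewrite ball_rV_box//.
pose B (i : 'I_n) : set R := `]x ord0 i - e, x ord0 i + e[%classic.
rewrite (@lebesgue_rV_box _ _ B); last by move=> i; exact: measurable_itv.
have : (0 <= \prod_(i < n) (@lebesgue_measure R) (B i) < +oo)%E.
  apply: (big_ind (fun y => (0 <= y < +oo)%E)) => //.
  - by rewrite lee01 ltry.
  - move=> a b /andP[a0 ay] /andP[b0 bY]; rewrite mule_ge0//=.
    by rewrite lte_mul_pinfty// ge0_fin_numE.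
  - move=> i _; rewrite measure_ge0/= /B lebesgue_measure_itv/=.
    by case: ifPn => // _; rewrite -EFinD ltry.
by case/andP.
Qed.

Lemma bounded_set_ball (A : set 'rV[R]_n) : bounded_set A ->
  exists2 M : R, 0 < M & A `<=` ball 0 M.
Proof.
move=> [M [_ MA]].
have M0 : 0 < `|M| + 2 by rewrite ltr_wpDl.
exists (`|M| + 2) => // x Ax; have := MA (`|M| + 1) _ x Ax.
have -> : M < `|M| + 1 by rewrite (le_lt_trans (ler_norm _))// ltrDl.
move=> /(_ isT) xM; rewrite -ball_normE /ball_/= sub0r normrN.
by rewrite (le_lt_trans xM)// ltrD2l ltr1n.
Qed.

Lemma lebesgue_bounded_lty (A : set 'rV[R]_n) : measurable A -> bounded_set A ->
  (mu A < +oo)%E.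
Proof.
move=> mA /bounded_set_ball[M M0 AB].
apply: le_lt_trans (lebesgue_ball_lty 0 M0).
by apply: le_measure => //; rewrite inE//; exact: measurable_ball_rV.
Qed.

End rV_topology.

Section rV_tonelli.
Context {R : realType} {n : nat}.
Local Notation TR := (measurableTypeR R).
Local Open Scope ereal_scope.

Let measurable_section_cons (f : 'rV[R]_n.+1 -> \bar R) : measurable_fun [set: 'rV[R]_n.+1] f ->
  measurable_fun setT (f \o @cons_rV R n).
Proof. by move=> mf; apply: measurableT_comp => //; exact: measurable_cons_rV. Qed.

Lemma integral_rVS_pushforward (f : 'rV[R]_n.+1 -> \bar R) :
  measurable_fun [set: 'rV[R]_n.+1] f -> (forall x, 0 <= f x) ->
  \int[@lebesgue_rV R n.+1]_w f w =
  \int[(@lebesgue_measure R) \x (@lebesgue_rV R n)]_z f (cons_rV z).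
Proof.
move=> mf f0; rewrite (ge0_integral_pushforward (@measurable_cons_rV R n))//.
Qed.

Lemma tonelli_rV1 (f : 'rV[R]_n.+1 -> \bar R) :
  measurable_fun [set: 'rV[R]_n.+1] f -> (forall x, 0 <= f x) ->
  \int[@lebesgue_rV R n.+1]_w f w =
  \int[@lebesgue_measure R]_s \int[@lebesgue_rV R n]_v f (cons_rV (s, v)).
Proof.
move=> mf f0; rewrite integral_rVS_pushforward//.
rewrite (fubini_tonelli1 (f \o @cons_rV R n))//.
- exact: measurable_section_cons.
- by move=> x; exact: f0.
Qed.

Lemma tonelli_rV2 (f : 'rV[R]_n.+1 -> \bar R) :
  measurable_fun [set: 'rV[R]_n.+1] f -> (forall x, 0 <= f x) ->
  \int[@lebesgue_rV R n.+1]_w f w =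
  \int[@lebesgue_rV R n]_v \int[@lebesgue_measure R]_s f (cons_rV (s, v)).
Proof.
move=> mf f0; rewrite integral_rVS_pushforward//.
rewrite (fubini_tonelli2 (f \o @cons_rV R n))//.
- exact: measurable_section_cons.
- by move=> x; exact: f0.
Qed.

End rV_tonelli.


(** * Hoelder's inequality and the Loomis-Whitney inequality *)

(** The weighted inequality of arithmetic and geometric means with free scaling factors
    [a] and [b]; when these are the integrals of the functions [x] and [y], integrating
    it yields Hoelder's inequality. *)
Lemma young_powR (R : realType) (a b t x y : R) :
  0 < a -> 0 < b -> 0 < t < 1 -> 0 <= x -> 0 <= y ->
  x `^ t * y `^ (1 - t) <=
    (a `^ t * b `^ (1 - t)) * (t / a * x + (1 - t) / b * y).
Proof.
move=> a0 b0 /andP[t0 t1] x0 y0.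
have t10 : 0 < 1 - t by rewrite subr_gt0.
have ab0 : 0 < a `^ t * b `^ (1 - t) by rewrite mulr_gt0// powR_gt0.
have xa0 : 0 <= x / a by rewrite divr_ge0// ltW.
have yb0 : 0 <= y / b by rewrite divr_ge0// ltW.
have := @conjugate_powR _ ((x / a) `^ t) ((y / b) `^ (1 - t)) t^-1 (1 - t)^-1
  (powR_ge0 _ _) (powR_ge0 _ _).
rewrite !invr_gt0 t0 t10 !invrK subrKC => /(_ isT isT erefl).
rewrite -!powRrM !mulfV ?gt_eqF// !powRr1//.
have xE : x `^ t = a `^ t * (x / a) `^ t.
  by rewrite -powRM ?(ltW a0)// mulrCA divff ?gt_eqF// mulr1.
have yE : y `^ (1 - t) = b `^ (1 - t) * (y / b) `^ (1 - t).
  by rewrite -powRM ?(ltW b0)// mulrCA divff ?gt_eqF// mulr1.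
rewrite xE yE mulrACA ler_pM2l// => /le_trans; apply.
by rewrite (mulrC t) (mulrC (1 - t)) (mulrC _ x) (mulrC _ y) !mulrA.
Qed.

Section hoelder_geometric.
Context d (T : measurableType d) (R : realType).
Variable mu : {measure set T -> \bar R}.
Local Open Scope ereal_scope.

Lemma young_poweR (a b : R) (t : R) (x y : \bar R) :
  (0 < a)%R -> (0 < b)%R -> (0 < t < 1)%R -> 0 <= x -> 0 <= y ->
  x `^ t * y `^ (1 - t) <=
    (a `^ t * b `^ (1 - t))%:E * ((t / a)%:E * x + ((1 - t) / b)%:E * y).
Proof.
move=> a0 b0 /andP[t0 t1] x0 y0.
have t10 : (0 < 1 - t)%R by rewrite subr_gt0.
have ab0 : (0 < a `^ t * b `^ (1 - t))%R by rewrite mulr_gt0// powR_gt0.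
have ta0 : (0 < t / a)%R by rewrite divr_gt0.
have tb0 : (0 < (1 - t) / b)%R by rewrite divr_gt0.
case: x x0 => [x| |//] x0; last first.
  by rewrite gt0_muley ?lte_fin// addye ?gt0_muley ?lte_fin ?leey//
    gt_eqF// (lt_le_trans (ltNyr 0%R))// mule_ge0// lee_fin ltW.
case: y y0 => [y| |//] y0; last first.
  by rewrite gt0_muley ?lte_fin// addey ?gt0_muley ?lte_fin ?leey//
    gt_eqF// (lt_le_trans (ltNyr 0%R))// mule_ge0// lee_fin ltW.
rewrite !poweR_EFin -!EFinM lee_fin.
by apply: young_powR; rewrite ?t0.
Qed.

(** The functions are extended-real because line integrals of an integrable function
    may be infinite on a null set. *)
Lemma hoelder_poweR (t : R) (F G : T -> \bar R) : (0 < t < 1)%R ->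
  measurable_fun setT F -> measurable_fun setT G ->
  (forall x, 0 <= F x) -> (forall x, 0 <= G x) ->
  \int[mu]_x (F x `^ t * G x `^ (1 - t)) <=
  (\int[mu]_x F x) `^ t * (\int[mu]_x G x) `^ (1 - t).
Proof.
move=> t01 mF mG F0 G0; have /andP[t0 t1] := t01.
have t10 : (0 < 1 - t)%R by rewrite subr_gt0.
have iF0 : 0 <= \int[mu]_x F x by exact: integral_ge0.
have iG0 : 0 <= \int[mu]_x G x by exact: integral_ge0.
have mp (H : T -> \bar R) s : measurable_fun setT H ->
    measurable_fun setT (fun x => H x `^ s).
  move=> mH; exact: (measurableT_comp (measurable_poweR s)).
have mFG : measurable_fun setT (fun x => F x `^ t * G x `^ (1 - t)).
  by apply: emeasurable_funM; exact: mp.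
have FG0 x : 0 <= F x `^ t * G x `^ (1 - t) by rewrite mule_ge0// poweR_ge0.
have null (H : T -> \bar R) : measurable_fun setT H -> (forall x, 0 <= H x) ->
    \int[mu]_x H x = 0 ->
    (forall x, H x = 0 -> F x `^ t * G x `^ (1 - t) = 0) ->
    \int[mu]_x (F x `^ t * G x `^ (1 - t)) = 0.
  move=> mH H0 iH HFG.
  have : \int[mu]_x `|H x| = 0.
    by rewrite -[RHS]iH; apply: eq_integral => x _; rewrite gee0_abs.
  move/(ae_eq_integral_abs mu measurableT mH) => H00.
  rewrite (ae_eq_integral (cst 0))//; first by rewrite integral0.
  by apply: filterS H00 => x + _ => /(_ I)/HFG.
have [iF00|iFN0] := eqVneq (\int[mu]_x F x) 0.
  rewrite (null F)// ?mule_ge0 ?poweR_ge0// => x ->.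
  by rewrite poweR0r ?gt_eqF// mul0e.
have [iG00|iGN0] := eqVneq (\int[mu]_x G x) 0.
  rewrite (null G)// ?mule_ge0 ?poweR_ge0// => x ->.
  by rewrite poweR0r ?gt_eqF// mule0.
have iFp : 0 < \int[mu]_x F x by rewrite lt0e iFN0.
have iGp : 0 < \int[mu]_x G x by rewrite lt0e iGN0.
have [iFy|iFny] := eqVneq (\int[mu]_x F x) +oo.
  by rewrite iFy poweRyr ?gt_eqF// gt0_mulye ?leey ?poweR_gt0.
have [iGy|iGny] := eqVneq (\int[mu]_x G x) +oo.
  by rewrite iGy poweRyr ?gt_eqF// gt0_muley ?leey ?poweR_gt0.
have [a a0 aE] : exists2 a : R, (0 < a)%R & \int[mu]_x F x = a%:E.
  exists (fine (\int[mu]_x F x)); first by rewrite fine_gt0// iFp ltey.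
  by rewrite fineK// ge0_fin_numE// ltey.
have [b b0 bE] : exists2 b : R, (0 < b)%R & \int[mu]_x G x = b%:E.
  exists (fine (\int[mu]_x G x)); first by rewrite fine_gt0// iGp ltey.
  by rewrite fineK// ge0_fin_numE// ltey.
have c0 : (0 <= a `^ t * b `^ (1 - t))%R by rewrite mulr_ge0// powR_ge0.
have ta0 : (0 <= t / a)%R by rewrite divr_ge0// ltW.
have tb0 : (0 <= (1 - t) / b)%R by rewrite divr_ge0// ltW.
have m1 : measurable_fun setT (fun x => (t / a)%:E * F x).
  exact: emeasurable_funM.
have m2 : measurable_fun setT (fun x => ((1 - t) / b)%:E * G x).
  exact: emeasurable_funM.
apply: (@le_trans _ _ (\int[mu]_x ((a `^ t * b `^ (1 - t))%:E *
    ((t / a)%:E * F x + ((1 - t) / b)%:E * G x)))).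
  apply: ge0_le_integral => //.
  - by apply: emeasurable_funM => //; exact: emeasurable_funD.
  - by move=> x _; exact: young_poweR.
rewrite ge0_integralZl//; last 2 first.
  - exact: emeasurable_funD.
  - by move=> x _; rewrite adde_ge0// mule_ge0.
rewrite ge0_integralD//; last 2 first.
  - by move=> x _; rewrite mule_ge0.
  - by move=> x _; rewrite mule_ge0.
rewrite !ge0_integralZl// aE bE !poweR_EFin -!EFinM.
by rewrite !divfK ?gt_eqF// subrKC mulr1.
Qed.

Lemma poweR_prod (I : Type) (s : seq I) (F : I -> \bar R) (t : R) :
  (forall i, 0 <= F i) ->
  (\prod_(i <- s) F i) `^ t = \prod_(i <- s) F i `^ t.
Proof.
move=> F0; elim: s => [|i s IH]; first by rewrite !big_nil poweR1r.
by rewrite !big_cons poweRM ?IH// prode_ge0.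
Qed.

Lemma emeasurable_prod_seq (I : Type) (s : seq I) (F : I -> T -> \bar R) :
  (forall i, measurable_fun setT (F i)) ->
  measurable_fun setT (fun x => \prod_(i <- s) F i x).
Proof.
move=> mF; elim: s => [|i s IH].
  by under eq_fun do rewrite big_nil; exact: measurable_cst.
under eq_fun do rewrite big_cons.
exact: emeasurable_funM.
Qed.

Lemma measurable_poweR_comp (H : T -> \bar R) (s : R) : measurable_fun setT H ->
  measurable_fun setT (fun x => H x `^ s).
Proof. by move=> mH; exact: (measurableT_comp (measurable_poweR s)). Qed.

(** By induction on the number of factors: one of them is split off with its weight,
    and the remaining weights are rescaled to add up to 1. *)
Lemma hoelder_geometric_mean (n : nat) (h : 'I_n.+1 -> T -> \bar R) :
  (forall i, measurable_fun setT (h i)) -> (forall i x, 0 <= h i x) ->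
  \int[mu]_x (\prod_(i < n.+1) h i x `^ (n.+1%:R^-1)) <=
  \prod_(i < n.+1) (\int[mu]_x h i x) `^ (n.+1%:R^-1).
Proof.
elim: n h => [|n IH] h mh h0.
  rewrite big_ord1 invr1 poweRe1; last exact: integral_ge0.
  by under eq_integral do rewrite big_ord1 poweRe1//.
set t : R := (n.+2%:R^-1)%R.
have t01 : (0 < t < 1)%R by rewrite invr_gt0 ltr0n/= invf_lt1// ltr1n.
have tE : (1 - t = n.+1%:R * t)%R.
  have n0 : (n.+2%:R != 0 :> R)%R by rewrite pnatr_eq0.
  by rewrite /t; apply: (mulIf n0); rewrite mulrBl mul1r -mulrA mulVf// !mulr1 -natr1 addrK.
have tE' : (t = n.+1%:R^-1 * (1 - t))%R by rewrite tE mulrA mulVf ?mul1r.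
rewrite big_ord_recl.
under eq_integral => x _.
  rewrite big_ord_recl.
  under eq_bigr do rewrite tE' poweRrM.
  rewrite -poweR_prod; last by move=> i; exact: poweR_ge0.
  over.
apply: le_trans (hoelder_poweR t01 _ _ _ _) _ => //.
- by apply: emeasurable_prod_seq => i; exact: measurable_poweR_comp.
- by move=> x; rewrite prode_ge0// => i _; exact: poweR_ge0.
apply: lee_wpmul2l; first exact: poweR_ge0.
under eq_bigr do rewrite tE' poweRrM.
rewrite -poweR_prod; last by move=> i; exact: poweR_ge0.
apply: gt0_ler_poweR.
- by case/andP: t01 => _ /ltW; rewrite subr_ge0.
- by rewrite in_itv/= leey andbT; apply: integral_ge0 => x _;
    rewrite prode_ge0// => i _; exact: poweR_ge0.
- by rewrite in_itv/= leey andbT; rewrite prode_ge0// => i _; exact: poweR_ge0.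
exact: IH.
Qed.

End hoelder_geometric.


Section line_integral.
Context {R : realType}.
Local Notation TR := (measurableTypeR R).
Local Notation lam := (@lebesgue_measure R).
Local Open Scope ereal_scope.

Definition set_coord n (x : 'rV[R]_n) (i : 'I_n) (s : R) : 'rV[R]_n :=
  \row_j (if j == i then s else x ord0 j).

Definition line_integral n (i : 'I_n) (f : 'rV[R]_n -> \bar R) x : \bar R :=
  \int[lam]_s f (set_coord x i s).

Lemma set_coord_cons0 n (s t : R) (v : 'rV[R]_n) :
  set_coord (cons_rV (s, v)) ord0 t = cons_rV (t, v).
Proof.
apply/rowP => j; rewrite !mxE; case: unliftP => [k|] ->; last by rewrite eqxx.
by rewrite eq_sym (negbTE (neq_lift _ _)).
Qed.

Lemma set_coord_cons_lift n (s t : R) (v : 'rV[R]_n) (i : 'I_n) :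
  set_coord (cons_rV (s, v)) (lift ord0 i) t = cons_rV (s, set_coord v i t).
Proof.
apply/rowP => j; rewrite !mxE; case: unliftP => [k|] ->.
  by rewrite !mxE (inj_eq lift_inj).
by rewrite (negbTE (neq_lift _ _)).
Qed.

Lemma measurable_set_coord n (i : 'I_n) :
  measurable_fun setT (fun z : 'rV[R]_n * TR => set_coord z.1 i z.2).
Proof.
apply: measurable_fun_mx => k j; rewrite (ord1 k) /set_coord.
under eq_fun do rewrite mxE.
case: (j == i); first exact: measurable_snd.
exact: (measurableT_comp (measurable_entry ord0 j) measurable_fst).
Qed.

Lemma line_integral_ge0 n (i : 'I_n) (f : 'rV[R]_n -> \bar R) x :
  (forall x, 0 <= f x) -> 0 <= line_integral i f x.
Proof. by move=> f0; exact: integral_ge0. Qed.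

Lemma measurable_line_integral n (i : 'I_n) (f : 'rV[R]_n -> \bar R) :
  measurable_fun [set: 'rV[R]_n] f -> (forall x, 0 <= f x) ->
  measurable_fun [set: 'rV[R]_n] (line_integral i f).
Proof.
move=> mf f0.
have := @measurable_fun_fubini_tonelli_F _ _ 'rV[R]_n TR R lam
  (fun z => f (set_coord z.1 i z.2)); apply.
- exact: (measurableT_comp mf (measurable_set_coord i)).
- by move=> z; exact: f0.
Qed.

Lemma measurable_cons_section n (f : 'rV[R]_n.+1 -> \bar R) (s : R) :
  measurable_fun [set: 'rV[R]_n.+1] f ->
  measurable_fun [set: 'rV[R]_n] (fun v => f (cons_rV (s, v))).
Proof.
move=> mf; apply: (measurableT_comp mf).
apply: (measurableT_comp (@measurable_cons_rV R n)).
exact: measurable_pair1.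
Qed.

Lemma measurable_integral_section n (f : 'rV[R]_n.+1 -> \bar R) :
  measurable_fun [set: 'rV[R]_n.+1] f -> (forall x, 0 <= f x) ->
  measurable_fun [set: TR] (fun s => \int[@lebesgue_rV R n]_v f (cons_rV (s, v))).
Proof.
move=> mf f0.
have := @measurable_fun_fubini_tonelli_F _ _ TR 'rV[R]_n R (@lebesgue_rV R n)
  (fun z => f (cons_rV z)); apply.
- exact: (measurableT_comp mf (@measurable_cons_rV R n)).
- by move=> z; exact: f0.
Qed.

Lemma measurable_integral_head n (f : 'rV[R]_n.+1 -> \bar R) :
  measurable_fun [set: 'rV[R]_n.+1] f -> (forall x, 0 <= f x) ->
  measurable_fun [set: 'rV[R]_n] (fun v => \int[lam]_s f (cons_rV (s, v))).
Proof.
move=> mf f0.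
have := @measurable_fun_fubini_tonelli_G _ _ TR 'rV[R]_n R lam
  (fun z => f (cons_rV z)); apply.
- exact: (measurableT_comp mf (@measurable_cons_rV R n)).
- by move=> z; exact: f0.
Qed.

Lemma integral_rV1 (f : 'rV[R]_1 -> \bar R) (v : 'rV[R]_1) (i : 'I_1) :
  measurable_fun [set: 'rV[R]_1] f -> (forall x, 0 <= f x) ->
  \int[@lebesgue_rV R 1]_x f x = line_integral i f v.
Proof.
move=> mf f0; rewrite tonelli_rV1//; apply: eq_integral => s _.
rewrite integral_dirac//= ?diracT ?mul1e; last exact: measurable_cons_section.
by congr f; apply/rowP => j; rewrite !mxE !ord1 eqxx unlift_none.
Qed.

(** Each line integral is constant in its own coordinate. For a fixed first coordinate,
    Hoelder's inequality separates the line integral in that coordinate from the other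
    ones, to which the inequality of one dimension less applies. This leaves a product
    of functions of the first coordinate alone, which [hoelder_geometric_mean]
    integrates. In dimension two the claim is Tonelli's theorem. *)
Lemma loomis_whitney n (f : 'I_n.+2 -> 'rV[R]_n.+2 -> \bar R) :
  (forall i, measurable_fun [set: 'rV[R]_n.+2] (f i)) ->
  (forall i x, 0 <= f i x) ->
  \int[@lebesgue_rV R n.+2]_x
     (\prod_(i < n.+2) line_integral i (f i) x `^ n.+1%:R^-1) <=
  \prod_(i < n.+2) (\int[@lebesgue_rV R n.+2]_x f i x) `^ n.+1%:R^-1.
Proof.
have mprod m (h : 'I_m -> 'rV[R]_m -> \bar R) (r : R) :
    (forall i, measurable_fun [set: 'rV[R]_m] (h i)) -> (forall i x, 0 <= h i x) ->
    measurable_fun [set: 'rV[R]_m]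
      (fun x => \prod_(i < m) line_integral i (h i) x `^ r).
  move=> mh h0; apply: emeasurable_prod_seq => i.
  by apply: measurable_poweR_comp; exact: measurable_line_integral.
have prod0 m (h : 'I_m -> 'rV[R]_m -> \bar R) (r : R) x :
    0 <= \prod_(i < m) line_integral i (h i) x `^ r.
  by rewrite prode_ge0// => i _; exact: poweR_ge0.
elim: n f => [|n IH] f mf f0.
  rewrite tonelli_rV1//; last exact: mprod.
  rewrite big_ord_recl big_ord1 invr1 !poweRe1; [|exact: integral_ge0..].
  set A := fun v => \int[lam]_t f ord0 (cons_rV (t, v)).
  set B := fun s => \int[@lebesgue_rV R 1]_v f (lift ord0 ord0) (cons_rV (s, v)).
  have A0 v : 0 <= A v by exact: integral_ge0.
  have B0 s : 0 <= B s by exact: integral_ge0.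
  have mA : measurable_fun [set: 'rV[R]_1] A by exact: measurable_integral_head.
  have mB : measurable_fun [set: TR] B by exact: measurable_integral_section.
  rewrite (eq_integral (fun s => \int[@lebesgue_rV R 1]_v (A v * B s))); last first.
    move=> s _; apply: eq_integral => v _.
    rewrite big_ord_recl big_ord1 !poweRe1; [|exact: line_integral_ge0..].
    congr (_ * _).
      by apply: eq_integral => t _; rewrite set_coord_cons0.
    rewrite /B (@integral_rV1 _ v ord0)//; last exact: measurable_cons_section.
    by apply: eq_integral => t _; rewrite set_coord_cons_lift.
  under eq_integral do rewrite ge0_integralZr//.
  rewrite ge0_integralZl//; last exact: integral_ge0.
  by rewrite (tonelli_rV2 (mf ord0))// (tonelli_rV1 (mf (lift ord0 ord0))).
set t : R := (n.+2%:R^-1)%R.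
have t01 : (0 < t < 1)%R by rewrite invr_gt0 ltr0n/= invf_lt1// ltr1n.
have t1 : (0 <= 1 - t)%R by case/andP: t01 => _ /ltW; rewrite subr_ge0.
have tE : (1 - t = n.+1%:R * t)%R.
  have n0 : (n.+2%:R != 0 :> R)%R by rewrite pnatr_eq0.
  by rewrite /t; apply: (mulIf n0); rewrite mulrBl mul1r -mulrA mulVf// !mulr1 -natr1 addrK.
have tE' : (t = n.+1%:R^-1 * (1 - t))%R by rewrite tE mulrA mulVf ?mul1r.
rewrite tonelli_rV1//; last exact: mprod.
set A := fun v => \int[lam]_t f ord0 (cons_rV (t, v)).
pose g s (j : 'I_n.+2) v := f (lift ord0 j) (cons_rV (s, v)).
have A0 v : 0 <= A v by exact: integral_ge0.
have mA : measurable_fun [set: 'rV[R]_n.+2] A by exact: measurable_integral_head.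
have mg s j : measurable_fun [set: 'rV[R]_n.+2] (g s j).
  exact: measurable_cons_section.
have g0 s j v : 0 <= g s j v by exact: f0.
have mG j : measurable_fun [set: TR] (fun s => \int[@lebesgue_rV R n.+2]_v g s j v).
  exact: measurable_integral_section.
have prodE s v : \prod_(i < n.+3) line_integral i (f i) (cons_rV (s, v)) `^ t =
    A v `^ t * (\prod_(j < n.+2) line_integral j (g s j) v `^ n.+1%:R^-1) `^ (1 - t).
  rewrite big_ord_recl; congr (_ * _).
    by congr (_ `^ _); apply: eq_integral => r _; rewrite set_coord_cons0.
  rewrite poweR_prod; last by move=> j; exact: poweR_ge0.
  apply: eq_bigr => j _; rewrite -poweRrM -tE'; congr (_ `^ _).
  by apply: eq_integral => r _; rewrite set_coord_cons_lift.
have iA : \int[@lebesgue_rV R n.+2]_v A v = \int[@lebesgue_rV R n.+3]_x f ord0 x.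
  by rewrite (tonelli_rV2 (mf ord0)).
apply: (@le_trans _ _ (\int[lam]_s ((\int[@lebesgue_rV R n.+3]_x f ord0 x) `^ t *
    \prod_(j < n.+2) (\int[@lebesgue_rV R n.+2]_v g s j v) `^ t))).
  apply: ge0_le_integral => //.
  - by move=> s _; apply: integral_ge0 => v _; exact: prod0.
  - exact: (measurable_integral_section (mprod _ f t mf f0) (prod0 _ f t)).
  - apply: emeasurable_funM => //.
    by apply: emeasurable_prod_seq => j; exact: measurable_poweR_comp.
  move=> s _; under eq_integral do rewrite prodE.
  apply: le_trans (hoelder_poweR _ t01 mA _ A0 _) _.
  - exact: mprod.
  - by move=> v; exact: prod0.
  rewrite iA; apply: lee_wpmul2l; first exact: poweR_ge0.
  rewrite [leRHS](_ : _ =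
      (\prod_(j < n.+2) (\int[@lebesgue_rV R n.+2]_v g s j v) `^ n.+1%:R^-1) `^ (1 - t)).
    2: { rewrite poweR_prod; last by move=> j; exact: poweR_ge0.
         by apply: eq_bigr => j _; rewrite -poweRrM -tE'. }
  apply: gt0_ler_poweR => //.
  - by rewrite in_itv/= leey andbT; apply: integral_ge0 => v _; exact: prod0.
  - by rewrite in_itv/= leey andbT prode_ge0// => j _; exact: poweR_ge0.
  exact: IH.
rewrite ge0_integralZl//; last 3 first.
- by apply: emeasurable_prod_seq => j; exact: measurable_poweR_comp.
- by move=> s _; rewrite prode_ge0// => j _; exact: poweR_ge0.
- exact: poweR_ge0.
rewrite [leRHS]big_ord_recl; apply: lee_wpmul2l; first exact: poweR_ge0.
apply: le_trans (hoelder_geometric_mean _ _ _) _ => //.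
  by move=> j s; exact: integral_ge0.
by under eq_bigr do rewrite -tonelli_rV1//.
Qed.

End line_integral.


(** * Powers of the positive part *)

Section positive_power.
Context {R : realType}.
Implicit Types a y : R.

(** For [a > 1] this power is continuously differentiable on the whole line, zero
    included, and the derivative is again of this form. Real functions are treated
    through the positive parts of themselves and of their opposites. *)
Definition ppow a y : R := Num.max y 0 `^ a.

Lemma ppow_ge0 a y : 0 <= ppow a y. Proof. exact: powR_ge0. Qed.

Lemma ppow_pos a y : 0 <= y -> ppow a y = y `^ a.
Proof. by move=> y0; rewrite /ppow max_l. Qed.

Lemma ppow_neg a y : a != 0 -> y <= 0 -> ppow a y = 0.
Proof. by move=> a0 y0; rewrite /ppow max_r// powR0. Qed.

Lemma continuous_ppow a : 0 < a -> continuous (ppow a).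
Proof.
move=> a0 y; have aN0 : a != 0 by rewrite gt_eqF.
have [y0|y0|<-] := ltgtP 0 y.
- have cy : {for y, continuous (@powR R ^~ a)}.
    apply/differentiable_continuous; rewrite -derivable1_diffP.
    by apply: ex_derive; exact: is_derive1_powR.
  rewrite /prop_for/continuous_at (ppow_pos _ (ltW y0)).
  apply: cvg_trans cy; apply: near_eq_cvg; near=> z.
  by rewrite ppow_pos// ltW//; near: z; exact: lt_nbhsr.
- rewrite /prop_for/continuous_at (ppow_neg aN0 (ltW y0)).
  apply: (cvg_trans _ (@cvg_cst _ _ _ (nbhs y) _)).
  apply: near_eq_cvg; near=> z.
  by rewrite ppow_neg// ltW//; near: z; exact: lt_nbhsl.
- rewrite /prop_for/continuous_at (ppow_neg aN0 (lexx 0)).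
  apply/cvgrPdist_lt => e e0; rewrite near_simpl.
  near=> z; rewrite sub0r normrN ger0_norm ?ppow_ge0//.
  have [z0|z0] := leP z 0; first by rewrite ppow_neg.
  rewrite ppow_pos ?(ltW z0)//.
  have -> : e = (e `^ a^-1) `^ a by rewrite -powRrM mulVf// powRr1// ltW.
  rewrite gt0_ltr_powR// ?nnegrE ?powR_ge0 ?(ltW z0)//.
  rewrite (le_lt_trans (ler_norm z))//.
  near: z; have := @nbhs0_lt _ R (e `^ a^-1); apply.
  exact: powR_gt0.
Unshelve. all: by end_near. Qed.

(** At zero the difference quotient equals [ppow (a - 1)], which tends to zero. *)
Lemma is_derive_ppow a y : 1 < a -> is_derive y 1 (ppow a) (a * ppow (a - 1) y).
Proof.
move=> a1; have a0 : 0 < a by rewrite (lt_trans _ a1).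
have aN0 : a != 0 by rewrite gt_eqF.
have a10 : 0 < a - 1 by rewrite subr_gt0.
have a1N0 : a - 1 != 0 by rewrite gt_eqF.
have [y0|y0|<-] := ltgtP 0 y.
- rewrite (ppow_pos _ (ltW y0)).
  apply: (@near_eq_is_derive _ _ _ (@powR R ^~ a)) => //.
    near=> z; rewrite ppow_pos// ltW//; near: z; exact: lt_nbhsr.
  exact: is_derive1_powR.
- rewrite (ppow_neg _ (ltW y0))// mulr0.
  apply: (@near_eq_is_derive _ _ _ (cst 0)) => //.
    near=> z; rewrite ppow_neg// ltW//; near: z; exact: lt_nbhsl.
- rewrite (ppow_neg _ (lexx 0))// mulr0.
  have : (fun h : R => h^-1 *: ((ppow a \o shift 0) (h *: 1) - ppow a 0)) @ 0^'
      --> (0 : R).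
    have c0 := @continuous_ppow (a - 1) a10 0.
    rewrite /prop_for/continuous_at (ppow_neg a1N0 (lexx 0)) in c0.
    have c1 : ppow (a - 1) @ (0 : R)^' --> (0 : R).
      exact: (@cvg_within_filter _ _ _ (nbhs (0 : R))).
    apply: cvg_trans c1; apply: near_eq_cvg; near=> h.
    rewrite /= addr0 (ppow_neg aN0 (lexx 0)) subr0 -[h *: 1]/(h * 1) mulr1.
    have h0 : h != 0 by near: h; exact: nbhs_dnbhs_neq.
    have [hn|hp] := leP h 0; first by rewrite !ppow_neg// scaler0.
    by rewrite !ppow_pos ?(ltW hp)// powRB ?h0 ?implybT// powRr1 ?(ltW hp)// mulrC.
  by move=> l; split; [apply/cvg_ex; exists 0|exact/cvg_lim].
Unshelve. all: by end_near. Qed.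

End positive_power.


(** * The fundamental theorem of calculus along coordinate lines *)

Section ftc_line.
Context {R : realType}.
Local Notation lam := (@lebesgue_measure R).

Lemma ftc_itv (F G : R -> R) (a b : R) : a < b ->
  (forall s : R, is_derive s (1 : R) F (G s)) -> continuous G ->
  (\int[lam]_(x in `[a, b]) (G x)%:E = (F b)%:E - (F a)%:E)%E.
Proof.
move=> ab dF cG.
have cF : continuous F.
  move=> s; apply/differentiable_continuous; rewrite -derivable1_diffP.
  by apply: ex_derive.
apply: continuous_FTC2 => //.
- by apply: continuous_subspaceT.
- split.
  + by move=> x _; apply: ex_derive.
  + by apply: cvg_at_right_filter; exact: cF.
  + by apply: cvg_at_left_filter; exact: cF.
- by move=> x _; rewrite derive1E; apply: derive_val.
Qed.

(** The value at a point is the integral of the derivative from any point where the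
    function vanishes. *)
Lemma ftc_le_total_variation (F G : R -> R) (M : R) :
  (forall s : R, is_derive s (1 : R) F (G s)) -> continuous G ->
  (forall s, M <= `|s| -> F s = 0) ->
  forall s, (`|F s|%:E <= \int[lam]_t (`|G t|)%:E)%E.
Proof.
move=> dF cG F0 s.
have mG : measurable_fun setT G by exact: continuous_measurable_fun.
pose a := - (`|M| + `|s| + 1).
have Ma : M <= `|a|.
  rewrite normrN ger0_norm ?addr_ge0//.
  by rewrite (le_trans (ler_norm M))// -addrA lerDl addr_ge0.
have sa : a < s.
  rewrite ltrNl; have := ler_norm (- s); rewrite normrN => /le_lt_trans; apply.
  by rewrite (addrC `|M|) -addrA ltrDl ltr_wpDl.
have := ftc_itv sa dF cG; rewrite (F0 a Ma) sube0 => /(congr1 abse)/=.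
move=> <-.
apply: le_trans (le_abse_integral _ _ _) _ => //.
  by apply/measurable_EFinP; exact: measurable_funTS.
apply: ge0_subset_integral => //.
by apply/measurable_EFinP; exact: measurableT_comp.
Qed.

Lemma integral_derivative_eq0 (F G : R -> R) (M : R) : 0 < M ->
  (forall s : R, is_derive s (1 : R) F (G s)) -> continuous G ->
  (forall s, M <= `|s| -> F s = 0) -> (forall s, M <= `|s| -> G s = 0) ->
  (\int[lam]_t (G t)%:E = 0)%E.
Proof.
move=> M0 dF cG F0 G0.
have MM : - M < M by rewrite gtrN.
have := ftc_itv MM dF cG.
rewrite !F0 ?normrN ?ger0_norm ?(ltW M0)// subee// => <-.
rewrite [RHS]integral_mkcond; apply: eq_integral => t _.
rewrite patchE; case: ifPn => // /negP tM; rewrite G0//.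
rewrite leNgt; apply/negP => ltM; apply: tM.
by rewrite inE/= in_itv/= -ler_norml ltW.
Qed.

End ftc_line.

Section C1c.
Context {R : realType} {n : nat}.
Local Notation mu := (@lebesgue_rV R n).
Local Notation lam := (@lebesgue_measure R).
Implicit Types (K : set 'rV[R]_n) (f : 'rV[R]_n -> R).

Lemma compact_measurable_rV K : compact K -> measurable K.
Proof.
move=> /(compact_closed (@norm_hausdorff _ 'rV[R]_n)) cK.
rewrite -(setCK K); apply: measurableC; apply: open_measurable_rV.
exact: closed_openC.
Qed.

Lemma lebesgue_compact_lty K : compact K -> (mu K < +oo)%E.
Proof.
move=> cK; apply: lebesgue_bounded_lty; first exact: compact_measurable_rV.
exact: compact_bounded.
Qed.

Lemma compact_support_bounded K f : compact K -> continuous f ->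
  (forall x, ~ K x -> f x = 0) -> exists2 B : R, 0 < B & forall x, `|f x| <= B.
Proof.
move=> cK cf f0.
have : compact (f @` K).
  by apply: continuous_compact => //; exact: continuous_subspaceT.
move=> /(@compact_bounded R R^o)[B [_ fB]]; exists (`|B| + 1).
  by rewrite ltr_wpDl.
move=> x; have [Kx|/f0 ->] := pselect (K x); last by rewrite normr0 addr_ge0.
apply: (fB (`|B| + 1)); last by exists x.
by rewrite (le_lt_trans (ler_norm _))// ltrDl.
Qed.

Lemma compact_support_integrable K f : compact K -> continuous f ->
  (forall x, ~ K x -> f x = 0) -> mu.-integrable setT (EFin \o f).
Proof.
move=> cK cf f0; have [B B0 fB] := compact_support_bounded cK cf f0.
have mK := compact_measurable_rV cK.
have mf : measurable_fun setT f by exact: continuous_measurable_rV.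
apply/integrableP; split; first exact/measurable_EFinP.
apply: (@le_lt_trans _ _ (\int[mu]_(x in K) (cst B%:E) x)%E).
  rewrite [leRHS]integral_mkcond; apply: ge0_le_integral => //.
  - by do 2 apply: measurableT_comp => //; exact/measurable_EFinP.
  - by apply/(measurable_restrictT _ mK); exact: measurable_cst.
  - move=> x _ /=; rewrite patchE; case: ifPn => [_|/negP xK].
      by rewrite lee_fin.
    by rewrite f0 ?normr0// => Kx; apply: xK; rewrite inE.
by rewrite integral_cst// lte_mul_pinfty ?lebesgue_compact_lty// lee_fin ltW.
Qed.

(** The set [K] only has to contain the support, so that functions with different
    supports can share it. *)
Definition C1c K f : Prop :=
  [/\ continuous f, forall i x, derivable f x (delta_mx ord0 i),
      forall i, continuous (partial i f) & forall x, ~ K x -> f x = 0].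

Lemma partial_support K f i x : compact K -> (forall x, ~ K x -> f x = 0) ->
  ~ K x -> partial i f x = 0.
Proof.
move=> /(compact_closed (@norm_hausdorff _ 'rV[R]_n)) cK f0 Kx.
rewrite /partial (@near_eq_derive _ _ _ _ (cst 0)) ?derive_cst//.
have : nbhs x (~` K) by apply: open_nbhs_nbhs; split=> //; exact: closed_openC.
by apply: filterS => y /f0 ->.
Qed.

Lemma set_coordE (x : 'rV[R]_n) i s t :
  set_coord x i (t + s) = t *: delta_mx ord0 i + set_coord x i s.
Proof.
apply/rowP => j; rewrite !mxE eqxx/=; case: (j == i); first by rewrite mulr1.
by rewrite mulr0 add0r.
Qed.

Lemma is_derive_line f (x : 'rV[R]_n) i (s : R) :
  (forall x, derivable f x (delta_mx ord0 i)) ->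
  is_derive s (1 : R) (fun t => f (set_coord x i t)) (partial i f (set_coord x i s)).
Proof.
move=> df; have := df (set_coord x i s).
rewrite /partial /derive /derivable => h.
suff E : (fun h : R => h^-1 *: (((fun t => f (set_coord x i t)) \o shift s) (h *: 1)
      - f (set_coord x i s))) =
    (fun h : R => h^-1 *: ((f \o shift (set_coord x i s)) (h *: delta_mx ord0 i)
      - f (set_coord x i s))).
  by split; rewrite /derivable /derive E.
apply/funext => t /=; rewrite -[t *: 1]/(t * 1) mulr1.
by rewrite set_coordE.
Qed.

Lemma continuous_set_coord (x : 'rV[R]_n) i : continuous (set_coord x i).
Proof.
move=> s; apply/cvgrPdist_lt => e e0; near=> t.
have : ball (set_coord x i s) e (set_coord x i t).
  split=> // k j; rewrite !mxE; case: (j == i); last exact: ballxx.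
  by rewrite /ball/=; near: t; exact: (@cvgr_dist_lt _ _ _ _ _ id (s : R^o) (@cvg_id _ _) e e0).
by rewrite -ball_normE.
Unshelve. all: by end_near. Qed.

Lemma continuous_line f (x : 'rV[R]_n) i : continuous f ->
  continuous (fun s => f (set_coord x i s)).
Proof.
move=> cf s; apply: continuous_comp; [exact: continuous_set_coord|exact: cf].
Qed.

Lemma line_bounded K : compact K -> exists2 M : R, 0 < M &
  forall (x : 'rV[R]_n) i s, M <= `|s| -> ~ K (set_coord x i s).
Proof.
move=> /compact_bounded/bounded_set_ball[M M0 KM]; exists M => // x i s Ms /KM.
move=> [_ /(_ ord0 i)]; rewrite !mxE eqxx /ball/= sub0r normrN.
by rewrite ltNge Ms.
Qed.

Lemma line_integral_partial_eq0 K f i x : compact K -> C1c K f ->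
  line_integral i (EFin \o partial i f) x = 0%E.
Proof.
move=> cK [cf df cdf f0]; have [M M0 KM] := line_bounded cK.
apply: (@integral_derivative_eq0 _ (fun s => f (set_coord x i s)) _ M) => //.
- by move=> s; exact: is_derive_line.
- exact: continuous_line.
- by move=> s Ms; apply: f0; exact: KM.
- by move=> s Ms; apply: (partial_support _ cK f0); exact: KM.
Qed.

(** The support is compact, so [ftc_le_total_variation] applies on the line through [x]
    parallel to the i-th axis. *)
Lemma ppow_le_line_integral K f i x (a : R) : compact K -> C1c K f -> 1 < a ->
  ((ppow a (f x))%:E <= line_integral i
     (fun y => (`|a * ppow (a - 1) (f y) * partial i f y|)%:E) x)%E.
Proof.
move=> cK [cf df cdf f0] a1; have [M M0 KM] := line_bounded cK.
have a0 : a != 0 by rewrite gt_eqF// (lt_trans _ a1).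
have a10 : 0 < a - 1 by rewrite subr_gt0.
pose F s := ppow a (f (set_coord x i s)).
have {1}-> : ppow a (f x) = `|F (x ord0 i)|.
  rewrite ger0_norm ?ppow_ge0// /F; congr (ppow _ (f _)).
  by apply/rowP => j; rewrite mxE; case: eqP => [->|].
apply: (@ftc_le_total_variation _ F
    (fun s => a * ppow (a - 1) (f (set_coord x i s)) * partial i f (set_coord x i s)) M).
- move=> s; apply: (@is_derive1_comp _ (ppow a) (fun s => f (set_coord x i s))).
    exact: is_derive_ppow.
  exact: is_derive_line.
- move=> s; apply: (@continuousM _ _
      (fun s => a * ppow (a - 1) (f (set_coord x i s)))
      (fun s => partial i f (set_coord x i s))); last exact: continuous_line.
  apply: continuousM; first exact: cvg_cst.
  apply: continuous_comp; first exact: continuous_line.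
  exact: continuous_ppow.
- by move=> s Ms; rewrite /F f0 ?ppow_neg//; exact: KM.
Qed.

End C1c.


(** * Integration by parts *)

(** Tonelli's theorem lets one integrate along direction [i] first; the recursive
    definition of the measure makes this an induction on the dimension. *)
Lemma eq_line_integral {R : realType} n (i : 'I_n) (f g : 'rV[R]_n -> \bar R) :
  measurable_fun [set: 'rV[R]_n] f -> measurable_fun [set: 'rV[R]_n] g ->
  (forall x, 0 <= f x)%E -> (forall x, 0 <= g x)%E ->
  (forall x, line_integral i f x = line_integral i g x) ->
  (\int[@lebesgue_rV R n]_x f x = \int[@lebesgue_rV R n]_x g x)%E.
Proof.
elim: n i f g => [[]//|n IH] i f g mf mg f0 g0.
case: (unliftP ord0 i) => [j|] -> fg.
  rewrite !tonelli_rV1//; apply: eq_integral => s _; apply: (IH j) => //.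
  - exact: measurable_cons_section.
  - exact: measurable_cons_section.
  - move=> v; have := fg (cons_rV (s, v)); rewrite /line_integral.
    under eq_integral do rewrite set_coord_cons_lift.
    by move=> ->; apply: eq_integral => t _; rewrite set_coord_cons_lift.
rewrite !tonelli_rV2//; apply: eq_integral => v _.
have := fg (cons_rV (0, v)); rewrite /line_integral.
under eq_integral do rewrite set_coord_cons0.
by move=> ->; apply: eq_integral => t _; rewrite set_coord_cons0.
Qed.

Section integration_by_parts.
Context {R : realType} {n : nat}.
Local Notation mu := (@lebesgue_rV R n).
Local Notation lam := (@lebesgue_measure R).
Implicit Types (K : set 'rV[R]_n) (f g : 'rV[R]_n -> R).

Lemma C1c_partial_integrable K f i : compact K -> C1c K f ->
  mu.-integrable setT (EFin \o partial i f).
Proof.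
move=> cK [cf df cdf f0].
apply: (compact_support_integrable cK) => // x.
exact: partial_support.
Qed.

(** The integral over every line parallel to the i-th axis vanishes, so the positive and
    negative parts of the derivative have the same line integrals. *)
Lemma integral_partial_eq0 K f i : compact K -> C1c K f ->
  (\int[mu]_x (partial i f x)%:E = 0)%E.
Proof.
move=> cK cf; have [cf0 df cdf f0] := cf.
have intf := C1c_partial_integrable i cK cf.
have mf := measurable_int _ intf.
rewrite integralE (@eq_line_integral _ _ i _ (EFin \o partial i f)^\-%E).
- rewrite subee// ge0_fin_numE; last exact: integral_ge0.
  by have /integrableP[_] := integrable_funeneg measurableT intf;
    under eq_integral do rewrite gee0_abs//.
- exact: measurable_funepos.
- exact: measurable_funeneg.
- by [].
- by [].
move=> x; have := line_integral_partial_eq0 i x cK cf.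
rewrite /line_integral integralE.
set P := integral _ _ _; set N := integral _ _ _ => PN.
have [M M0 KM] := line_bounded cK.
have [B B0 fB] := compact_support_bounded cK (cdf i)
  (fun x => @partial_support _ _ _ f i x cK f0).
have mline : measurable_fun setT (fun s => partial i f (set_coord x i s)).
  by apply: continuous_measurable_fun; exact: continuous_line.
have intl : lam.-integrable setT (EFin \o (fun s => partial i f (set_coord x i s))).
  apply/integrableP; split; first exact/measurable_EFinP.
  apply: (@le_lt_trans _ _ (\int[lam]_(s in `[(- M)%R, M]) (cst B%:E) s)%E).
    rewrite [leRHS]integral_mkcond; apply: ge0_le_integral => //.
    - by do 2 apply: measurableT_comp => //; exact/measurable_EFinP.
    - by apply/(measurable_restrictT _ (measurable_itv _)); exact: measurable_cst.
    - move=> s _ /=; rewrite patchE; case: ifPn => [_|/negP sM].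
        by rewrite lee_fin.
      rewrite (partial_support _ cK f0) ?normr0//; apply: KM.
      rewrite leNgt; apply/negP => ltM; apply: sM.
      by rewrite inE/= in_itv/= -ler_norml ltW.
  rewrite integral_cst//= lebesgue_measure_itv/=.
  by case: ifPn => _; rewrite ?mule0// -EFinD -EFinM ltry.
have Pfin : P \is a fin_num.
  rewrite ge0_fin_numE; last exact: integral_ge0.
  have /integrableP[_] := integrable_funepos measurableT intl.
  by under eq_integral do rewrite gee0_abs//.
have Nfin : N \is a fin_num.
  rewrite ge0_fin_numE; last exact: integral_ge0.
  have /integrableP[_] := integrable_funeneg measurableT intl.
  by under eq_integral do rewrite gee0_abs//.
suff PNE : P = N.
  transitivity P; first by apply: eq_integral => s _; rewrite !funeposE.
  by rewrite PNE; apply: eq_integral => s _; rewrite !funenegE.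
by rewrite -(subeK P Nfin) PN add0e.
Qed.

Lemma partialM f g i x : derivable f x (delta_mx ord0 i) ->
  derivable g x (delta_mx ord0 i) ->
  partial i (f \* g) x = f x * partial i g x + partial i f x * g x.
Proof.
by move=> df dg; rewrite /partial deriveM// [g x *: _]mulrC.
Qed.

Lemma C1cM K f g : C1c K f -> C1c K g -> C1c K (f \* g).
Proof.
move=> [cf df cdf f0] [cg dg cdg g0].
have pE i : partial i (f \* g) = (fun x => f x * partial i g x + partial i f x * g x).
  by apply/funext => x; rewrite partialM.
split.
- by move=> x; apply: continuousM; [exact: cf|exact: cg].
- by move=> i x; apply: derivableM.
- move=> i x; rewrite pE.
  apply: (@continuousD _ _ _ (f \* partial i g) (partial i f \* g));
    apply: continuousM.
  + exact: cf.
  + exact: cdg.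
  + exact: cdf.
  + exact: cg.
- by move=> x Kx; rewrite /= f0// mul0r.
Qed.

Lemma C1c_subset K K' f : K `<=` K' -> C1c K f -> C1c K' f.
Proof.
by move=> KK' [cf df cdf f0]; split=> // x K'x; apply: f0 => /KK'.
Qed.

Lemma integration_by_parts_rV K f g i : compact K -> C1c K f -> C1c K g ->
  \int[mu]_x (f x * partial i g x) = - \int[mu]_x (partial i f x * g x).
Proof.
move=> cK Cf Cg; have [cf df cdf f0] := Cf; have [cg dg cdg g0] := Cg.
have := integral_partial_eq0 i cK (C1cM Cf Cg).
under eq_integral do rewrite partialM//.
move=> /(congr1 fine)/=.
rewrite -[LHS]/(\int[mu]_x (f x * partial i g x + partial i f x * g x)) RintegralD//.
- by move=> /eqP; rewrite addr_eq0 => /eqP.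
- apply: (compact_support_integrable cK).
    by move=> x; apply: continuousM; [exact: cf|exact: cdg].
  by move=> x Kx; rewrite f0// mul0r.
- apply: (compact_support_integrable cK).
    by move=> x; apply: continuousM; [exact: cdf|exact: cg].
  by move=> x Kx; rewrite g0// mulr0.
Qed.

End integration_by_parts.


(** * The Gagliardo-Nirenberg-Sobolev inequality *)

Section sobolev_real.
Context {R : realType}.

Lemma prod_poweR_const n (c : \bar R) (t : R) : (0 <= c)%E -> 0 < t ->
  (\prod_(i < n) c `^ t = c `^ (n%:R * t))%E.
Proof.
move=> c0 t0; elim: n => [|n IH]; first by rewrite big_ord0 mul0r poweRe0.
rewrite big_ord_recl IH -natr1 mulrDl mul1r addrC poweRD//.
by apply: add_neq0_poweRD_def; rewrite gt_eqF// ltr_pwDl ?mulr_ge0// ltW.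
Qed.

Lemma lee_prod_ord n (F G : 'I_n -> \bar R) :
  (forall i, 0 <= F i)%E -> (forall i, F i <= G i)%E ->
  (\prod_(i < n) F i <= \prod_(i < n) G i)%E.
Proof.
elim: n F G => [|n IH] F G F0 FG; first by rewrite !big_ord0.
rewrite !big_ord_recl; apply: lee_pmul => //; last exact: IH.
by rewrite prode_ge0.
Qed.

Lemma lee_poweR (t : R) (x y : \bar R) : 0 <= t -> (0 <= x)%E -> (x <= y)%E ->
  (x `^ t <= y `^ t)%E.
Proof.
move=> t0 x0 xy; apply: gt0_ler_poweR => //; rewrite in_itv/= leey andbT//.
exact: le_trans xy.
Qed.

Lemma measurable_ppow a : 0 < a -> measurable_fun [set: R] (@ppow R a).
Proof. by move=> a0; apply: continuous_measurable_fun; exact: continuous_ppow. Qed.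

Variables (m : nat).
Let n := m.+2.
Local Notation mu := (@lebesgue_rV R n).
Variables (p : R).
Hypotheses (p1 : 1 < p) (pn : p < n%:R).

Let N : R := n%:R.
(** The power of the function to which the inequality for p = 1 is applied: it makes
    [sob_gamma * n / (n - 1)] and [(sob_gamma - 1) * p / (p - 1)] equal, and their
    common value is the critical exponent [sob_star]. *)
Definition sob_gamma := p * (N - 1) / (N - p).
Definition sob_star := N * p / (N - p).

Let p0 : 0 < p. Proof. by rewrite (lt_trans _ p1). Qed.
Let Np : 0 < N - p. Proof. by rewrite subr_gt0. Qed.
Let N1 : 0 < N - 1. Proof. by rewrite subr_gt0 (lt_trans p1). Qed.
Let N1E : N - 1 = m.+1%:R. Proof. by rewrite /N /n -natr1 addrK. Qed.

Let gamma1 : 1 < sob_gamma.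
Proof.
rewrite /sob_gamma ltr_pdivlMr// mul1r -subr_gt0.
have -> : p * (N - 1) - (N - p) = (p - 1) * N by ring.
by rewrite mulr_gt0 ?subr_gt0// (lt_trans p0).
Qed.

Let starE : sob_star = sob_gamma * (N * (N - 1)^-1).
Proof. by rewrite /sob_star /sob_gamma; field; rewrite !gt_eqF. Qed.

Let star_conj : sob_star * (1 - p^-1) = sob_gamma - 1.
Proof. by rewrite /sob_star /sob_gamma; field; rewrite !gt_eqF. Qed.

Lemma sob_star_gt0 : 0 < sob_star.
Proof. by rewrite divr_gt0// mulr_gt0// (lt_trans p0). Qed.

(** The function [ppow sob_gamma f] is at most its line integral in each of the n
    directions. The product of these n bounds, raised to the power 1/(n - 1), is
    integrated by the Loomis-Whitney inequality, and Hoelder's inequality separates the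
    gradient from [ppow (sob_gamma - 1) f]. *)
Lemma gagliardo_nirenberg_self (K : set 'rV[R]_n) (f w : 'rV[R]_n -> R) :
  compact K -> C1c K f -> measurable_fun setT w -> (forall x, 0 <= w x) ->
  (forall i x, `|partial i f x| <= w x) ->
  (\int[mu]_x (ppow sob_star (f x))%:E <=
   (sob_gamma%:E * ((\int[mu]_x (w x `^ p)%:E) `^ p^-1 *
     (\int[mu]_x (ppow sob_star (f x))%:E) `^ (1 - p^-1))) `^ (N * (N - 1)^-1))%E.
Proof.
move=> cK Cf mw w0 fw; have [cf df cdf f0] := Cf.
have mf : measurable_fun setT f by exact: continuous_measurable_rV.
have g0 : 0 < sob_gamma by rewrite (lt_trans _ gamma1).
have g10 : 0 < sob_gamma - 1 by rewrite subr_gt0.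
have e0 : 0 < (N - 1)^-1 by rewrite invr_gt0.
have mpp a : 0 < a -> measurable_fun setT (fun x => ppow a (f x)).
  by move=> a0; apply: measurableT_comp => //; exact: measurable_ppow.
pose h i y := (`|sob_gamma * ppow (sob_gamma - 1) (f y) * partial i f y|)%:E.
have h0 i y : (0 <= h i y)%E by rewrite lee_fin.
have mh i : measurable_fun [set: 'rV[R]_n] (h i).
  apply/measurable_EFinP; apply: measurableT_comp => //.
  apply: measurable_funM; last exact: continuous_measurable_rV.
  by apply: measurable_funM => //; exact: mpp.
have star0 := sob_star_gt0.
have mm : measurable_fun [set: 'rV[R]_n]
    (fun x => (\prod_(i < n) line_integral i (h i) x `^ (N - 1)^-1)%E).
  apply: emeasurable_prod_seq => i.
  by apply: measurable_poweR_comp; exact: measurable_line_integral.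
apply: (@le_trans _ _ (\int[mu]_x
    (\prod_(i < n) line_integral i (h i) x `^ (N - 1)^-1))%E).
  apply: ge0_le_integral => //.
  - by move=> x _; rewrite lee_fin ppow_ge0.
  - by apply/measurable_EFinP; exact: mpp.
  move=> x _; rewrite /ppow starE powRrM -poweR_EFin.
  rewrite -prod_poweR_const ?lee_fin ?powR_ge0//.
  apply: lee_prod_ord => i; first exact: poweR_ge0.
  apply: lee_poweR; [exact: ltW|by rewrite lee_fin powR_ge0|].
  exact: (ppow_le_line_integral i x cK Cf gamma1).
rewrite N1E; apply: le_trans (loomis_whitney mh h0) _.
set Y := (X in (_ <= X `^ _)%E).
suff hY i : (\int[mu]_x h i x <= Y)%E.
  have Y0 : (0 <= Y)%E.
    by rewrite /Y mule_ge0 ?lee_fin ?(ltW g0)// mule_ge0// poweR_ge0.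
  have t0 : 0 < m.+1%:R^-1 :> R by rewrite -N1E.
  rewrite -(prod_poweR_const n Y0 t0).
  apply: lee_prod_ord => i; first exact: poweR_ge0.
  by apply: lee_poweR; rewrite -?N1E ?(ltW e0)//; exact: integral_ge0.
rewrite /Y.
apply: (@le_trans _ _ (sob_gamma%:E *
    \int[mu]_x ((w x `^ p)%:E `^ p^-1 * (ppow sob_star (f x))%:E `^ (1 - p^-1)))%E).
  rewrite -ge0_integralZl//; last 3 first.
  - apply: emeasurable_funM; apply: measurable_poweR_comp; apply/measurable_EFinP.
      by apply: (measurableT_comp (measurable_powR p)).
    exact: mpp.
  - by move=> x _; rewrite mule_ge0// poweR_ge0.
  - by rewrite lee_fin ltW.
  apply: ge0_le_integral => //.
  - apply: measurable_funeM; apply: emeasurable_funM;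
      apply: measurable_poweR_comp; apply/measurable_EFinP.
      by apply: (measurableT_comp (measurable_powR p)).
    exact: mpp.
  - move=> x _; rewrite !poweR_EFin -!EFinM lee_fin.
    rewrite -powRrM mulfV ?gt_eqF// powRr1// /ppow -powRrM star_conj.
    rewrite normrM (normrM sob_gamma) (ger0_norm (ltW g0)) (ger0_norm (powR_ge0 _ _)).
    rewrite -mulrA ler_pM2l// mulrC ler_wpM2r ?powR_ge0//.
apply: lee_wpmul2l; first by rewrite lee_fin ltW.
apply: hoelder_poweR.
- by rewrite invr_gt0 p0/= invf_lt1.
- by apply/measurable_EFinP; apply: (measurableT_comp (measurable_powR p)).
- by apply/measurable_EFinP; exact: mpp.
- by move=> x; rewrite lee_fin powR_ge0.
- by move=> x; rewrite lee_fin ppow_ge0.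
Qed.

(** In [gagliardo_nirenberg_self] the integral on the left reappears on the right with
    exponent n (p - 1) / ((n - 1) p), which is less than 1 because p < n. As this
    integral is finite, it can be absorbed. *)
Lemma sobolev_real (A : R) : exists C : R,
  forall (K : set 'rV[R]_n) (f w : 'rV[R]_n -> R),
  compact K -> C1c K f -> measurable_fun setT w -> (forall x, 0 <= w x) ->
  (forall i x, `|partial i f x| <= w x) ->
  (\int[mu]_x (w x `^ p)%:E <= A%:E)%E ->
  (\int[mu]_x (ppow sob_star (f x))%:E <= C%:E)%E.
Proof.
pose th := N * (N - 1)^-1.
pose de := th * (1 - p^-1).
have de1 : 0 < 1 - de.
  have -> : 1 - de = (N - p) / (p * (N - 1)) by rewrite /de /th; field; rewrite !gt_eqF.
  by rewrite divr_gt0// mulr_gt0.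
pose B := (sob_gamma * `|A| `^ p^-1) `^ th.
exists (B `^ (1 - de)^-1) => K f w cK Cf mw w0 fw wA.
have [cf df cdf f0] := Cf.
have := gagliardo_nirenberg_self cK Cf mw w0 fw.
set X := (\int[mu]_x (ppow sob_star (f x))%:E)%E.
have g0 : 0 <= sob_gamma by rewrite ltW// (lt_trans _ gamma1).
have th0 : 0 <= th by rewrite /th mulr_ge0// ?invr_ge0 ?(ltW N1)// /N.
have X0 : (0 <= X)%E by apply: integral_ge0 => x _; rewrite lee_fin ppow_ge0.
have Xfin : X \is a fin_num.
  rewrite ge0_fin_numE//.
  have cont : continuous (fun x => ppow sob_star (f x)).
    move=> x; apply: continuous_comp; first exact: cf.
    by apply: continuous_ppow; exact: sob_star_gt0.
  have supp x : ~ K x -> ppow sob_star (f x) = 0.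
    by move=> Kx; rewrite f0// ppow_neg// gt_eqF// sob_star_gt0.
  have /integrableP[_] := compact_support_integrable cK cont supp.
  by under eq_integral do rewrite gee0_abs ?lee_fin ?ppow_ge0//.
move: X0 Xfin; case: X => [x| |]// x0 _; rewrite lee_fin in x0.
rewrite -/th => xle.
have {xle} : (x%:E <= (sob_gamma%:E * ((`|A|%:E `^ p^-1) * x%:E `^ (1 - p^-1))) `^ th)%E.
  apply: le_trans xle _; apply: lee_poweR => //.
    by rewrite mule_ge0 ?lee_fin// mule_ge0// poweR_ge0.
  apply: lee_wpmul2l; first by rewrite lee_fin.
  apply: lee_wpmul2r; first exact: poweR_ge0.
  apply: lee_poweR.
  - by rewrite invr_ge0 ltW.
  - by apply: integral_ge0 => y _; rewrite lee_fin powR_ge0.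
  - by apply: le_trans wA _; rewrite lee_fin ler_norm.
rewrite !poweR_EFin lee_fin mulrA powRM ?powR_ge0//; last first.
  by rewrite mulr_ge0// powR_ge0.
rewrite -powRrM -/B (mulrC _ th) -/de => xB.
have [->|xN0] := eqVneq x 0; first exact: powR_ge0.
have xpos : 0 < x by rewrite lt0r xN0.
have {}xB : x `^ (1 - de) <= B.
  rewrite powRB ?xN0 ?implybT// powRr1// ler_pdivrMr//.
  exact: powR_gt0.
have -> : x = (x `^ (1 - de)) `^ (1 - de)^-1.
  by rewrite -powRrM mulfV ?gt_eqF// powRr1.
apply: ge0_ler_powR => //; rewrite ?nnegrE ?powR_ge0//.
by rewrite invr_ge0 ltW.
Qed.

End sobolev_real.


Local Open Scope complex_scope.

(** * Complex vectors as a real Euclidean space *)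

Section complex_vectors.
Context {R : realType}.
Local Notation Re := (@complex.Re R).
Local Notation Im := (@complex.Im R).
Local Notation cmod := (@ComplexField.Normc.normc R).
Implicit Types (a b : R[i]) (t : R).

Lemma cReD a b : Re (a + b) = Re a + Re b. Proof. by case: a; case: b. Qed.
Lemma cImD a b : Im (a + b) = Im a + Im b. Proof. by case: a; case: b. Qed.
Lemma cReN a : Re (- a) = - Re a. Proof. by case: a. Qed.
Lemma cImN a : Im (- a) = - Im a. Proof. by case: a. Qed.
Lemma cReZ t a : Re (t%:C * a) = t * Re a.
Proof. by case: a => x y /=; rewrite mul0r subr0. Qed.
Lemma cImZ t a : Im (t%:C * a) = t * Im a.
Proof. by case: a => x y /=; rewrite mul0r addr0. Qed.
Lemma cReM a b : Re (a * b) = Re a * Re b - Im a * Im b.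
Proof. by case: a; case: b. Qed.
Lemma cImM a b : Im (a * b) = Re a * Im b + Im a * Re b.
Proof. by case: a; case: b. Qed.
Lemma cReJ a : Re (a^*) = Re a. Proof. by case: a. Qed.
Lemma cImJ a : Im (a^*) = - Im a. Proof. by case: a. Qed.
Lemma cRe_sum (I : Type) (s : seq I) (F : I -> R[i]) :
  Re (\sum_(i <- s) F i) = \sum_(i <- s) Re (F i).
Proof. by elim: s => [|i s IH]; rewrite ?big_nil// !big_cons cReD IH. Qed.
Lemma cIm_sum (I : Type) (s : seq I) (F : I -> R[i]) :
  Im (\sum_(i <- s) F i) = \sum_(i <- s) Im (F i).
Proof. by elim: s => [|i s IH]; rewrite ?big_nil// !big_cons cImD IH. Qed.

Lemma eq_complexP a b : Re a = Re b -> Im a = Im b -> a = b.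
Proof. by case: a; case: b => ? ? ? ? /= -> ->. Qed.

Lemma cmodE a : cmod a = Num.sqrt (Re a ^+ 2 + Im a ^+ 2).
Proof. by case: a. Qed.

Lemma cmod_ge0 a : 0 <= cmod a. Proof. by rewrite cmodE sqrtr_ge0. Qed.

Lemma cmod_sqr a : cmod a ^+ 2 = Re a ^+ 2 + Im a ^+ 2.
Proof. by rewrite cmodE sqr_sqrtr// addr_ge0// sqr_ge0. Qed.

Lemma Re_le_cmod a : `|Re a| <= cmod a.
Proof.
rewrite -(@ler_pXn2r _ 2)// ?nnegrE ?cmod_ge0// cmod_sqr real_normK ?num_real//.
by rewrite lerDl sqr_ge0.
Qed.

Lemma Im_le_cmod a : `|Im a| <= cmod a.
Proof.
rewrite -(@ler_pXn2r _ 2)// ?nnegrE ?cmod_ge0// cmod_sqr real_normK ?num_real//.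
by rewrite lerDr sqr_ge0.
Qed.

Section vectors.
Context {m : nat}.
Implicit Types z w : 'rV[R[i]]_m.

(** The real part of the Hermitian inner product. *)
Definition vdot z w : R :=
  \sum_i (Re (z ord0 i) * Re (w ord0 i) + Im (z ord0 i) * Im (w ord0 i)).

Lemma vmodE z : vmod z = Num.sqrt (vdot z z).
Proof.
by rewrite /vmod /vdot; congr Num.sqrt; apply: eq_bigr => i _; rewrite cmod_sqr.
Qed.

Lemma vdot_ge0 z : 0 <= vdot z z.
Proof. by apply: sumr_ge0 => i _; rewrite addr_ge0// -expr2 sqr_ge0. Qed.

Lemma vmod_ge0 z : 0 <= vmod z. Proof. exact: sqrtr_ge0. Qed.

Lemma vmod_sqr z : vmod z ^+ 2 = vdot z z.
Proof. by rewrite vmodE sqr_sqrtr// vdot_ge0. Qed.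

Lemma vdotC z w : vdot z w = vdot w z.
Proof. by apply: eq_bigr => i _; rewrite mulrC (mulrC (Im _)). Qed.

Lemma vdotDr z w w' : vdot z (w + w') = vdot z w + vdot z w'.
Proof.
by rewrite /vdot -big_split; apply: eq_bigr => i _; rewrite mxE cReD cImD /=; ring.
Qed.

Lemma vdotZr t z w : vdot z (t%:C *: w) = t * vdot z w.
Proof.
by rewrite /vdot mulr_sumr; apply: eq_bigr => i _; rewrite mxE cReZ cImZ /=; ring.
Qed.

Lemma vdotDl z z' w : vdot (z + z') w = vdot z w + vdot z' w.
Proof. by rewrite vdotC vdotDr !(vdotC w). Qed.

Lemma vdotZl t z w : vdot (t%:C *: z) w = t * vdot z w.
Proof. by rewrite vdotC vdotZr vdotC. Qed.

Lemma vmodZ t z : vmod (t%:C *: z) = `|t| * vmod z.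
Proof.
by rewrite !vmodE vdotZr vdotZl mulrA sqrtrM -expr2 ?sqr_ge0// sqrtr_sqr.
Qed.

Lemma vmod0 : vmod (0 : 'rV[R[i]]_m) = 0.
Proof.
have := vmodZ 0 0; rewrite normr0 mul0r => <-; congr vmod.
by rewrite scaler0.
Qed.

Lemma vmod_eq0 z : vmod z = 0 -> z = 0.
Proof.
move=> /(congr1 (fun x => x ^+ 2)); rewrite vmod_sqr expr0n/= => /eqP.
rewrite psumr_eq0 => [/allP z0|i _]; last by rewrite addr_ge0// -expr2 sqr_ge0.
apply/rowP => i; have := z0 i; rewrite mem_index_enum => /(_ isT)/=.
rewrite -!expr2 paddr_eq0 ?sqr_ge0// !sqrf_eq0 => /andP[/eqP r0 /eqP i0].
by rewrite mxE; apply: eq_complexP.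
Qed.

(** The squared norm of [z] minus its projection on [w] is nonnegative. *)
Lemma vdot_le z w : vdot z w <= vmod z * vmod w.
Proof.
have [w0|wN0] := eqVneq (vmod w) 0.
  by rewrite w0 mulr0 (vmod_eq0 w0) -(scale0r 0) -[0]/(0%:C) vdotZr mul0r.
have w0 : 0 < vmod w by rewrite lt0r wN0 vmod_ge0.
have [zw|/ltW zw] := leP (vdot z w) 0.
  by rewrite (le_trans zw)// mulr_ge0// vmod_ge0.
rewrite -(@ler_pXn2r _ 2)// ?nnegrE ?mulr_ge0 ?vmod_ge0// exprMn.
have := vdot_ge0 (z + (- (vdot z w / vmod w ^+ 2))%:C *: w).
rewrite vdotDl !vdotDr !vdotZl !vdotZr (vdotC w z) -!vmod_sqr.
have -> : vmod z ^+ 2 + - (vdot z w / vmod w ^+ 2) * vdot z w +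
    (- (vdot z w / vmod w ^+ 2) * vdot z w +
     - (vdot z w / vmod w ^+ 2) * (- (vdot z w / vmod w ^+ 2) * vmod w ^+ 2))
   = vmod z ^+ 2 - vdot z w ^+ 2 / vmod w ^+ 2 by field.
by rewrite subr_ge0 ler_pdivrMr// exprn_gt0.
Qed.

Lemma normr_vdot_le z w : `|vdot z w| <= vmod z * vmod w.
Proof.
rewrite ler_norml vdot_le andbT lerNl.
have -> : - vdot z w = vdot z ((- 1)%:C *: w) by rewrite vdotZr mulN1r.
by rewrite (le_trans (vdot_le _ _))// vmodZ normrN1 mul1r.
Qed.

Lemma ler_vmodD z w : vmod (z + w) <= vmod z + vmod w.
Proof.
rewrite -(@ler_pXn2r _ 2)// ?nnegrE ?addr_ge0 ?vmod_ge0// vmod_sqr.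
rewrite vdotDl !vdotDr (vdotC w z) -!vmod_sqr sqrrD.
have := vdot_le z w; rewrite -mulr_natr; lra.
Qed.

Lemma vmodN z : vmod (- z) = vmod z.
Proof.
by rewrite -[- z]scaleN1r -(rmorphN1 (@real_complex R)) vmodZ normrN1 mul1r.
Qed.

Lemma ler_vmod_sub z w : vmod w <= vmod z + vmod (z - w).
Proof. by rewrite -(vmodN (z - w)) opprB; apply: le_trans (ler_vmodD _ _); rewrite subrKC. Qed.

Lemma cmod_le_vmod z i : cmod (z ord0 i) <= vmod z.
Proof.
rewrite -(@ler_pXn2r _ 2)// ?nnegrE ?vmod_ge0 ?cmod_ge0// vmod_sqr cmod_sqr.
rewrite /vdot (bigD1 i)//= -!expr2 lerDl.
by apply: sumr_ge0 => j _; rewrite addr_ge0// -expr2 sqr_ge0.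
Qed.

End vectors.

Lemma vmod_const a : vmod (const_mx a : 'rV_1) = cmod a.
Proof. by rewrite /vmod big_ord1 mxE sqrtr_sqr ger0_norm// cmod_ge0. Qed.

Definition cdot a b : R := Re a * Re b + Im a * Im b.

Lemma vdot_const a b : vdot (const_mx a : 'rV_1) (const_mx b) = cdot a b.
Proof. by rewrite /vdot big_ord1 !mxE. Qed.

Lemma normr_cdot_le a b : `|cdot a b| <= cmod a * cmod b.
Proof. by rewrite -vdot_const -!vmod_const normr_vdot_le. Qed.

(** Take for [x] and [y] the norms of z and z + w, and for [c] the inner product of z and
    w: the last hypothesis is then the Cauchy-Schwarz inequality for z and z + w. Young's
    inequality turns it into convexity of the p-th power of the norm. *)
Lemma powR_tangent (p x y c : R) : 1 < p -> 0 <= x -> 0 <= y ->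
  x ^+ 2 + c <= x * y -> x `^ p + p * (x `^ (p - 2) * c) <= y `^ p.
Proof.
move=> p1 x0 y0 xyc; have p0 : 0 < p by rewrite (lt_trans _ p1).
have pN0 : p != 0 by rewrite gt_eqF.
have p10 : 0 < p - 1 by rewrite subr_gt0.
have [xE|xN0] := eqVneq x 0.
  have c0 : c <= 0 by move: xyc; rewrite xE expr0n/= mul0r add0r.
  rewrite xE powR0// add0r (@le_trans _ _ 0) ?powR_ge0//.
  by rewrite mulr_ge0_le0 ?(ltW p0)// mulr_ge0_le0// powR_ge0.
have x_gt0 : 0 < x by rewrite lt0r xN0.
have xp2 : x `^ (p - 2) * x ^+ 2 = x `^ p.
  by rewrite -powR_mulrn// -powRD ?subrK// gt_eqF.
have xp1 : x `^ (p - 2) * (x * y) = x `^ (p - 1) * y.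
  rewrite mulrA; congr (_ * _).
  rewrite -[X in _ * X](powRr1 x0) -powRD ?xN0 ?implybT//.
  by congr (_ `^ _); ring.
have h : x `^ p + x `^ (p - 2) * c <= x `^ (p - 1) * y.
  by rewrite -xp1 -xp2 -mulrDr ler_wpM2l// powR_ge0.
have q0 : 0 < p / (p - 1) by rewrite divr_gt0.
have pq : (p / (p - 1))^-1 + p^-1 = 1 by field; rewrite pN0 gt_eqF.
have := @conjugate_powR _ (x `^ (p - 1)) y (p / (p - 1)) p (powR_ge0 _ _) y0 q0 p0 pq.
rewrite -powRrM mulrCA divff ?mulr1 ?gt_eqF// => young.
have {}young : p * (x `^ (p - 1) * y) <= (p - 1) * x `^ p + y `^ p.
  rewrite -(ler_pM2l p0) in young; apply: le_trans young _.
  rewrite le_eqVlt; apply/orP; left; apply/eqP.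
  by field; rewrite pN0 gt_eqF.
have : p * (x `^ p + x `^ (p - 2) * c) <= p * (x `^ (p - 1) * y).
  by rewrite ler_pM2l.
move=> h2; have := le_trans h2 young.
by rewrite mulrDr mulrBl mul1r; lra.
Qed.

Section duality.
Context {m : nat}.
Implicit Types z w : 'rV[R[i]]_m.

(** The real part of the pairing of the conjugate of |z|^(p-2) z with w: this is
    1/p times the derivative of |z|^p in the direction w. *)
Definition dual (p : R) z w : R := vmod z `^ (p - 2) * vdot z w.

Lemma dual_tangent p z w : 1 < p ->
  vmod z `^ p + p * dual p z w <= vmod (z + w) `^ p.
Proof.
move=> p1; apply: powR_tangent => //; rewrite ?vmod_ge0//.
by rewrite vmod_sqr -vdotDr vdot_le.
Qed.

Lemma vmod_powRB1 p z : 1 < p -> vmod z `^ (p - 2) * vmod z = vmod z `^ (p - 1).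
Proof.
move=> p1; have p10 : p - 1 != 0 by rewrite gt_eqF// subr_gt0.
have [->|zN0] := eqVneq (vmod z) 0; first by rewrite mulr0 powR0.
rewrite -[X in _ * X](powRr1 (vmod_ge0 z)) -powRD ?zN0 ?implybT//.
by congr (_ `^ _); ring.
Qed.

Lemma normr_dual_le p z w : 1 < p -> `|dual p z w| <= vmod z `^ (p - 1) * vmod w.
Proof.
move=> p1; rewrite normrM (ger0_norm (powR_ge0 _ _)) -vmod_powRB1// -mulrA.
by rewrite ler_wpM2l ?powR_ge0// normr_vdot_le.
Qed.

Lemma dualzz p z : 1 < p -> dual p z z = vmod z `^ p.
Proof.
move=> p1; rewrite /dual -vmod_sqr expr2 mulrA vmod_powRB1// mulrC mulr_powRB1//.
  exact: vmod_ge0.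
by rewrite (lt_trans _ p1).
Qed.

Lemma dualDr p z w w' : dual p z (w + w') = dual p z w + dual p z w'.
Proof. by rewrite /dual vdotDr mulrDr. Qed.

Lemma dualZr p t z w : dual p z (t%:C *: w) = t * dual p z w.
Proof. by rewrite /dual vdotZr mulrCA. Qed.

(** For p < 2 the factor [vmod z `^ (p - 2)] is unbounded near 0, but the product is at most
    [vmod z `^ (p - 1) * vmod w], which is continuous. *)
Lemma cvg_dual p z w (t : nat -> R) : 1 < p -> t @ \oo --> (0 : R) ->
  dual p (z + (t k)%:C *: w) w @[k --> \oo] --> dual p z w.
Proof.
move=> p1 t0.
have p10 : 0 < p - 1 by rewrite subr_gt0.
have lin (a b : R) : (a + t k * b) @[k --> \oo] --> a.
  have cb : t k * b @[k --> \oo] --> 0 * b by apply: cvgMr_tmp.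
  have ca : a @[_ --> \oo] --> a by exact: cvg_cst.
  by have := cvgD ca cb; rewrite mul0r addr0; exact.
have cd : (vdot (z + (t k)%:C *: w) w) @[k --> \oo] --> vdot z w.
  under eq_fun do rewrite vdotDl vdotZl.
  exact: lin.
have cs : vdot (z + (t k)%:C *: w) (z + (t k)%:C *: w) @[k --> \oo] --> vdot z z.
  under eq_fun do rewrite vdotDr vdotZr.
  have c1 : vdot (z + (t k)%:C *: w) z @[k --> \oo] --> vdot z z.
    under eq_fun do rewrite vdotDl vdotZl.
    exact: lin.
  have := cvgD c1 (cvgM t0 cd); rewrite mul0r addr0; exact.
have cv : vmod (z + (t k)%:C *: w) @[k --> \oo] --> vmod z.
  rewrite vmodE; under eq_fun do rewrite vmodE.
  by apply: (@cvg_comp _ _ _ _ _ _ _ _ cs); exact: sqrt_continuous.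
have cp (a : R) : 0 < a -> vmod (z + (t k)%:C *: w) `^ a @[k --> \oo] --> vmod z `^ a.
  move=> a0; rewrite -(ppow_pos _ (vmod_ge0 z)).
  under eq_fun do rewrite -(ppow_pos _ (vmod_ge0 _)).
  by apply: (@cvg_comp _ _ _ _ _ _ _ _ cv); exact: continuous_ppow.
have [z0|zN0] := eqVneq (vmod z) 0.
  have d0 : dual p z w = 0.
    apply/eqP; rewrite -normr_le0 (le_trans (normr_dual_le _ _ p1))//.
    by rewrite z0 powR0 ?mul0r// gt_eqF.
  rewrite d0.
  have c0 : vmod (z + (t k)%:C *: w) `^ (p - 1) * vmod w @[k --> \oo] --> (0 : R).
    have := cp _ p10; rewrite z0 powR0 ?gt_eqF// => cp0.
    by rewrite -(mul0r (vmod w)); apply: cvgMr_tmp.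
  have c0N : - (vmod (z + (t k)%:C *: w) `^ (p - 1) * vmod w) @[k --> \oo] --> (0 : R).
    by rewrite -oppr0; apply: cvgN.
  apply: (squeeze_cvgr _ c0N c0).
  by near=> k; rewrite -ler_norml normr_dual_le.
have z0 : 0 < vmod z by rewrite lt0r zN0 vmod_ge0.
apply: cvgM => //.
apply: (@cvg_comp _ _ _ _ (@powR R ^~ (p - 2)) _ _ _ cv).
have : {for vmod z, continuous (@powR R ^~ (p - 2))}.
  apply/differentiable_continuous; rewrite -derivable1_diffP.
  by apply: ex_derive; exact: is_derive1_powR.
exact.
Unshelve. all: by end_near. Qed.

End duality.

End complex_vectors.


(** * Test functions *)

Section test_functions.
Context {R : realType} {n : nat}.
Local Notation mu := (@lebesgue_rV R n).
Local Notation Re := (@complex.Re R).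
Local Notation Im := (@complex.Im R).
Local Notation cmod := (@ComplexField.Normc.normc R).
Implicit Types (D : set 'rV[R]_n) (phi psi eta : 'rV[R]_n -> R[i]).
Implicit Types (f g : 'rV[R]_n -> R).

Lemma partial_lin (a b : R) f g i x :
  derivable f x (delta_mx ord0 i) -> derivable g x (delta_mx ord0 i) ->
  partial i (fun y => a * f y + b * g y) x = a * partial i f x + b * partial i g x.
Proof.
move=> df dg; rewrite /partial.
rewrite -[fun y => _]/((a \*: (f : _ -> R^o)) + (b \*: (g : _ -> R^o))).
rewrite deriveD; [|exact: derivableZ..].
by rewrite !deriveZ.
Qed.

Lemma derivable_lin (a b : R) f g i x :
  derivable f x (delta_mx ord0 i) -> derivable g x (delta_mx ord0 i) ->
  derivable (fun y => a * f y + b * g y) x (delta_mx ord0 i).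
Proof.
move=> df dg.
rewrite -[fun y => _]/((a \*: (f : _ -> R^o)) + (b \*: (g : _ -> R^o))).
by apply: derivableD; exact: derivableZ.
Qed.

Lemma foldr_partial_lin (a b : R) f g (l : seq 'I_n) : smooth f -> smooth g ->
  foldr (@partial R n) (fun y => a * f y + b * g y) l =
  (fun y => a * foldr (@partial R n) f l y + b * foldr (@partial R n) g l y).
Proof.
move=> sf sg; elim: l => [//|i l IH] /=; rewrite IH.
by apply/funext => x; apply: partial_lin; [case: (sf l)|case: (sg l)].
Qed.

Lemma smooth_lin (a b : R) f g : smooth f -> smooth g ->
  smooth (fun y => a * f y + b * g y).
Proof.
move=> sf sg l; rewrite /= foldr_partial_lin//.
have [cf df] := sf l; have [cg dg] := sg l.
split=> [x|i x]; last exact: derivable_lin.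
apply: (@continuousD _ _ _ (fun y => a * foldr (@partial R n) f l y)
  (fun y => b * foldr (@partial R n) g l y)); apply: continuousM.
- exact: cst_continuous.
- exact: cf.
- exact: cst_continuous.
- exact: cg.
Qed.

Lemma smooth_derivable f i x : smooth f -> derivable f x (delta_mx ord0 i).
Proof. by move=> /(_ [::])[]. Qed.

Lemma smooth_C1c K f : smooth f -> (forall x, ~ K x -> f x = 0) -> C1c K f.
Proof.
move=> sf f0; split=> //.
- by have [] := sf [::].
- by move=> i x; exact: smooth_derivable.
- by move=> i; have [] := sf [:: i].
Qed.

Lemma test_function_C1c D phi : test_function D phi ->
  exists K, [/\ compact K, K `<=` D, C1c K (Re \o phi) & C1c K (Im \o phi)].
Proof.
move=> [sr si [K [cK KD phi0]]]; exists K; split=> //.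
  by apply: smooth_C1c => // x /phi0 /= ->.
by apply: smooth_C1c => // x /phi0 /= ->.
Qed.

Lemma test_functionDZ D phi eta (t : R) : test_function D phi ->
  test_function D eta -> test_function D (fun x => phi x + t%:C * eta x).
Proof.
move=> [sr si [K [cK KD phi0]]] [sr' si' [K' [cK' KD' eta0]]].
have smooth_sum (F : R[i] -> R) : (forall x y, F (x + t%:C * y) = 1 * F x + t * F y) ->
    smooth (F \o phi) -> smooth (F \o eta) ->
    smooth (F \o (fun x => phi x + t%:C * eta x)).
  move=> FE s s'; have := smooth_lin 1 t s s'.
  by congr smooth; apply/funext => x /=; rewrite FE.
split.
- by apply: smooth_sum => // x y; rewrite cReD cReZ mul1r.
- by apply: smooth_sum => // x y; rewrite cImD cImZ mul1r.
exists (K `|` K'); split.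
- exact: compactU.
- by move=> x [/KD|/KD'].
- by move=> x /not_orP[/phi0 -> /eta0 ->]; rewrite mulr0 addr0.
Qed.

Lemma gradDZ D phi eta (t : R) x : test_function D phi -> test_function D eta ->
  grad (fun x => phi x + t%:C * eta x) x = grad phi x + t%:C *: grad eta x.
Proof.
move=> [sr si _] [sr' si' _].
apply/rowP => i; rewrite !mxE; apply: eq_complexP.
  rewrite cReD cReZ /= -[X in X + _]mul1r -partial_lin; last 2 first.
  - exact: smooth_derivable.
  - exact: smooth_derivable.
  by congr (partial _ _ _); apply/funext => y /=; rewrite cReD cReZ mul1r.
rewrite cImD cImZ /= -[X in X + _]mul1r -partial_lin; last 2 first.
- exact: smooth_derivable.
- exact: smooth_derivable.
by congr (partial _ _ _); apply/funext => y /=; rewrite cImD cImZ mul1r.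
Qed.

Lemma partialN f i x : smooth f -> partial i (fun y => - f y) x = - partial i f x.
Proof.
move=> sf; rewrite (_ : (fun y => - f y) = fun y => (-1) * f y + 0 * f y).
  by rewrite partial_lin ?mul0r ?addr0 ?mulN1r//; exact: smooth_derivable.
by apply/funext => y; rewrite mul0r addr0 mulN1r.
Qed.

Lemma smoothN f : smooth f -> smooth (fun y => - f y).
Proof.
move=> sf; rewrite (_ : (fun y => - f y) = fun y => (-1) * f y + 0 * f y).
  exact: smooth_lin.
by apply/funext => y; rewrite mul0r addr0 mulN1r.
Qed.

Lemma test_function_conj D psi : test_function D psi ->
  test_function D (fun x => (psi x)^*).
Proof.
move=> [sr si [K [cK KD psi0]]]; split.
- by move: sr; congr smooth; apply/funext => x /=; rewrite cReJ.
- by have := smoothN si; congr smooth; apply/funext => x /=; rewrite cImJ.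
- by exists K; split=> // x /psi0 ->; rewrite conjc0.
Qed.

Lemma grad_conj D psi x i : test_function D psi ->
  grad (fun x => (psi x)^*) x ord0 i = (grad psi x ord0 i)^*.
Proof.
move=> [sr si _]; rewrite !mxE; apply: eq_complexP => /=.
  by congr (partial _ _ _); apply/funext => y /=; rewrite cReJ.
by rewrite -partialN//; congr (partial _ _ _); apply/funext => y /=; rewrite cImJ.
Qed.

(** The imaginary unit times the conjugate. *)
Definition swapc (z : R[i]) : R[i] := Im z +i* Re z.

Lemma test_function_swap D psi : test_function D psi ->
  test_function D (swapc \o psi).
Proof.
by move=> [sr si [K [cK KD psi0]]]; split=> //; exists K; split=> // x /psi0 /= ->.
Qed.

Lemma grad_swap psi x i : grad (swapc \o psi) x ord0 i = swapc (grad psi x ord0 i).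
Proof. by rewrite !mxE. Qed.

(** Testing with conjugates and with conjugates multiplied by the imaginary unit
    separates the real and the imaginary part of the equation, which thus says
    that a single real-linear identity holds for all complex test functions. *)
Lemma weak_solutionP D (p E : R) (V : 'rV[R]_n -> R) (u : 'rV[R]_n -> R[i])
    (g : 'rV[R]_n -> 'rV[R[i]]_n) :
  weak_solution D p E V u g <->
  (forall eta, test_function D eta ->
    \int[mu]_(x in D) dual p (g x) (grad eta x) =
    \int[mu]_(x in D) (E * V x * cmod (u x) `^ (p - 2) * cdot (u x) (eta x))).
Proof.
have lhs c (z w : 'rV[R[i]]_n) : \sum_i c%:C * z ord0 i * w ord0 i =
    (c * \sum_i (Re (z ord0 i) * Re (w ord0 i) - Im (z ord0 i) * Im (w ord0 i))) +i*
    (c * \sum_i (Re (z ord0 i) * Im (w ord0 i) + Im (z ord0 i) * Re (w ord0 i))).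
  apply: eq_complexP; rewrite ?cRe_sum ?cIm_sum /= mulr_sumr; apply: eq_bigr => i _.
    by rewrite -mulrA cReZ cReM.
  by rewrite -mulrA cImZ cImM.
have reE c (z w : R[i]) : Re (c%:C * z * w) = c * (Re z * Re w - Im z * Im w).
  by rewrite -mulrA cReZ cReM.
have imE c (z w : R[i]) : Im (c%:C * z * w) = c * (Re z * Im w + Im z * Re w).
  by rewrite -mulrA cImZ cImM.
split=> [ws eta teta|ws psi tpsi].
  have tpsi := test_function_conj teta.
  have /(congr1 Re)/= := ws _ tpsi.
  under eq_Rintegral do rewrite lhs/=.
  under [in X in _ = X]eq_Rintegral do rewrite reE cReJ cImJ mulrN opprK.
  move=> H; rewrite -[RHS]H; apply: eq_Rintegral => x _; congr (_ * _).
  apply: eq_bigr => i _.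
  by rewrite (grad_conj _ _ teta) cReJ cImJ mulrN opprK.
apply: eq_complexP => /=.
  transitivity (\int[mu]_(x in D) dual p (g x) (grad (fun x => (psi x)^*) x)).
    apply: eq_Rintegral => x _; rewrite lhs/=; congr (_ * _).
    by apply: eq_bigr => i _; rewrite (grad_conj _ _ tpsi) cReJ cImJ mulrN.
  rewrite (ws _ (test_function_conj tpsi)); apply: eq_Rintegral => x _.
  by rewrite reE /cdot cReJ cImJ mulrN.
transitivity (\int[mu]_(x in D) dual p (g x) (grad (swapc \o psi) x)).
  apply: eq_Rintegral => x _; rewrite lhs/=; congr (_ * _).
  by apply: eq_bigr => i _; rewrite grad_swap.
rewrite (ws _ (test_function_swap tpsi)); apply: eq_Rintegral => x _.
by rewrite imE.
Qed.

End test_functions.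


(** * Norms, integrability, and the Sobolev space *)

Section norms.
Context {R : realType} {n : nat}.
Local Notation mu := (@lebesgue_rV R n).
Local Notation Re := (@complex.Re R).
Local Notation Im := (@complex.Im R).
Local Notation cmod := (@ComplexField.Normc.normc R).
Implicit Types (D K : set 'rV[R]_n) (f h : 'rV[R]_n -> R).

Lemma continuous_sqrtr (f : 'rV[R]_n -> R) : continuous f ->
  continuous (fun x => Num.sqrt (f x)).
Proof.
by move=> cf x; apply: continuous_comp; [exact: cf|exact: sqrt_continuous].
Qed.

Lemma measurable_sqrtr : measurable_fun [set: R] (@Num.sqrt R).
Proof. by apply: continuous_measurable_fun; exact: sqrt_continuous. Qed.

Lemma LnormD_ge0 D (s : \bar R) f : (0 <= LnormD D s f)%E.
Proof. exact: Lnorm_ge0. Qed.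

Lemma integrable_cst_finite D (c : R) : measurable D -> (mu D < +oo)%E ->
  mu.-integrable D (EFin \o cst c).
Proof.
move=> mD Dfin; apply/integrableP; split; first by apply/measurable_EFinP; exact: measurable_cst.
apply: (@le_lt_trans _ _ (\int[mu]_(x in D) (cst `|c|%:E) x)%E) => //.
by rewrite integral_cst// lte_mul_pinfty// lee_fin.
Qed.

Lemma LnormDE D (p : R) f : measurable D -> p != 0 -> (forall x, 0 <= f x) ->
  LnormD D p%:E f = ((\int[mu]_(x in D) (f x `^ p)%:E) `^ p^-1)%E.
Proof.
move=> mD p0 f0; rewrite /LnormD unlock [in RHS]integral_mkcond; congr (_ `^ _)%E.
apply: eq_integral => x _; rewrite /= !patchE; case: ifPn => _.
  by rewrite ger0_norm.
by rewrite normr0 powR0.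
Qed.

Lemma LnormD_powR D (p : R) f : measurable D -> p != 0 -> (forall x, 0 <= f x) ->
  (LnormD D p%:E f `^ p)%E = (\int[mu]_(x in D) (f x `^ p)%:E)%E.
Proof.
move=> mD p0 f0; rewrite LnormDE// -poweRrM mulVf// poweRe1//.
by apply: integral_ge0 => x _; rewrite lee_fin powR_ge0.
Qed.

Lemma LnormD_lty D (p : R) f : measurable D -> 0 < p -> (forall x, 0 <= f x) ->
  (LnormD D p%:E f < +oo)%E <-> (\int[mu]_(x in D) (f x `^ p)%:E < +oo)%E.
Proof.
move=> mD p0 f0; have pN0 : p != 0 by rewrite gt_eqF.
split=> [|fi]; first by rewrite -LnormD_powR//; exact: poweR_lty.
by rewrite LnormDE//; exact: poweR_lty.
Qed.

Lemma cmeasurable_cmod D (u : 'rV[R]_n -> R[i]) : cmeasurable D u ->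
  measurable_fun D (cmod \o u).
Proof.
move=> [mr mi]; rewrite (_ : cmod \o u = fun x => Num.sqrt (Re (u x) ^+ 2 + Im (u x) ^+ 2)).
  apply: (measurableT_comp measurable_sqrtr).
  by apply: measurable_funD; exact: measurable_funX.
by apply/funext => x /=; rewrite cmodE.
Qed.

Lemma measurable_vdot m D (g g' : 'rV[R]_n -> 'rV[R[i]]_m) :
  (forall i, cmeasurable D (fun x => g x ord0 i)) ->
  (forall i, cmeasurable D (fun x => g' x ord0 i)) ->
  measurable_fun D (fun x => vdot (g x) (g' x)).
Proof.
move=> mg mg'; apply: measurable_sum => i.
have [mr mi] := mg i; have [mr' mi'] := mg' i.
by apply: measurable_funD; exact: measurable_funM.
Qed.

Lemma measurable_vmod m D (g : 'rV[R]_n -> 'rV[R[i]]_m) :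
  (forall i, cmeasurable D (fun x => g x ord0 i)) ->
  measurable_fun D (fun x => vmod (g x)).
Proof.
move=> mg; under eq_fun do rewrite vmodE.
by apply: (measurableT_comp measurable_sqrtr); exact: measurable_vdot.
Qed.

Lemma measurable_powR_comp D (p : R) f : measurable_fun D f ->
  measurable_fun D (fun x => f x `^ p).
Proof. by move=> mf; exact: (measurableT_comp (measurable_powR p)). Qed.

Lemma measurable_dual m D p (g g' : 'rV[R]_n -> 'rV[R[i]]_m) :
  (forall i, cmeasurable D (fun x => g x ord0 i)) ->
  (forall i, cmeasurable D (fun x => g' x ord0 i)) ->
  measurable_fun D (fun x => dual p (g x) (g' x)).
Proof.
move=> mg mg'; apply: measurable_funM; last exact: measurable_vdot.
by apply: measurable_powR_comp; exact: measurable_vmod.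
Qed.

Lemma cmeasurableDZ D (t : R) (u v : 'rV[R]_n -> R[i]) :
  cmeasurable D u -> cmeasurable D v -> cmeasurable D (fun x => u x + t%:C * v x).
Proof.
move=> [mr mi] [mr' mi']; split.
  rewrite (_ : _ \o _ = fun x => Re (u x) + t * Re (v x)).
    by apply: measurable_funD => //; exact: measurable_funM.
  by apply/funext => x /=; rewrite cReD cReZ.
rewrite (_ : _ \o _ = fun x => Im (u x) + t * Im (v x)).
  by apply: measurable_funD => //; exact: measurable_funM.
by apply/funext => x /=; rewrite cImD cImZ.
Qed.

Lemma cmeasurableB D (u v : 'rV[R]_n -> R[i]) :
  cmeasurable D u -> cmeasurable D v -> cmeasurable D (fun x => u x - v x).
Proof.
move=> mu_ mv; have := cmeasurableDZ (-1) mu_ mv.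
by congr cmeasurable; apply/funext => x; rewrite rmorphN1 mulN1r.
Qed.

Lemma cmeasurable_rowB m D (g g' : 'rV[R]_n -> 'rV[R[i]]_m) i :
  cmeasurable D (fun x => g x ord0 i) -> cmeasurable D (fun x => g' x ord0 i) ->
  cmeasurable D (fun x => (g x - g' x) ord0 i).
Proof. by move=> mg mg'; under eq_fun do rewrite !mxE; exact: cmeasurableB. Qed.

Lemma cmeasurableM D (u v : 'rV[R]_n -> R[i]) :
  cmeasurable D u -> cmeasurable D v -> cmeasurable D (fun x => u x * v x).
Proof.
move=> [mr mi] [mr' mi']; split.
  rewrite (_ : _ \o _ = fun x => Re (u x) * Re (v x) - Im (u x) * Im (v x)).
    by apply: measurable_funB => //; exact: measurable_funM.
  by apply/funext => x /=; rewrite cReM.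
rewrite (_ : _ \o _ = fun x => Re (u x) * Im (v x) + Im (u x) * Re (v x)).
  by apply: measurable_funD => //; exact: measurable_funM.
by apply/funext => x /=; rewrite cImM.
Qed.

Lemma integrable_powRP D (p : R) f : measurable D -> measurable_fun D f ->
  mu.-integrable D (EFin \o (fun x => f x `^ p)) <->
  (\int[mu]_(x in D) (f x `^ p)%:E < +oo)%E.
Proof.
move=> mD mf; split=> [/integrableP[_]|fi].
  by under eq_integral do rewrite gee0_abs ?lee_fin ?powR_ge0//.
apply/integrableP; split; first by apply/measurable_EFinP; exact: measurable_powR_comp.
by under eq_integral do rewrite gee0_abs ?lee_fin ?powR_ge0//.
Qed.

Lemma in_LpP D p (u : 'rV[R]_n -> R[i]) : measurable D -> 0 < p ->
  in_Lp D p u <->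
  cmeasurable D u /\ mu.-integrable D (EFin \o (fun x => cmod (u x) `^ p)).
Proof.
move=> mD p0; split=> -[mu0 lu]; split=> //.
  apply/integrable_powRP => //; first exact: cmeasurable_cmod.
  by apply/(LnormD_lty mD p0) => // x; exact: cmod_ge0.
apply/(LnormD_lty mD p0); first by move=> x; exact: cmod_ge0.
by apply/integrable_powRP => //; exact: cmeasurable_cmod.
Qed.

Lemma in_Lp_vecP D p (g : 'rV[R]_n -> 'rV[R[i]]_n) : measurable D -> 0 < p ->
  in_Lp_vec D p g <->
  (forall i, cmeasurable D (fun x => g x ord0 i)) /\
  mu.-integrable D (EFin \o (fun x => vmod (g x) `^ p)).
Proof.
move=> mD p0; split=> -[mg lg]; split=> //.
  apply/integrable_powRP => //; first exact: measurable_vmod.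
  by apply/(LnormD_lty mD p0) => // x; exact: vmod_ge0.
apply/(LnormD_lty mD p0); first by move=> x; exact: vmod_ge0.
by apply/integrable_powRP => //; exact: measurable_vmod.
Qed.

Lemma powRD_le (p a b : R) : 0 <= p -> 0 <= a -> 0 <= b ->
  (a + b) `^ p <= 2 `^ p * (a `^ p + b `^ p).
Proof.
move=> p0 a0 b0; rewrite mulrDr -!powRM//.
have [ab|/ltW ba] := leP a b.
  apply: (@le_trans _ _ ((2 * b) `^ p)); last by rewrite lerDr powR_ge0.
  by apply: ge0_ler_powR; rewrite ?nnegrE ?addr_ge0 ?mulr_ge0//; lra.
apply: (@le_trans _ _ ((2 * a) `^ p)); last by rewrite lerDl powR_ge0.
by apply: ge0_ler_powR; rewrite ?nnegrE ?addr_ge0 ?mulr_ge0//; lra.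
Qed.

Lemma integrable_powRD D (p : R) f h (e : 'rV[R]_n -> R) : measurable D -> 0 <= p ->
  measurable_fun D e -> (forall x, 0 <= e x <= f x + h x) ->
  (forall x, 0 <= f x) -> (forall x, 0 <= h x) ->
  mu.-integrable D (EFin \o (fun x => f x `^ p)) ->
  mu.-integrable D (EFin \o (fun x => h x `^ p)) ->
  mu.-integrable D (EFin \o (fun x => e x `^ p)).
Proof.
move=> mD p0 me efh f0 h0 fi hi.
have := integrableZl mD (2 `^ p) (integrableD mD fi hi).
apply: le_integrable => //.
  by apply/measurable_EFinP; exact: measurable_powR_comp.
move=> x _; have /andP[e0 efhx] := efh x.
rewrite /= !ger0_norm ?powR_ge0 ?mulr_ge0 ?addr_ge0 ?powR_ge0// lee_fin.
apply: le_trans (powRD_le p0 (f0 x) (h0 x)).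
by apply: ge0_ler_powR; rewrite ?nnegrE// (le_trans e0).
Qed.

Lemma integrable_of_powR D (p : R) f : measurable D -> (mu D < +oo)%E -> 1 <= p ->
  measurable_fun D f -> (forall x, 0 <= f x) ->
  mu.-integrable D (EFin \o (fun x => f x `^ p)) ->
  mu.-integrable D (EFin \o f).
Proof.
move=> mD Dfin p1 mf f0 fi.
have i1 : mu.-integrable D (EFin \o cst (1 : R)).
  exact: integrable_cst_finite.
have := integrableD mD i1 fi.
apply: le_integrable => //; first exact/measurable_EFinP.
move=> x _ /=; rewrite !ger0_norm ?addr_ge0 ?powR_ge0// lee_fin.
have [f1|/ltW f1] := leP (f x) 1; first by rewrite (le_trans f1)// lerDl powR_ge0.
by rewrite (le_trans (le1r_powR f1 p1))// lerDr.
Qed.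

Lemma Rintegral_support D f : (forall x, ~ D x -> f x = 0) ->
  \int[mu]_(x in D) f x = \int[mu]_x f x.
Proof.
move=> f0; rewrite Rintegral_mkcond; apply: eq_Rintegral => x _.
rewrite patchE; case: ifPn => // /negP xD.
by rewrite f0// => Dx; apply: xD; rewrite inE.
Qed.

End norms.


Section test_functions_sobolev.
Context {R : realType} {n : nat}.
Local Notation mu := (@lebesgue_rV R n).
Local Notation Re := (@complex.Re R).
Local Notation Im := (@complex.Im R).
Local Notation cmod := (@ComplexField.Normc.normc R).
Implicit Types (D K : set 'rV[R]_n) (phi psi eta u : 'rV[R]_n -> R[i]).
Implicit Types (F G : 'rV[R]_n -> R[i]) (g : 'rV[R]_n -> 'rV[R[i]]_n).

Lemma continuous_vmod m (G : 'rV[R]_n -> 'rV[R[i]]_m) :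
  (forall i, continuous (fun x => Re (G x ord0 i))) ->
  (forall i, continuous (fun x => Im (G x ord0 i))) ->
  continuous (fun x => vmod (G x)).
Proof.
move=> cr ci; under eq_fun do rewrite vmodE.
apply: continuous_sqrtr; rewrite /vdot.
apply: (@continuous_big _ _ _ _ _ _ _ _ (fun i x => Re (G x ord0 i) * Re (G x ord0 i) +
  Im (G x ord0 i) * Im (G x ord0 i))) => [|i _ x]; first exact: add_continuous.
apply: (@continuousD _ _ _ (fun x => Re (G x ord0 i) * Re (G x ord0 i))
  (fun x => Im (G x ord0 i) * Im (G x ord0 i))); apply: continuousM.
- exact: cr.
- exact: cr.
- exact: ci.
- exact: ci.
Qed.

Lemma measurable_sub_setT D (f : 'rV[R]_n -> R) : continuous f -> measurable_fun D f.
Proof. by move=> /continuous_measurable_rV; exact: measurable_funTS. Qed.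

Lemma test_function_measurable D E phi : test_function D phi ->
  cmeasurable E phi /\ forall i, cmeasurable E (fun x => grad phi x ord0 i).
Proof.
move=> /test_function_C1c[K [cK KD [cr dr cdr r0] [ci di cdi i0]]]; split.
  by split; exact: measurable_sub_setT.
move=> i; split.
  rewrite (_ : _ \o _ = partial i (Re \o phi)); first exact: measurable_sub_setT.
  by apply/funext => x; rewrite /= mxE.
rewrite (_ : _ \o _ = partial i (Im \o phi)); first exact: measurable_sub_setT.
by apply/funext => x; rewrite /= mxE.
Qed.

Lemma test_function_continuous D phi : test_function D phi -> exists K,
  [/\ compact K, K `<=` D,
      continuous (fun x => cmod (phi x)) /\ continuous (fun x => vmod (grad phi x)) &
      forall x, ~ K x -> phi x = 0 /\ grad phi x = 0].
Proof.
move=> /test_function_C1c[K [cK KD [cr dr cdr r0] [ci di cdi i0]]]; exists K.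
split=> //.
  split.
    under eq_fun do rewrite -vmod_const.
    apply: continuous_vmod => i.
      by under eq_fun do rewrite mxE; exact: cr.
    by under eq_fun do rewrite mxE; exact: ci.
  apply: continuous_vmod => i.
    by under eq_fun do rewrite mxE /=; exact: cdr.
  by under eq_fun do rewrite mxE /=; exact: cdi.
move=> x Kx; split; first by apply: eq_complexP; [exact: r0|exact: i0].
apply/rowP => i; rewrite !mxE; apply: eq_complexP => /=.
  exact: partial_support cK r0 Kx.
exact: partial_support cK i0 Kx.
Qed.

Lemma test_function_bounded D phi : test_function D phi ->
  exists2 B : R, 0 < B & forall x, cmod (phi x) <= B /\ vmod (grad phi x) <= B.
Proof.
move=> /test_function_continuous[K [cK KD [c1 c2] s0]].
have [|B B0 h1] := compact_support_bounded cK c1.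
  by move=> x /s0[-> _]; rewrite ComplexField.Normc.normc0.
have [|B' B0' h2] := compact_support_bounded cK c2.
  by move=> x /s0[_ ->]; rewrite vmod0.
exists (B + B'); first by rewrite addr_gt0.
move=> x; split.
  by have := h1 x; rewrite ger0_norm ?cmod_ge0// => /le_trans; apply; rewrite lerDl ltW.
by have := h2 x; rewrite ger0_norm ?vmod_ge0// => /le_trans; apply; rewrite lerDr ltW.
Qed.

Lemma test_function_integrable D (p : R) phi : measurable D -> 0 < p ->
  test_function D phi ->
  mu.-integrable D (EFin \o (fun x => cmod (phi x) `^ p)) /\
  mu.-integrable D (EFin \o (fun x => vmod (grad phi x) `^ p)).
Proof.
move=> mD p0 /test_function_continuous[K [cK KD [c1 c2] s0]].
have pN0 : p != 0 by rewrite gt_eqF.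
have cp (f : 'rV[R]_n -> R) : (forall x, 0 <= f x) -> continuous f ->
    continuous (fun x => f x `^ p).
  move=> f0 cf; under eq_fun do rewrite -(ppow_pos _ (f0 _)).
  by move=> x; apply: continuous_comp; [exact: cf|exact: continuous_ppow].
have sub (f : 'rV[R]_n -> R) : mu.-integrable setT (EFin \o f) ->
    mu.-integrable D (EFin \o f).
  by apply: integrableS.
split; apply: sub; apply: (compact_support_integrable cK).
- by apply: cp => // x; exact: cmod_ge0.
- by move=> x /s0[-> _]; rewrite ComplexField.Normc.normc0 powR0.
- by apply: cp => // x; exact: vmod_ge0.
- by move=> x /s0[_ ->]; rewrite vmod0 powR0.
Qed.

Definition cintegrable D F : Prop :=
  mu.-integrable D (EFin \o (Re \o F)) /\ mu.-integrable D (EFin \o (Im \o F)).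

Lemma cintegrable_le D F (h : 'rV[R]_n -> R) : measurable D -> cmeasurable D F ->
  (forall x, D x -> cmod (F x) <= h x) -> mu.-integrable D (EFin \o h) ->
  cintegrable D F.
Proof.
move=> mD [mr mi] Fh hi; split; apply: le_integrable hi => //.
- exact/measurable_EFinP.
- move=> x Dx /=; rewrite lee_fin (le_trans (Re_le_cmod _))//.
  by rewrite (le_trans (Fh x Dx))// ler_norm.
- exact/measurable_EFinP.
- move=> x Dx /=; rewrite lee_fin (le_trans (Im_le_cmod _))//.
  by rewrite (le_trans (Fh x Dx))// ler_norm.
Qed.

Lemma cintegralDZ D F G (t : R) : measurable D -> cintegrable D F ->
  cintegrable D G ->
  cintegral D (fun x => F x + t%:C * G x) = cintegral D F + t%:C * cintegral D G.
Proof.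
move=> mD [Fr Fi] [Gr Gi]; apply: eq_complexP.
  rewrite cReD cReZ /=; under eq_Rintegral do rewrite cReD cReZ.
  rewrite RintegralD// ?RintegralZl//.
  exact: (integrableZl mD t Gr).
rewrite cImD cImZ /=; under eq_Rintegral do rewrite cImD cImZ.
rewrite RintegralD// ?RintegralZl//.
exact: (integrableZl mD t Gi).
Qed.

Lemma cintegrable_bounded D (p B : R) F G : measurable D -> (mu D < +oo)%E ->
  1 <= p -> cmeasurable D F ->
  mu.-integrable D (EFin \o (fun x => cmod (F x) `^ p)) ->
  cmeasurable D G -> (forall x, cmod (G x) <= B) ->
  cintegrable D (fun x => F x * G x).
Proof.
move=> mD Dfin p1 mF Fp mG GB.
apply: (@cintegrable_le _ _ (fun x => B * cmod (F x))) => //.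
- exact: cmeasurableM.
- move=> x _; rewrite ComplexField.Normc.normcM mulrC ler_wpM2r ?cmod_ge0//.
- have := @integrable_of_powR _ _ D p (fun x => cmod (F x)) mD Dfin p1
    (cmeasurable_cmod mF) (fun x => cmod_ge0 (F x)) Fp.
  exact: integrableZl.
Qed.

Lemma test_function_weak_gradient D phi : measurable D -> test_function D phi ->
  weak_gradient D phi (grad phi).
Proof.
move=> mD tphi psi tpsi i.
have [K [cK KD Cr Ci]] := test_function_C1c tphi.
have [K' [cK' KD' Cr' Ci']] := test_function_C1c tpsi.
have cKK := compactU cK cK'.
have sK : K `<=` K `|` K' by move=> x; left.
have sK' : K' `<=` K `|` K' by move=> x; right.
have inti (f h : 'rV[R]_n -> R) : continuous f -> continuous h ->
    (forall x, ~ (K `|` K') x -> f x = 0 \/ h x = 0) ->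
    mu.-integrable D (EFin \o (fun x => f x * h x)).
  move=> cf ch fh0; apply: (@integrableS _ _ _ mu setT) => //.
  apply: (compact_support_integrable cKK).
    by move=> x; apply: continuousM; [exact: cf|exact: ch].
  by move=> x /fh0[] ->; rewrite ?mul0r ?mulr0.
have part (f h : 'rV[R]_n -> R) : C1c K f -> C1c K' h ->
    \int[mu]_(x in D) (f x * partial i h x) = - \int[mu]_(x in D) (partial i f x * h x).
  move=> Cf Ch.
  have [_ _ _ f0] := Cf; have [_ _ _ h0] := Ch.
  rewrite (@Rintegral_support _ _ D (fun x => f x * partial i h x)); last first.
    by move=> x Dx; rewrite f0 ?mul0r// => /KD.
  rewrite (@Rintegral_support _ _ D (fun x => partial i f x * h x)); last first.
    by move=> x Dx; rewrite h0 ?mulr0// => /KD'.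
  by apply: (integration_by_parts_rV _ cKK); [exact: C1c_subset Cf|exact: C1c_subset Ch].
have ii (f h : 'rV[R]_n -> R) : C1c K f -> C1c K' h ->
    mu.-integrable D (EFin \o (fun x => f x * partial i h x)) /\
    mu.-integrable D (EFin \o (fun x => partial i f x * h x)).
  move=> [cf df cdf f0] [ch dh cdh h0]; split; apply: inti => // x /not_orP[Kx K'x].
    by left; exact: f0.
  by right; exact: h0.
have [rr rr'] := ii _ _ Cr Cr'; have [ri ri'] := ii _ _ Cr Ci'.
have [ir ir'] := ii _ _ Ci Cr'; have [jj jj'] := ii _ _ Ci Ci'.
apply: eq_complexP; rewrite /= ?cReN ?cImN /=.
  under eq_Rintegral do rewrite cReM mxE/=.
  under [in RHS]eq_Rintegral do rewrite cReM mxE/=.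
  by rewrite !RintegralB// opprB (part _ _ Cr Cr') (part _ _ Ci Ci') opprK addrC.
under eq_Rintegral do rewrite cImM mxE/=.
under [in RHS]eq_Rintegral do rewrite cImM mxE/=.
by rewrite !RintegralD// opprD (part _ _ Cr Ci') (part _ _ Ci Cr').
Qed.

Lemma test_function_sobolev0 D (p : R) phi : measurable D -> 1 < p ->
  test_function D phi -> sobolev0 D p phi (grad phi).
Proof.
move=> mD p1 tphi; have p0 : 0 < p by rewrite (lt_trans _ p1).
have [mphi mgrad] := test_function_measurable D tphi.
have [i1 i2] := test_function_integrable mD p0 tphi.
split.
  split; last exact: test_function_weak_gradient.
    exact/in_LpP.
  exact/in_Lp_vecP.
have z (f : 'rV[R]_n -> R) (e : R) : 0 < e -> (forall x, f x = 0) ->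
    (LnormD D p%:E f < e%:E)%E.
  move=> e0 f0; rewrite (_ : f = cst 0); last by apply/funext => x; rewrite f0.
  rewrite LnormDE// ?gt_eqF// integral0_eq ?poweR0r ?lte_fin//.
    by rewrite invr_eq0 gt_eqF.
  by move=> x _; rewrite powR0// gt_eqF.
move=> e e0; exists phi; split=> //; apply: z => // x; rewrite subrr.
  by rewrite ComplexField.Normc.normc0.
by rewrite vmod0.
Qed.

Lemma sobolev0_addZ D (p t : R) u g eta : measurable D -> (mu D < +oo)%E -> 1 < p ->
  sobolev0 D p u g -> test_function D eta ->
  sobolev0 D p (fun x => u x + t%:C * eta x) (fun x => g x + t%:C *: grad eta x).
Proof.
move=> mD Dfin p1 [[Lu Lg wug] ap] teta; have p0 : 0 < p by rewrite (lt_trans _ p1).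
have [mu_ ui] := (in_LpP _ mD p0).1 Lu; have [mg gi] := (in_Lp_vecP _ mD p0).1 Lg.
have [meta mgrad] := test_function_measurable D teta.
have [i1 i2] := test_function_integrable mD p0 teta.
have scale (f : 'rV[R]_n -> R) : (forall x, 0 <= f x) ->
    mu.-integrable D (EFin \o (fun x => f x `^ p)) ->
    mu.-integrable D (EFin \o (fun x => (`|t| * f x) `^ p)).
  move=> f0 fi; have := integrableZl mD (`|t| `^ p) fi.
  by apply: eq_integrable => // x _ /=; rewrite powRM.
have mg' i : cmeasurable D (fun x => (g x + t%:C *: grad eta x) ord0 i).
  by under eq_fun do rewrite !mxE; have := cmeasurableDZ t (mg i) (mgrad i);
    under eq_fun do rewrite mxE.
split; first split.
- apply/(in_LpP _ mD p0); split; first exact: cmeasurableDZ.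
  apply: (@integrable_powRD _ _ D p (fun x => cmod (u x)) (fun x => `|t| * cmod (eta x))) => //.
  + exact: ltW.
  + by apply: cmeasurable_cmod; exact: cmeasurableDZ.
  + move=> x; rewrite cmod_ge0 -!vmod_const -vmodZ /=.
    apply: le_trans (ler_vmodD _ _); rewrite le_eqVlt; apply/orP; left; apply/eqP.
    by congr vmod; apply/rowP => j; rewrite !mxE.
  + by move=> x; exact: cmod_ge0.
  + by move=> x; rewrite mulr_ge0 ?cmod_ge0.
  + by apply: scale => // x; exact: cmod_ge0.
- apply/(in_Lp_vecP _ mD p0); split => //.
  apply: (@integrable_powRD _ _ D p (fun x => vmod (g x)) (fun x => `|t| * vmod (grad eta x))) => //.
  + exact: ltW.
  + exact: measurable_vmod.
  + by move=> x; rewrite vmod_ge0 -vmodZ ler_vmodD.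
  + by move=> x; exact: vmod_ge0.
  + by move=> x; rewrite mulr_ge0 ?vmod_ge0.
  + by apply: scale => // x; exact: vmod_ge0.
- move=> psi tpsi i.
  have weta := test_function_weak_gradient mD teta tpsi i.
  have [B B0 psiB] := test_function_bounded tpsi.
  have [mpsi mgpsi] := test_function_measurable D tpsi.
  have gB x : cmod (grad psi x ord0 i) <= B.
    by rewrite (le_trans (cmod_le_vmod _ _))//; case: (psiB x).
  have pB x : cmod (psi x) <= B by case: (psiB x).
  have comp (G : 'rV[R]_n -> 'rV[R[i]]_n) : (forall i, cmeasurable D (fun x => G x ord0 i)) ->
      mu.-integrable D (EFin \o (fun x => vmod (G x) `^ p)) ->
      mu.-integrable D (EFin \o (fun x => cmod (G x ord0 i) `^ p)).
    move=> mG; apply: le_integrable => //.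
      by apply/measurable_EFinP; apply: measurable_powR_comp; exact: cmeasurable_cmod.
    move=> x _ /=; rewrite !ger0_norm ?powR_ge0// lee_fin.
    by apply: ge0_ler_powR; rewrite ?nnegrE ?cmod_ge0 ?vmod_ge0 ?(ltW p0)// cmod_le_vmod.
  under eq_fun do rewrite mulrDl -mulrA.
  under [in RHS]eq_fun do rewrite !mxE mulrDl -mulrA.
  rewrite !cintegralDZ//.
  + rewrite wug// opprD; congr (_ + _).
    rewrite -mulrN; congr (_ * _).
    rewrite weta; congr (- _); congr cintegral.
    by apply/funext => x; rewrite mxE.
  + exact: (cintegrable_bounded mD Dfin (ltW p1) (mg i) (comp _ mg gi) mpsi pB).
  + have := cintegrable_bounded mD Dfin (ltW p1) (mgrad i) (comp _ mgrad i2) mpsi pB.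
    by under eq_fun do rewrite mxE.
  + exact: (cintegrable_bounded mD Dfin (ltW p1) mu_ ui (mgpsi i) gB).
  + exact: (cintegrable_bounded mD Dfin (ltW p1) meta i1 (mgpsi i) gB).
move=> e e0; have [phi [tphi h1 h2]] := ap e e0.
exists (fun x => phi x + t%:C * eta x); split; first exact: test_functionDZ.
  move: h1; congr (LnormD _ _ _ < _)%E; apply/funext => x.
  by rewrite opprD addrACA subrr addr0.
rewrite (_ : (fun x => _) = fun x => vmod (g x - grad phi x))//.
apply/funext => x.
by rewrite (gradDZ _ _ tphi teta) opprD addrACA subrr addr0.
Qed.

End test_functions_sobolev.


(** * The lower bound *)

Section hoelder_on_domain.
Context {R : realType} {n : nat}.
Local Notation mu := (@lebesgue_rV R n).
Local Notation cmod := (@ComplexField.Normc.normc R).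
Implicit Types (D : set 'rV[R]_n) (f h : 'rV[R]_n -> R).

Lemma hoelder_domain D (t : R) f h : measurable D -> 0 < t < 1 ->
  measurable_fun D f -> measurable_fun D h ->
  (forall x, 0 <= f x) -> (forall x, 0 <= h x) ->
  (\int[mu]_(x in D) (f x `^ t * h x `^ (1 - t))%:E <=
   (\int[mu]_(x in D) (f x)%:E) `^ t * (\int[mu]_(x in D) (h x)%:E) `^ (1 - t))%E.
Proof.
move=> mD t01 mf mh f0 h0.
have tN0 : t != 0 by case/andP: t01 => t0 _; rewrite gt_eqF.
have patch0 (e : 'rV[R]_n -> R) : (forall x, 0 <= e x) ->
    forall x, (0 <= ((EFin \o e) \_ D) x)%E.
  by move=> e0 x; rewrite patchE; case: ifPn => // _; rewrite lee_fin.
have mpatch (e : 'rV[R]_n -> R) : measurable_fun D e ->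
    measurable_fun [set: 'rV[R]_n] ((EFin \o e) \_ D).
  by move=> me; apply/(measurable_restrictT _ mD); exact/measurable_EFinP.
have := @hoelder_poweR _ _ R mu t _ _ t01 (mpatch _ mf) (mpatch _ mh)
  (patch0 _ f0) (patch0 _ h0).
rewrite -(integral_mkcond D (EFin \o f)) -(integral_mkcond D (EFin \o h)).
apply: le_trans; rewrite [leLHS]integral_mkcond le_eqVlt; apply/orP; left; apply/eqP.
apply: eq_integral => x _; rewrite !patchE; case: ifPn => _.
  by [].
by rewrite poweR0r// mul0e.
Qed.

Lemma Rintegral_abs_le D f (c : R) : measurable D -> measurable_fun D f ->
  (\int[mu]_(x in D) `|f x|%:E <= c%:E)%E ->
  mu.-integrable D (EFin \o f) /\ `|\int[mu]_(x in D) f x| <= c.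
Proof.
move=> mD mf fc.
have fi : mu.-integrable D (EFin \o f).
  apply/integrableP; split; first exact/measurable_EFinP.
  exact: (le_lt_trans fc (ltry _)).
split=> //; rewrite -lee_fin EFin_normr_Rintegral//; apply: le_trans fc.
by apply: le_abse_integral => //; exact/measurable_EFinP.
Qed.

Lemma LnormD_le D (p a : R) f : measurable D -> 0 < p -> 0 <= a ->
  (forall x, 0 <= f x) -> (LnormD D p%:E f <= a%:E)%E ->
  (\int[mu]_(x in D) (f x `^ p)%:E <= (a `^ p)%:E)%E.
Proof.
move=> mD p0 a0 f0 fa; rewrite -LnormD_powR ?gt_eqF// -poweR_EFin.
by apply: lee_poweR => //; [exact: ltW|exact: LnormD_ge0].
Qed.

Lemma LnormD_triangle D (p : R) (e f h : 'rV[R]_n -> R) : measurable D -> 1 <= p ->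
  measurable_fun D e -> measurable_fun D f -> measurable_fun D h ->
  (forall x, 0 <= e x <= f x + h x) -> (forall x, 0 <= f x) -> (forall x, 0 <= h x) ->
  (LnormD D p%:E e <= LnormD D p%:E f + LnormD D p%:E h)%E.
Proof.
move=> mD p1 me mf mh efh f0 h0.
have p0 : 0 < p by rewrite (lt_le_trans _ p1).
have mpatch (k : 'rV[R]_n -> R) : measurable_fun D k ->
    measurable_fun [set: 'rV[R]_n] (k \_ D).
  by move=> mk; apply/(measurable_restrictT _ mD).
rewrite /LnormD.
apply: le_trans (minkowski_EFin mu (mpatch _ mf) (mpatch _ mh) p1).
rewrite -[leRHS]/(Lnorm mu p%:E (EFin \o (f \_ D \+ h \_ D))).
have -> : f \_ D \+ h \_ D = (f \+ h) \_ D.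
  by apply/funext => x; rewrite /= !patchE; case: ifPn; rewrite ?addr0.
rewrite -!/(LnormD D p%:E _) !LnormDE ?gt_eqF//; last 2 first.
- by move=> x; rewrite addr_ge0.
- by move=> x; case/andP: (efh x).
apply: lee_poweR; first by rewrite invr_ge0 ltW.
  by apply: integral_ge0 => x _; rewrite lee_fin powR_ge0.
apply: ge0_le_integral => //.
- by move=> x _; rewrite lee_fin powR_ge0.
- by apply/measurable_EFinP; exact: measurable_powR_comp.
- by apply/measurable_EFinP; apply: measurable_powR_comp; exact: measurable_funD.
- move=> x _; rewrite lee_fin; have /andP[e0 ex] := efh x.
  by apply: ge0_ler_powR; rewrite ?nnegrE ?(ltW p0)// addr_ge0.
Qed.

Lemma LnormD_approx D (p a e : R) (g h : 'rV[R]_n -> 'rV[R[i]]_n) :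
  measurable D -> 1 <= p ->
  (forall i, cmeasurable D (fun x => g x ord0 i)) ->
  (forall i, cmeasurable D (fun x => h x ord0 i)) ->
  (LnormD D p%:E (fun x => vmod (g x)) <= a%:E)%E ->
  (LnormD D p%:E (fun x => vmod (g x - h x)%R) <= e%:E)%E ->
  (LnormD D p%:E (fun x => vmod (h x)) <= (a + e)%:E)%E.
Proof.
move=> mD p1 mg mh ga he; rewrite EFinD; apply: le_trans (leeD ga he).
apply: LnormD_triangle => //; try by move=> x; exact: vmod_ge0.
- exact: measurable_vmod.
- exact: measurable_vmod.
- by apply: measurable_vmod => i; exact: cmeasurable_rowB.
- by move=> x; rewrite vmod_ge0 ler_vmod_sub.
Qed.

Lemma dual_integral_le m D (p a b : R) (g w : 'rV[R]_n -> 'rV[R[i]]_m) :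
  measurable D -> 1 < p -> 0 <= a -> 0 <= b ->
  (forall i, cmeasurable D (fun x => g x ord0 i)) ->
  (forall i, cmeasurable D (fun x => w x ord0 i)) ->
  (LnormD D p%:E (fun x => vmod (g x)) <= a%:E)%E ->
  (LnormD D p%:E (fun x => vmod (w x)) <= b%:E)%E ->
  mu.-integrable D (EFin \o (fun x => dual p (g x) (w x))) /\
  `|\int[mu]_(x in D) dual p (g x) (w x)| <= a `^ (p - 1) * b.
Proof.
move=> mD p1 a0 b0 mg mw ga wb; have p0 : 0 < p by rewrite (lt_trans _ p1).
have pV1 : p^-1 < 1 by rewrite invf_lt1.
have p10 : 0 <= p - 1 by rewrite subr_ge0 ltW.
have t01 : 0 < 1 - p^-1 < 1 by rewrite subr_gt0 pV1/= gtrBl invr_gt0.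
have tE : p * (1 - p^-1) = p - 1 by rewrite mulrBr mulr1 divff ?gt_eqF.
have tE' : 1 - (1 - p^-1) = p^-1 by ring.
have hg := LnormD_le mD p0 a0 (fun x => vmod_ge0 (g x)) ga.
have hw := LnormD_le mD p0 b0 (fun x => vmod_ge0 (w x)) wb.
apply: Rintegral_abs_le => //; first exact: measurable_dual.
have := @hoelder_domain D (1 - p^-1) (fun x => vmod (g x) `^ p)
  (fun x => vmod (w x) `^ p) mD t01.
rewrite tE'; under eq_integral do rewrite -!powRrM tE mulfV ?gt_eqF// powRr1 ?vmod_ge0//.
move=> H; apply: le_trans (le_trans (H _ _ _ _) _).
- apply: ge0_le_integral => //.
  + by apply/measurable_EFinP; apply: measurableT_comp => //; exact: measurable_dual.
  + apply/measurable_EFinP; apply: measurable_funM; last exact: measurable_vmod.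
    by apply: measurable_powR_comp; exact: measurable_vmod.
  + by move=> x _; rewrite lee_fin normr_dual_le.
- by apply: measurable_powR_comp; exact: measurable_vmod.
- by apply: measurable_powR_comp; exact: measurable_vmod.
- by move=> x; exact: powR_ge0.
- by move=> x; exact: powR_ge0.
have -> : (a `^ (p - 1) * b)%:E = ((a `^ p)%:E `^ (1 - p^-1) * (b `^ p)%:E `^ p^-1)%E.
  by rewrite !poweR_EFin -EFinM -!powRrM tE mulfV ?gt_eqF// powRr1.
apply: lee_pmul; rewrite ?poweR_ge0//; apply: lee_poweR => //.
- by rewrite subr_ge0 ltW.
- by apply: integral_ge0 => x _; rewrite lee_fin powR_ge0.
- by rewrite invr_ge0 ltW.
- by apply: integral_ge0 => x _; rewrite lee_fin powR_ge0.
Qed.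

(** Hoelder's inequality with the conjugate exponents [r] and [q / p]; when [r] is
    infinite, [q = p] and the potential is bounded by 1 almost everywhere. *)
Lemma potential_hoelder D (p q : R) (r : \bar R) V f : measurable D -> 0 < p ->
  (1 < r)%E -> (r^-1 + (p / q)%:E = 1)%E -> potential_class D r V ->
  measurable_fun D f -> (forall x, 0 <= f x) ->
  (\int[mu]_(x in D) (`|V x| * f x)%:E <=
   (\int[mu]_(x in D) (f x `^ (q / p))%:E) `^ (p / q))%E.
Proof.
move=> mD p0 r1 rq [mV V0 Vr] mf f0.
case: r r1 rq Vr => [r| |]// r1 rq Vr.
  have r1' : 1 < r by rewrite -lte_fin.
  have r0 : 0 < r by rewrite (lt_trans _ r1').
  have tE : 1 - r^-1 = p / q.
    move: rq; rewrite inver gt_eqF// -EFinD => -[<-].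
    by rewrite addrC addKr.
  have t01 : 0 < r^-1 < 1 by rewrite invr_gt0 r0 invf_lt1.
  have qp : (q / p) * (p / q) = 1.
    have pq0 : p / q != 0 by rewrite -tE gt_eqF// subr_gt0; case/andP: t01.
    by rewrite -[q / p]invf_div mulVf.
  have := @hoelder_domain D r^-1 (fun x => `|V x| `^ r) (fun x => f x `^ (q / p)) mD t01.
  rewrite tE; under eq_integral do rewrite -!powRrM qp mulfV ?gt_eqF// !powRr1//.
  move=> H; apply: le_trans (H _ _ _ _) _.
  - by apply: measurable_powR_comp; apply: measurableT_comp.
  - exact: measurable_powR_comp.
  - by move=> x; exact: powR_ge0.
  - by move=> x; exact: powR_ge0.
  suff -> : (\int[mu]_(x in D) (`|V x| `^ r)%:E = 1)%E by rewrite poweR1r mul1e.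
  rewrite -LnormD_powR ?gt_eqF//.
  have -> : LnormD D r%:E (fun x => `|V x|) = LnormD D r%:E V.
    rewrite /LnormD -[RHS]Lnorm_abse; apply: eq_Lnorm => x /=.
    by rewrite !patchE; case: ifPn => // _; rewrite normr0.
  by rewrite Vr poweR1r.
have pq : p / q = 1 by move: rq; rewrite invey add0e => -[].
have qp : q / p = 1 by rewrite -[q / p]invf_div pq invr1.
rewrite pq qp poweRe1; last first.
  by apply: integral_ge0 => x _; rewrite lee_fin powR_ge0.
under [leRHS]eq_integral do rewrite powRr1//.
apply: ae_ge0_le_integral => //.
- by move=> x _; rewrite lee_fin mulr_ge0.
- by apply/measurable_EFinP; apply: measurable_funM => //; apply: measurableT_comp.
- by move=> x _; rewrite lee_fin.
- exact/measurable_EFinP.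
move: Vr; rewrite /LnormD unlock; case: ifPn => [_ Vs|_ [/eqP]]; last first.
  by rewrite eq_sym oner_eq0.
have := ess_sup_ge mu (abse \o (EFin \o V \_ D)); rewrite Vs.
apply: filterS => x /=; rewrite patchE => + Dx; rewrite mem_set// lee_fin => V1.
by rewrite lee_fin ler_piMl.
Qed.

(** [potential_hoelder] removes the potential; Hoelder's inequality with exponents
    p / (p - 1) and p then separates the two functions. *)
Lemma potential_integral_le D (p q a b : R) (r : \bar R) V (u v : 'rV[R]_n -> R[i]) :
  measurable D -> 1 < p -> 0 < q ->
  (1 < r)%E -> (r^-1 + (p / q)%:E = 1)%E -> potential_class D r V ->
  cmeasurable D u -> cmeasurable D v -> 0 <= a -> 0 <= b ->
  (LnormD D q%:E (cmod \o u) <= a%:E)%E -> (LnormD D q%:E (cmod \o v) <= b%:E)%E ->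
  (\int[mu]_(x in D) (`|V x| * (cmod (u x) `^ (p - 1) * cmod (v x)))%:E <=
   (a `^ (p - 1) * b)%:E)%E.
Proof.
move=> mD p1 q0 r1 rq VG mu_ mv a0 b0 ua vb; have p0 : 0 < p by rewrite (lt_trans _ p1).
have pV1 : p^-1 < 1 by rewrite invf_lt1.
have t01 : 0 < 1 - p^-1 < 1 by rewrite subr_gt0 pV1/= gtrBl invr_gt0.
have tE : q * (1 - p^-1) = (p - 1) * (q / p) by field; rewrite gt_eqF.
have tE' : 1 - (1 - p^-1) = p^-1 by ring.
have mcu := cmeasurable_cmod mu_; have mcv := cmeasurable_cmod mv.
have hu := LnormD_le mD q0 a0 (fun x => cmod_ge0 (u x)) ua.
have hv := LnormD_le mD q0 b0 (fun x => cmod_ge0 (v x)) vb.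
apply: le_trans (potential_hoelder mD p0 r1 rq VG _ _) _.
- by apply: measurable_funM => //; exact: measurable_powR_comp.
- by move=> x; rewrite mulr_ge0 ?powR_ge0 ?cmod_ge0.
have -> : (a `^ (p - 1) * b)%:E = (((a `^ q)%:E `^ (1 - p^-1) * (b `^ q)%:E `^ p^-1) `^ (p / q))%E.
  rewrite !poweR_EFin; congr EFin.
  rewrite powRM ?powR_ge0// -!powRrM; congr (_ * _).
    by congr (_ `^ _); field; rewrite !gt_eqF.
  by rewrite -[LHS]powRr1//; congr (_ `^ _); field; rewrite !gt_eqF.
apply: lee_poweR.
- by rewrite divr_ge0 ?ltW.
- by apply: integral_ge0 => x _; rewrite lee_fin powR_ge0.
have := @hoelder_domain D (1 - p^-1) (fun x => cmod (u x) `^ q)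
  (fun x => cmod (v x) `^ q) mD t01.
rewrite tE' => H.
have E x : (cmod (u x) `^ (p - 1) * cmod (v x)) `^ (q / p) =
    (cmod (u x) `^ q) `^ (1 - p^-1) * (cmod (v x) `^ q) `^ p^-1.
  by rewrite powRM ?powR_ge0 ?cmod_ge0// -!powRrM tE.
under eq_integral do rewrite E.
apply: le_trans (H _ _ _ _) _.
- exact: measurable_powR_comp.
- exact: measurable_powR_comp.
- by move=> x; exact: powR_ge0.
- by move=> x; exact: powR_ge0.
apply: lee_pmul; rewrite ?poweR_ge0//; apply: lee_poweR => //.
- by rewrite subr_ge0 ltW.
- by apply: integral_ge0 => x _; rewrite lee_fin powR_ge0.
- by rewrite invr_ge0 ltW.
- by apply: integral_ge0 => x _; rewrite lee_fin powR_ge0.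
Qed.

End hoelder_on_domain.


Section lower_bound.
Context {R : realType} {n : nat}.
Local Notation mu := (@lebesgue_rV R n).
Local Notation cmod := (@ComplexField.Normc.normc R).
Implicit Types (D : set 'rV[R]_n) (u : 'rV[R]_n -> R[i]) (g : 'rV[R]_n -> 'rV[R[i]]_n).

Lemma LnormD_cmod_eq0 D (q : R) u : measurable D -> 0 < q -> cmeasurable D u ->
  LnormD D q%:E (cmod \o u) = 0%E <-> ae_on D (fun x => u x = 0).
Proof.
move=> mD q0 mu_.
have mcu := cmeasurable_cmod mu_.
have mcp : measurable_fun D (EFin \o (cmod \o u) \_ D : _ -> \bar R).
  apply: (measurable_funTS (D := D)); apply/measurable_EFinP.
  exact/(measurable_restrictT _ mD).
rewrite /LnormD; split=> [L0|u0].
  have mT : measurable_fun [set: 'rV[R]_n] (EFin \o (cmod \o u) \_ D : _ -> \bar R).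
    by apply/measurable_EFinP; exact/(measurable_restrictT _ mD).
  have := Lnorm_eq0_eq0 mT _ L0; rewrite lte_fin => /(_ q0).
  apply: filterS => x /(_ I)/=; rewrite patchE => + Dx; rewrite mem_set// => -[].
  exact: ComplexField.Normc.eq0_normc.
rewrite -/(LnormD _ _ _) LnormDE ?gt_eqF//; last by move=> x; exact: cmod_ge0.
rewrite (ae_eq_integral (cst 0%E))//; first by rewrite integral0 poweR0r// invr_eq0 gt_eqF.
- by apply/measurable_EFinP; exact: measurable_powR_comp.
- have u0_ae : {ae mu, forall x, D x -> u x = 0} := u0.
  by apply: filterS u0_ae => x /[apply] /= ->; rewrite ComplexField.Normc.normc0 powR0// gt_eqF.
Qed.

(** A quotient with vanishing denominator is infinite, hence excluded by finiteness of
    the constant. The sign of [k] serves for trivial [u], as the supremum of the empty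
    set is negative. *)
Lemma sobolev_constant_ub D (q p k : R) u g : measurable D -> 0 < p -> 0 < q ->
  sobolev_constant D q p = k%:E -> 0 <= k -> sobolev0 D p u g ->
  (LnormD D q%:E (cmod \o u) <= k%:E * LnormD D p%:E (vmod \o g))%E.
Proof.
move=> mD p0 q0 Kk k0 sug.
have [[[mu_ _] [_ gfin] _] _] := sug.
have [u0|/[dup] ntu /(LnormD_cmod_eq0 mD q0 mu_)/eqP uN0] :=
  pselect (ae_on D (fun x => u x = 0)).
  rewrite (LnormD_cmod_eq0 mD q0 mu_).2// mule_ge0 ?lee_fin//.
  exact: LnormD_ge0.
have : (LnormD D q%:E (cmod \o u) / LnormD D p%:E (vmod \o g) <= k%:E)%E.
  by rewrite -Kk; apply: ereal_sup_ubound; exists u, g; split.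
have [gE0|gN0] := eqVneq (LnormD D p%:E (vmod \o g)) 0%E.
  rewrite gE0 inve0 gt0_muley ?leye_eq//.
  by rewrite lt0e uN0 LnormD_ge0.
have gfin_num : LnormD D p%:E (vmod \o g) \is a fin_num.
  by rewrite ge0_fin_numE// LnormD_ge0.
have gpos : (0 < LnormD D p%:E (vmod \o g))%E by rewrite lt0e gN0 LnormD_ge0.
rewrite -(fineK gfin_num) inver gt_eqF ?fine_gt0 ?gpos// => H.
by rewrite -lee_pdivrMr ?fine_gt0 ?gpos.
Qed.

Lemma sobolev_constant_gt0 D (q p : R) u g : measurable D -> 0 < p -> 0 < q ->
  sobolev0 D p u g -> nontrivial D u -> (0 < sobolev_constant D q p)%E.
Proof.
move=> mD p0 q0 sug ntu; have [[[mu_ _] [_ gfin] _] _] := sug.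
have uN0 : LnormD D q%:E (cmod \o u) != 0%E.
  by apply/eqP => /(LnormD_cmod_eq0 mD q0 mu_).
apply: (@lt_le_trans _ _ (LnormD D q%:E (cmod \o u) / LnormD D p%:E (vmod \o g))%E).
  apply: mule_gt0; first by rewrite lt0e uN0 LnormD_ge0.
  have [gE0|gN0] := eqVneq (LnormD D p%:E (vmod \o g)) 0%E; first by rewrite gE0 inve0.
  have gfin_num : LnormD D p%:E (vmod \o g) \is a fin_num.
    by rewrite ge0_fin_numE// LnormD_ge0.
  have gpos : (0 < LnormD D p%:E (vmod \o g))%E by rewrite lt0e gN0 LnormD_ge0.
  by rewrite -(fineK gfin_num) inver gt_eqF ?fine_gt0 ?gpos// lte_fin invr_gt0 fine_gt0// gpos.
by apply: ereal_sup_ubound; exists u, g; split.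
Qed.

(** With [a] the gradient norm of the solution and [e] the accuracy of a test function
    approximating it, the equation gives [a <= e + E * k `^ p * (a + e)]; then [e] tends
    to zero. *)
Lemma eigenvalue_lower_bound D (p q E : R) (r : \bar R) V : open D ->
  1 < p -> 0 < q -> (1 < r)%E -> (r^-1 + (p / q)%:E = 1)%E -> 0 < E ->
  potential_class D r V -> has_nontrivial_solution D p E V ->
  ((sobolev_constant D q p `^ p)^-1 <= E%:E)%E.
Proof.
move=> oD p1 q0 r1 rq E0 VG [u [g [sug ntu ws]]].
have mD : measurable D by exact: open_measurable_rV.
have p0 : 0 < p by rewrite (lt_trans _ p1).
have Kpos := sobolev_constant_gt0 mD p0 q0 sug ntu.
case KE : (sobolev_constant D q p) Kpos => [k| |]// kpos; last first.
  by rewrite poweRyr ?gt_eqF// invey lee_fin ltW.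
rewrite lte_fin in kpos.
have [[[mu_ ufin] [mg gfin] _] ap] := sug.
pose a := fine (LnormD D p%:E (vmod \o g)).
have aE : LnormD D p%:E (vmod \o g) = a%:E.
  by rewrite fineK// ge0_fin_numE// LnormD_ge0.
have ua : (LnormD D q%:E (cmod \o u) <= (k * a)%:E)%E.
  by rewrite EFinM -aE; exact: (sobolev_constant_ub mD p0 q0 KE (ltW kpos) sug).
have a0 : 0 <= a by rewrite -lee_fin -aE LnormD_ge0.
have apos : 0 < a.
  rewrite lt0r a0 andbT; apply/eqP => a00; apply: ntu.
  apply/(LnormD_cmod_eq0 mD q0 mu_)/eqP; rewrite eq_le LnormD_ge0 andbT.
  by rewrite a00 mulr0 in ua.
have kp0 : 0 < k `^ p by rewrite powR_gt0.
rewrite poweR_EFin inver gt_eqF// lee_fin -[_^-1]mul1r ler_pdivrMr//.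
suff H (e : R) : 0 < e -> a <= e + E * k `^ p * (a + e).
  have {}H : a <= E * k `^ p * a.
    apply/ler_addgt0Pr => e e0.
    have c0 : 0 < 1 + E * k `^ p by rewrite addr_gt0// mulr_gt0.
    have := H (e / (1 + E * k `^ p)); rewrite divr_gt0// => /(_ isT)/le_trans; apply.
    rewrite le_eqVlt; apply/orP; left; apply/eqP; field.
    by rewrite gt_eqF.
  by rewrite -(ler_pM2r apos) mul1r.
move=> e0; have [phi [tphi uphi gphi]] := ap e e0.
have sphi := test_function_sobolev0 mD p1 tphi.
have [mphi mgphi] := test_function_measurable D tphi.
have mgd i : cmeasurable D (fun x => (g x - grad phi x) ord0 i).
  exact: cmeasurable_rowB.
have ga : (LnormD D p%:E (vmod \o g) <= a%:E)%E by rewrite aE.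
have gphi_le : (LnormD D p%:E (vmod \o grad phi) <= (a + e)%:E)%E.
  exact: (LnormD_approx mD (ltW p1) mg mgphi ga (ltW gphi)).
have phi_le : (LnormD D q%:E (cmod \o phi) <= (k * (a + e))%:E)%E.
  apply: le_trans (sobolev_constant_ub mD p0 q0 KE (ltW kpos) sphi) _.
  by rewrite EFinM; apply: lee_wpmul2l => //; rewrite lee_fin ltW.
have ae0 : 0 <= a + e by rewrite addr_ge0// ltW.
have [i1 b1] := dual_integral_le mD p1 a0 (ltW e0) mg mgd ga (ltW gphi).
have [i2 b2] := dual_integral_le mD p1 a0 ae0 mg mgphi ga gphi_le.
have split_dual : a `^ p = \int[mu]_(x in D) dual p (g x) (grad phi x) +
    \int[mu]_(x in D) dual p (g x) (g x - grad phi x).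
  rewrite -RintegralD//; transitivity (fine (\int[mu]_(x in D) (vmod (g x) `^ p)%:E)%E).
    rewrite -(@LnormD_powR _ _ _ _ (vmod \o g))// ?gt_eqF// ?aE//.
    by move=> x; exact: vmod_ge0.
  congr fine; apply: eq_integral => x _.
  by rewrite -dualDr subrKC dualzz.
have wsphi := (weak_solutionP _ _ _ _ _ _).1 ws phi tphi.
have [mV _ _] := VG.
have mcdot : measurable_fun D (fun x => cdot (u x) (phi x)).
  under eq_fun do rewrite -vdot_const.
  by apply: measurable_vdot => i; under eq_fun do rewrite mxE.
have ka0 : 0 <= k * a by rewrite mulr_ge0// ltW.
have kae0 : 0 <= k * (a + e) by rewrite mulr_ge0// ltW.
have PI := potential_integral_le mD p1 q0 r1 rq VG mu_ mphi ka0 kae0 ua phi_le.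
have [i3 b3] : mu.-integrable D (EFin \o (fun x =>
      E * V x * cmod (u x) `^ (p - 2) * cdot (u x) (phi x))) /\
    `|\int[mu]_(x in D) (E * V x * cmod (u x) `^ (p - 2) * cdot (u x) (phi x))| <=
    E * ((k * a) `^ (p - 1) * (k * (a + e))).
  apply: Rintegral_abs_le => //.
    apply: measurable_funM => //; apply: measurable_funM; first exact: measurable_funM.
    by apply: measurable_powR_comp; exact: cmeasurable_cmod.
  rewrite EFinM; apply: le_trans (lee_wpmul2l _ PI); last by rewrite lee_fin ltW.
  have mint : measurable_fun D
      (fun x => `|V x| * (cmod (u x) `^ (p - 1) * cmod (phi x))).
    apply: measurable_funM; first exact: measurableT_comp.
    apply: measurable_funM; last exact: cmeasurable_cmod.
    by apply: measurable_powR_comp; exact: cmeasurable_cmod.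
  rewrite -ge0_integralZl//; last 3 first.
  - exact/measurable_EFinP.
  - by move=> x _; rewrite lee_fin !mulr_ge0// ?powR_ge0 ?cmod_ge0.
  - by rewrite lee_fin ltW.
  apply: ge0_le_integral => //.
  - apply/measurable_EFinP; apply: measurableT_comp => //.
    apply: measurable_funM => //; apply: measurable_funM; first exact: measurable_funM.
    by apply: measurable_powR_comp; exact: cmeasurable_cmod.
  - by apply/measurable_EFinP; exact: measurable_funM.
  move=> x _; rewrite -EFinM lee_fin -!mulrA !normrM (ger0_norm (ltW E0)).
  rewrite ler_pM2l// ler_wpM2l// -!normrM -!vmod_const -vdot_const.
  exact: (normr_dual_le (const_mx (u x)) (const_mx (phi x)) p1).
rewrite -wsphi in b3.
have ap1 : 0 < a `^ (p - 1) by rewrite powR_gt0.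
rewrite -(ler_pM2l ap1) [leLHS]mulrC mulr_powRB1// split_dual.
have -> : a `^ (p - 1) * (e + E * k `^ p * (a + e)) =
    E * ((k * a) `^ (p - 1) * (k * (a + e))) + a `^ (p - 1) * e.
  rewrite powRM// ?ltW// -[in LHS](mulr_powRB1 (ltW kpos) p0); ring.
by apply: lerD; [rewrite (le_trans (ler_norm _))|rewrite (le_trans (ler_norm _))].
Qed.

End lower_bound.


(** * Finiteness of the norm of an extremal *)

Section sobolev_embedding.
Context {R : realType}.
Local Notation Re := (@complex.Re R).
Local Notation Im := (@complex.Im R).
Local Notation cmod := (@ComplexField.Normc.normc R).

Lemma normr_powR_ppow (s y : R) : 0 < s -> `|y| `^ s = ppow s y + ppow s (- y).
Proof.
move=> s0; have sN0 : s != 0 by rewrite gt_eqF.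
have [y0|y0] := leP 0 y.
  by rewrite ger0_norm// ppow_pos// ppow_neg ?addr0// oppr_le0.
by rewrite ltr0_norm// ppow_neg ?(ltW y0)// add0r ppow_pos// oppr_ge0 ltW.
Qed.

Lemma cmod_powR_le (s : R) (z : R[i]) : 0 < s ->
  cmod z `^ s <= 2 `^ s * ((ppow s (Re z) + ppow s (- Re z)) +
    (ppow s (Im z) + ppow s (- Im z))).
Proof.
move=> s0; rewrite -!normr_powR_ppow//.
apply: le_trans (powRD_le (ltW s0) (normr_ge0 _) (normr_ge0 _)).
apply: ge0_ler_powR; rewrite ?nnegrE ?cmod_ge0 ?addr_ge0 ?(ltW s0)//.
rewrite -(@ler_pXn2r _ 2)// ?nnegrE ?cmod_ge0 ?addr_ge0// cmod_sqr sqrrD.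
by rewrite !real_normK ?num_real// -addrA lerD2l lerDr mulrn_wge0// mulr_ge0.
Qed.

Lemma ge0_integral_support n (D : set 'rV[R]_n) (f : 'rV[R]_n -> R) :
  (forall x, ~ D x -> f x = 0) ->
  (\int[@lebesgue_rV R n]_(x in D) (f x)%:E = \int[@lebesgue_rV R n]_x (f x)%:E)%E.
Proof.
move=> f0; rewrite [LHS]integral_mkcond; apply: eq_integral => x _.
rewrite patchE; case: ifPn => // /negP xD.
by rewrite f0// => Dx; apply: xD; rewrite inE.
Qed.

Variable m : nat.
Let n := m.+2.
Local Notation mu := (@lebesgue_rV R n).
Variables (p : R) (p1 : 1 < p) (pn : p < n%:R).
Variables (D : set 'rV[R]_n).
Hypotheses (mD : measurable D) (Dfin : (mu D < +oo)%E).

Let p0 : 0 < p. Proof. by rewrite (lt_trans _ p1). Qed.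

Lemma le_integralD (f h : 'rV[R]_n -> R) (a b : R) :
  measurable_fun D f -> measurable_fun D h ->
  (forall x, 0 <= f x) -> (forall x, 0 <= h x) ->
  (\int[mu]_(x in D) (f x)%:E <= a%:E)%E -> (\int[mu]_(x in D) (h x)%:E <= b%:E)%E ->
  (\int[mu]_(x in D) (f x + h x)%:E <= (a + b)%:E)%E.
Proof.
move=> mf mh f0 h0 fa hb; rewrite EFinD; apply: le_trans (leeD fa hb).
rewrite -ge0_integralD//; do ?exact/measurable_EFinP.
- by move=> x _; rewrite lee_fin.
- by move=> x _; rewrite lee_fin.
Qed.

(** The real inequality is applied to the real and imaginary parts and their opposites.
    On a set of finite measure, the power with the critical exponent controls the
    lower ones. *)
Lemma sobolev_test_function (A q : R) : 0 < q -> q <= sob_star m p ->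
  exists C : R, forall phi, test_function D phi ->
  (\int[mu]_(x in D) (vmod (grad phi x) `^ p)%:E <= A%:E)%E ->
  (\int[mu]_(x in D) (cmod (phi x) `^ q)%:E <= C%:E)%E.
Proof.
move=> q0 qs; have s0 := sob_star_gt0 p1 pn.
have [C HC] := sobolev_real p1 pn A.
pose c := 2 `^ (sob_star m p).
exists (fine (mu D) + c * ((C + C) + (C + C))) => phi tphi phiA.
have [K [cK KD Cr Ci]] := test_function_C1c tphi.
have [sr si _] := tphi.
have [mphi mgrad] := test_function_measurable setT tphi.
have [K' [cK' KD' [c1 c2] s0']] := test_function_continuous tphi.
have phiA' : (\int[mu]_x (vmod (grad phi x) `^ p)%:E <= A%:E)%E.
  rewrite -(@ge0_integral_support _ D)// => x Dx.
  have [_ ->] : phi x = 0 /\ grad phi x = 0 by apply: s0' => /KD'.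
  by rewrite vmod0 powR0// gt_eqF.
have mw : measurable_fun setT (fun x => vmod (grad phi x)) by exact: measurable_vmod.
have bound (f : 'rV[R]_n -> R) : C1c K f ->
    (forall i x, `|partial i f x| <= vmod (grad phi x)) ->
    (\int[mu]_(x in D) (ppow (sob_star m p) (f x))%:E <= C%:E)%E.
  move=> Cf fw; have [cf _ _ f0] := Cf.
  rewrite ge0_integral_support; last first.
    by move=> x Dx; rewrite f0 ?ppow_neg// ?gt_eqF// => /KD.
  by apply: (HC K f (fun x => vmod (grad phi x))) => // x; exact: vmod_ge0.
have gr i x : `|partial i (Re \o phi) x| <= vmod (grad phi x).
  apply: le_trans (cmod_le_vmod _ i); apply: le_trans (Re_le_cmod _).
  by rewrite mxE.
have gi i x : `|partial i (Im \o phi) x| <= vmod (grad phi x).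
  apply: le_trans (cmod_le_vmod _ i); apply: le_trans (Im_le_cmod _).
  by rewrite mxE.
have C1cN f : smooth f -> C1c K f -> C1c K (fun x => - f x).
  move=> sf [_ _ _ f0]; apply: smooth_C1c; first exact: smoothN.
  by move=> x /f0 ->; rewrite oppr0.
have b1 := bound _ Cr gr; have b2 := bound _ Ci gi.
have b3 : (\int[mu]_(x in D) (ppow (sob_star m p) (- Re (phi x)))%:E <= C%:E)%E.
  apply: (bound (fun x => - Re (phi x))); first exact: (C1cN (Re \o phi)).
  by move=> i x; rewrite (partialN _ _ sr) normrN; exact: gr.
have b4 : (\int[mu]_(x in D) (ppow (sob_star m p) (- Im (phi x)))%:E <= C%:E)%E.
  apply: (bound (fun x => - Im (phi x))); first exact: (C1cN (Im \o phi)).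
  by move=> i x; rewrite (partialN _ _ si) normrN; exact: gi.
have mpp (f : 'rV[R]_n -> R) : measurable_fun D f ->
    measurable_fun D (fun x => ppow (sob_star m p) (f x)).
  by move=> mf; apply: measurableT_comp => //; exact: measurable_ppow.
have [mr mi] : cmeasurable D phi by case: mphi => mr mi; split; exact: measurable_funTS.
have m1 := mpp _ mr; have m2 := mpp _ mi.
have m3 : measurable_fun D (fun x => ppow (sob_star m p) (- Re (phi x))).
  by apply: mpp; exact: measurable_funN.
have m4 : measurable_fun D (fun x => ppow (sob_star m p) (- Im (phi x))).
  by apply: mpp; exact: measurable_funN.
have c0 : 0 <= c by exact: powR_ge0.
pose S (x : 'rV[R]_n) := (ppow (sob_star m p) (Re (phi x)) + ppow (sob_star m p) (- Re (phi x))) +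
  (ppow (sob_star m p) (Im (phi x)) + ppow (sob_star m p) (- Im (phi x))).
have S0 x : 0 <= S x by rewrite !addr_ge0 ?ppow_ge0.
have mS : measurable_fun D S.
  by apply: measurable_funD; apply: measurable_funD.
have mcphi : measurable_fun D (fun x => cmod (phi x)) by apply: cmeasurable_cmod.
apply: (@le_trans _ _ (\int[mu]_(x in D) (1%:E + c%:E * (S x)%:E))%E).
  apply: ge0_le_integral => //.
  - by move=> x _; rewrite lee_fin powR_ge0.
  - by apply/measurable_EFinP; exact: measurable_powR_comp.
  - apply: emeasurable_funD; first exact: measurable_cst.
    by apply: measurable_funeM; exact/measurable_EFinP.
  move=> x _; rewrite -EFinM -EFinD lee_fin.
  have [h|/ltW h] := leP (cmod (phi x)) 1.
    rewrite (@le_trans _ _ 1)// ?lerDl ?mulr_ge0//.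
    have -> : 1 = 1 `^ q :> R by rewrite powR1.
    by apply: ge0_ler_powR; rewrite ?nnegrE ?cmod_ge0// ltW.
  apply: le_trans (ler_powR h qs) _; rewrite (le_trans (cmod_powR_le _ s0))//.
  by rewrite lerDr.
rewrite ge0_integralD//; last 2 first.
- by move=> x _; rewrite -EFinM lee_fin mulr_ge0.
- by apply: measurable_funeM; exact/measurable_EFinP.
rewrite ge0_integralZl//; last 2 first.
- exact/measurable_EFinP.
- by move=> x _; rewrite lee_fin.
rewrite EFinD EFinM fineK ?ge0_fin_numE//; apply: leeD.
  by rewrite integral_cst// mul1e.
apply: lee_wpmul2l; first by rewrite lee_fin.
apply: le_integralD; [exact: measurable_funD|exact: measurable_funD| | | |].
- by move=> x; rewrite addr_ge0 ?ppow_ge0.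
- by move=> x; rewrite addr_ge0 ?ppow_ge0.
- by apply: le_integralD => // x; exact: ppow_ge0.
- by apply: le_integralD => // x; exact: ppow_ge0.
Qed.

(** Lower semicontinuity of the norm is obtained by truncation: for a fixed height
    the truncated powers converge because the exponent p controls them. *)
Lemma sobolev0_Lq (q : R) u g : p <= q -> q <= sob_star m p ->
  sobolev0 D p u g -> (LnormD D q%:E (cmod \o u) < +oo)%E.
Proof.
move=> pq qs [[Lu Lg _] ap].
have q0 : 0 < q by rewrite (lt_le_trans p0).
have [mu_ ui] := (in_LpP _ mD p0).1 Lu; have [mg gi] := (in_Lp_vecP _ mD p0).1 Lg.
have gfin : (LnormD D p%:E (vmod \o g) < +oo)%E by case: Lg.
pose a := fine (LnormD D p%:E (vmod \o g)).
have aE : LnormD D p%:E (vmod \o g) = a%:E.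
  by rewrite fineK// ge0_fin_numE// LnormD_ge0.
have a0 : 0 <= a by rewrite -lee_fin -aE LnormD_ge0.
have [C HC] := sobolev_test_function ((a + 1) `^ p) q0 qs.
have mcu : measurable_fun D (fun x => cmod (u x)) by apply: cmeasurable_cmod.
pose tr (N : nat) x := Num.min (cmod (u x)) N%:R.
have tr0 N x : 0 <= tr N x by rewrite le_min cmod_ge0 ler0n.
have mtr N : measurable_fun D (tr N).
  by apply: measurable_minr => //; exact: measurable_cst.
have trC N : (\int[mu]_(x in D) (tr N x `^ q)%:E <= (2 `^ q * (C + 1))%:E)%E.
  (* The accuracy [e] makes up for the factor (N + 1)^(q - p) lost when the q-th power
     of a number at most N + 1 is replaced by its p-th power. *)
  pose e := (N%:R + 1 : R) `^ (- ((q - p) / p)).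
  have N1 : 0 < N%:R + 1 :> R by rewrite ltr_wpDl.
  have e0 : 0 < Num.min e 1 by rewrite lt_min powR_gt0//= ltr01.
  have [phi [tphi uphi gphi]] := ap _ e0.
  have [mphi mgphi] := test_function_measurable D tphi.
  have mud : cmeasurable D (fun x => u x - phi x) by exact: cmeasurableB.
  have ga : (LnormD D p%:E (vmod \o g) <= a%:E)%E by rewrite aE.
  have gphi1 : (LnormD D p%:E (fun x => vmod (g x - grad phi x)%R) <= 1%:E)%E.
    by apply: le_trans (ltW gphi) _; rewrite lee_fin ge_min lexx orbT.
  have gphi_le := LnormD_approx mD (ltW p1) mg mgphi ga gphi1.
  have {}HC := HC _ tphi (LnormD_le mD p0 (addr_ge0 a0 ler01)
     (fun x => vmod_ge0 (grad phi x)) gphi_le).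
  have uphi_le : (\int[mu]_(x in D) (cmod (u x - phi x) `^ p)%:E <= (e `^ p)%:E)%E.
    apply: LnormD_le => //; first exact: powR_ge0.
      by move=> x; exact: cmod_ge0.
    by apply: le_trans (ltW uphi) _; rewrite lee_fin ge_min lexx.
  have mcd : measurable_fun D (fun x => cmod (u x - phi x)) by apply: cmeasurable_cmod.
  have mcphi : measurable_fun D (fun x => cmod (phi x)) by apply: cmeasurable_cmod.
  pose d := (N%:R + 1 : R) `^ (q - p).
  have d0 : 0 <= d by exact: powR_ge0.
  have de : d * e `^ p = 1.
    rewrite /d /e -powRrM mulNr divfK ?gt_eqF// -powRD ?subrr ?powRr0//.
    by rewrite lt0r_neq0 ?implybT.
  have m2 : measurable_fun D (fun x => d * cmod (u x - phi x) `^ p).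
    by apply: measurable_funM => //; exact: measurable_powR_comp.
  have m1 : measurable_fun D (fun x => cmod (phi x) `^ q).
    exact: measurable_powR_comp.
  apply: (@le_trans _ _ (\int[mu]_(x in D) ((2 `^ q)%:E * ((cmod (phi x) `^ q)%:E +
      (d * cmod (u x - phi x) `^ p)%:E))%E)%E).
    apply: ge0_le_integral => //.
    - by move=> x _; rewrite lee_fin powR_ge0.
    - by apply/measurable_EFinP; exact: measurable_powR_comp.
    - by apply: measurable_funeM; apply: emeasurable_funD; exact/measurable_EFinP.
    move=> x _; rewrite -EFinD -EFinM lee_fin.
    pose y := Num.min (cmod (u x - phi x)) (N%:R + 1).
    have y0 : 0 <= y by rewrite le_min cmod_ge0 ltW.
    apply: (@le_trans _ _ (2 `^ q * (cmod (phi x) `^ q + y `^ q))).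
      apply: le_trans (powRD_le (ltW q0) (cmod_ge0 _) y0).
      apply: ge0_ler_powR; rewrite ?nnegrE ?(ltW q0) ?addr_ge0 ?cmod_ge0//.
      rewrite /y /tr; have := ler_vmod_sub (const_mx (phi x) : 'rV_1) (const_mx (u x)).
      have -> : vmod (const_mx (phi x) - const_mx (u x) : 'rV_1) = cmod (u x - phi x).
        rewrite -vmod_const -vmodN; congr vmod.
        by apply/rowP => j; rewrite !mxE opprB.
      rewrite !vmod_const => h; rewrite ge_min.
      have [h'|h'] := leP (cmod (u x - phi x)) (N%:R + 1); first by rewrite h.
      by apply/orP; right; rewrite addrCA lerDl addr_ge0 ?cmod_ge0.
    rewrite ler_wpM2l ?powR_ge0// lerD2l.
    have [->|yN0] := eqVneq y 0; first by rewrite powR0 ?gt_eqF// mulr_ge0 ?powR_ge0.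
    have -> : y `^ q = y `^ (q - p) * y `^ p by rewrite -powRD ?subrK// gt_eqF.
    apply: ler_pM; rewrite ?powR_ge0//.
      by apply: ge0_ler_powR; rewrite ?nnegrE ?subr_ge0 ?(ltW N1)// ge_min lexx orbT.
    by apply: ge0_ler_powR; rewrite ?nnegrE ?(ltW p0) ?cmod_ge0// ge_min lexx.
  rewrite ge0_integralZl//; last 2 first.
  - by apply: emeasurable_funD; exact/measurable_EFinP.
  - by move=> x _; rewrite adde_ge0// lee_fin ?mulr_ge0 ?powR_ge0.
  rewrite EFinM; apply: lee_wpmul2l; first by rewrite lee_fin powR_ge0.
  rewrite ge0_integralD//; last 4 first.
  - by move=> x _; rewrite lee_fin powR_ge0.
  - exact/measurable_EFinP.
  - by move=> x _; rewrite lee_fin ?mulr_ge0 ?powR_ge0.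
  - exact/measurable_EFinP.
  rewrite EFinD; apply: leeD => //.
  under eq_integral do rewrite EFinM.
  rewrite ge0_integralZl//; last 2 first.
  - by apply/measurable_EFinP; exact: measurable_powR_comp.
  - by move=> x _; rewrite lee_fin powR_ge0.
  by rewrite -de EFinM; apply: lee_wpmul2l.
apply/(LnormD_lty mD q0); first by move=> x; exact: cmod_ge0.
apply: le_lt_trans (ltry (2 `^ q * (C + 1))).
have ndtr x : {homo (fun N => (tr N x `^ q)%:E) : N M / (N <= M)%N >-> (N <= M)%E}.
  move=> N M NM; rewrite lee_fin; apply: ge0_ler_powR; rewrite ?nnegrE ?(ltW q0)//.
  rewrite le_min ge_min lexx/= ge_min; apply/orP; right.
  by rewrite ler_nat.
have mtrq N : measurable_fun D (fun x => (tr N x `^ q)%:E).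
  by apply/measurable_EFinP; exact: measurable_powR_comp.
have tr0q N x : D x -> (0 <= (tr N x `^ q)%:E)%E by rewrite lee_fin powR_ge0.
have := @monotone_convergence _ _ R mu D mD (fun N x => (tr N x `^ q)%:E) mtrq tr0q
  (fun x _ => @ndtr x).
have limE x : limn (fun N => (tr N x `^ q)%:E) = (cmod (u x) `^ q)%:E.
  apply/cvg_lim => //; apply: cvg_near_cst.
  near=> N; rewrite /tr min_l//.
  near: N; exact: nbhs_infty_ger.
under [in X in X = _]eq_integral do rewrite limE.
move=> ->; apply: lime_le.
  by apply: ereal_nondecreasing_is_cvgn => N M NM; apply: ge0_le_integral => //;
    [move=> x Dx; exact: tr0q|move=> x _; exact: ndtr].
by near=> N; exact: trC.
Unshelve. all: by end_near. Qed.

End sobolev_embedding.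


(** * The Euler-Lagrange equation of an extremal *)

Section euler_lagrange.
Context {R : realType} {n : nat}.
Local Notation mu := (@lebesgue_rV R n).
Local Notation cmod := (@ComplexField.Normc.normc R).
Implicit Types (D : set 'rV[R]_n) (u : 'rV[R]_n -> R[i]) (g : 'rV[R]_n -> 'rV[R[i]]_n).

(** The set where a continuous function does not vanish is open, hence empty or of
    positive measure. *)
Lemma trivial_test_function D phi : open D -> test_function D phi ->
  ae_on D (fun x => phi x = 0) -> forall x, phi x = 0 /\ grad phi x = 0.
Proof.
move=> oD tphi phi0.
have [K [cK KD [c1 c2] s0]] := test_function_continuous tphi.
have phi00 x : phi x = 0.
  apply: contrapT => phix.
  pose U := D `&` (fun x => cmod (phi x)) @^-1` [set y | 0 < y].
  have oU : open U.
    apply: openI => //; apply: open_comp; first by move=> y _; exact: c1.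
    exact: open_gt.
  have Ux : U !=set0.
    exists x; split.
      by apply: contrapT => Dx; apply: phix; have [] := s0 x (fun Kx => Dx (KD _ Kx)).
    rewrite /= lt0r cmod_ge0 andbT.
    by apply/eqP => /ComplexField.Normc.eq0_normc.
  have := lebesgue_open_gt0 oU Ux; rewrite lt_neqAle => /andP[/eqP + _]; apply.
  have phi0_ae : {ae mu, forall x, D x -> phi x = 0} := phi0.
  have [N [mN muN0 UN]] := phi0_ae.
  apply/esym; apply: (subset_measure0 (open_measurable_rV oU) mN _ muN0).
  move=> y [Dy phiy]; apply: UN => /= /(_ Dy) y0.
  by move: phiy; rewrite /= y0 ComplexField.Normc.normc0 ltxx.
move=> x; split=> //.
apply/rowP => i; rewrite !mxE /partial.
have -> : (@complex.Re R) \o phi = cst 0 by apply/funext => y /=; rewrite phi00.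
have -> : (@complex.Im R) \o phi = cst 0 by apply/funext => y /=; rewrite phi00.
by rewrite !derive_cst.
Qed.

(** A vanishing extremal would force the Sobolev constant to be 0. Then all test
    functions would vanish, and their gradients could not approximate the gradient of
    the extremal, which has norm 1. *)
Lemma extremal_nontrivial D (q p : R) u g : open D -> 1 < p -> 0 < q ->
  normalized_extremal D q p u g -> nontrivial D u.
Proof.
move=> oD p1 q0 [sug upos g1 uK] u0.
have mD : measurable D by exact: open_measurable_rV.
have p0 : 0 < p by rewrite (lt_trans _ p1).
have [[[mu_ _] _ _] ap] := sug.
have K0 : sobolev_constant D q p = 0%E.
  by rewrite -uK; apply/(LnormD_cmod_eq0 mD q0 mu_).
have [phi [tphi _ gphi]] := ap 1 ltr01.
have phi0 : ae_on D (fun x => phi x = 0).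
  apply: contrapT => ntphi.
  have := sobolev_constant_gt0 mD p0 q0 (test_function_sobolev0 mD p1 tphi) ntphi.
  by rewrite K0 ltxx.
have z := trivial_test_function oD tphi phi0.
move: gphi; have -> : (fun x => vmod (g x - grad phi x)) = vmod \o g.
  by apply/funext => x /=; have [_ ->] := z x; rewrite subr0.
by rewrite g1 ltxx.
Qed.

Lemma dual_tangent_integral m D (p t : R) (f h : 'rV[R]_n -> R)
    (z w : 'rV[R]_n -> 'rV[R[i]]_m) : measurable D -> 1 < p ->
  (forall x, f x = vmod (z x)) -> (forall x, h x = vmod (z x + t%:C *: w x)) ->
  mu.-integrable D (EFin \o (fun x => f x `^ p)) ->
  mu.-integrable D (EFin \o (fun x => h x `^ p)) ->
  mu.-integrable D (EFin \o (fun x => dual p (z x) (w x))) ->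
  \int[mu]_(x in D) (f x `^ p) + p * t * \int[mu]_(x in D) dual p (z x) (w x) <=
  \int[mu]_(x in D) (h x `^ p).
Proof.
move=> mD p1 fE hE iz izw id.
have id' := integrableZl mD (p * t) id.
rewrite -RintegralZl// -RintegralD//.
apply: le_Rintegral => //; first exact: (integrableD mD iz id').
move=> x _; have := dual_tangent (z x) (t%:C *: w x) p1.
by rewrite dualZr mulrA -fE -hE.
Qed.

(** The tangent of the m-th power at [x] lies below the graph at 1. *)
Lemma powR_bernoulli (m x : R) : 1 <= m -> 0 < x ->
  x `^ m <= 1 + m * (x - 1) * x `^ (m - 1).
Proof.
rewrite le_eqVlt => /predU1P[<-|m1] x0.
  by rewrite subrr powRr0 (powRr1 (ltW x0)) mul1r mulr1 addrC subrK.
have := @powR_tangent _ m x 1 (x - x ^+ 2) m1 (ltW x0) ler01.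
rewrite mulr1 addrC subrK lexx powR1 => /(_ isT).
have -> : x `^ (m - 2) * (x - x ^+ 2) = (1 - x) * x `^ (m - 1).
  have -> : x `^ (m - 1) = x `^ (m - 2) * x.
    rewrite -[X in _ * X](powRr1 (ltW x0)) -powRD ?(gt_eqF x0) ?implybT//.
    by congr (_ `^ _); ring.
  by ring.
by rewrite -mulrA => h; lra.
Qed.

Section variation.
Variables (D : set 'rV[R]_n) (q p k : R) (u : 'rV[R]_n -> R[i]).
Variables (g : 'rV[R]_n -> 'rV[R[i]]_n).
Hypotheses (mD : measurable D) (Dfin : (mu D < +oo)%E) (p1 : 1 < p) (pq : p <= q).
Hypotheses (k0 : 0 < k) (KE : sobolev_constant D q p = k%:E).
Hypotheses (sug : sobolev0 D p u g) (g1 : LnormD D p%:E (vmod \o g) = 1%E).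
Hypothesis uK : LnormD D q%:E (cmod \o u) = k%:E.

Let p0 : 0 < p. Proof. by rewrite (lt_trans _ p1). Qed.
Let q1 : 1 < q. Proof. by rewrite (lt_le_trans p1). Qed.
Let q0 : 0 < q. Proof. by rewrite (lt_trans _ q1). Qed.


(** For small t > 0 let B be the integral of |u + t eta|^q and A that of
    |grad u + t grad eta|^p. By convexity B is above its tangent at 0, and the tangent of
    A at t lies below the value of A at 0, which bounds A from above by its slope at t;
    that slope converges as t tends to 0, by dominated convergence. The Sobolev
    inequality B <= k^q A^(q/p) is an equality at t = 0, so comparing the terms of first
    order gives the claim. *)
Lemma euler_lagrange_le eta : test_function D eta ->
  \int[mu]_(x in D) (cmod (u x) `^ (q - 2) * cdot (u x) (eta x)) <=
  k `^ q * \int[mu]_(x in D) dual p (g x) (grad eta x).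
Proof.
move=> teta.
(* Dominated convergence being about sequences, t runs through 1/(j + 1). *)
pose t (j : nat) : R := j.+1%:R^-1.
have t0 j : 0 < t j by rewrite invr_gt0.
have t1 j : t j <= 1 by rewrite invf_le1// ler1n.
have tlim : t @ \oo --> (0 : R) by exact: cvg_harmonic.
have [[Lu Lg _] _] := sug.
have [mu_ ui] := (in_LpP _ mD p0).1 Lu; have [mg gi] := (in_Lp_vecP _ mD p0).1 Lg.
have [meta mgrad] := test_function_measurable D teta.
have [ieta igrad] := test_function_integrable mD p0 teta.
pose gt j x := g x + (t j)%:C *: grad eta x.
pose ut j x := u x + (t j)%:C * eta x.
have sut j : sobolev0 D p (ut j) (gt j) by exact: sobolev0_addZ.
have [mgt igt] : (forall j i, cmeasurable D (fun x => gt j x ord0 i)) /\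
    (forall j, mu.-integrable D (EFin \o (fun x => vmod (gt j x) `^ p))).
  by split=> j; have [[_ /(in_Lp_vecP _ mD p0)[]]] := sut j.
pose a_ j := \int[mu]_(x in D) dual p (gt j x) (grad eta x).
pose a := \int[mu]_(x in D) dual p (g x) (grad eta x).
pose dom x := 2 `^ p * (vmod (g x) `^ p + vmod (grad eta x) `^ p).
have idom : mu.-integrable D (EFin \o dom).
  exact: (integrableZl mD (2 `^ p) (integrableD mD gi igrad)).
have dom_le j x : `|dual p (gt j x) (grad eta x)| <= dom x.
  apply: le_trans (normr_dual_le _ _ p1) _.
  pose s := vmod (g x) + vmod (grad eta x).
  have s0 : 0 <= s by rewrite addr_ge0 ?vmod_ge0.
  apply: (@le_trans _ _ (s `^ (p - 1) * s)).
    apply: ler_pM; rewrite ?powR_ge0 ?vmod_ge0 ?lerDr ?vmod_ge0//.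
    apply: ge0_ler_powR; rewrite ?nnegrE ?subr_ge0 ?(ltW p1) ?vmod_ge0//.
    apply: le_trans (ler_vmodD _ _) _; rewrite vmodZ lerD2l ger0_norm ?(ltW (t0 j))//.
    by rewrite ler_piMl ?vmod_ge0.
  by rewrite mulrC mulr_powRB1// powRD_le ?vmod_ge0 ?(ltW p0).
have mdual j : measurable_fun D (fun x => dual p (gt j x) (grad eta x)).
  exact: measurable_dual.
have idual j : mu.-integrable D (EFin \o (fun x => dual p (gt j x) (grad eta x))).
  apply: le_integrable idom => //; first exact/measurable_EFinP.
  by move=> x _ /=; rewrite lee_fin (le_trans (dom_le j x))// ler_norm.
have a_lim : a_ @ \oo --> a.
  have [||||ia _ h] := @dominated_convergence _ _ R mu D mD
    (fun j x => (dual p (gt j x) (grad eta x))%:E)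
    (fun x => (dual p (g x) (grad eta x))%:E) (EFin \o dom) _ _ _ idom.
  - by move=> j; exact/measurable_EFinP.
  - by apply/measurable_EFinP; exact: measurable_dual.
  - apply: aeW => x _; apply: cvg_EFin; first by near=> j.
    exact: cvg_dual.
  - by apply: aeW => x j _; rewrite lee_fin.
  have aE : (\int[mu]_(x in D) (dual p (g x) (grad eta x))%:E)%E = a%:E.
    by rewrite fineK// integrable_fin_num.
  by rewrite aE in h; exact: (fine_cvg h).
have A_le j : \int[mu]_(x in D) (vmod (gt j x) `^ p) <= 1 + p * t j * a_ j.
  have E x : vmod (g x) = vmod (gt j x + (- t j)%:C *: grad eta x).
    by rewrite /gt -addrA -scalerDl -rmorphD subrr scale0r addr0.
  have := @dual_tangent_integral n D p (- t j) (fun x => vmod (gt j x))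
    (fun x => vmod (g x)) (gt j) (grad eta) mD p1 (fun=> erefl) E (igt j) gi (idual j).
  have -> : \int[mu]_(x in D) (vmod (g x) `^ p) = 1.
    rewrite /Rintegral -(@LnormD_powR _ _ _ _ (vmod \o g)) ?gt_eqF//.
      by rewrite g1 poweR1r.
    by move=> x; exact: vmod_ge0.
  by rewrite -/(a_ j) mulrN mulNr => h; lra.
pose m := q / p.
have m1 : 1 <= m by rewrite ler_pdivlMr// mul1r.
have B_le j : \int[mu]_(x in D) (cmod (ut j x) `^ q) <=
    k `^ q * (\int[mu]_(x in D) (vmod (gt j x) `^ p)) `^ m.
  have := sobolev_constant_ub mD p0 q0 KE (ltW k0) (sut j).
  have Afin : (\int[mu]_(x in D) (vmod (gt j x) `^ p)%:E)%E \is a fin_num.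
    exact: (integrable_fin_num mD (igt j)).
  have A0 : 0 <= \int[mu]_(x in D) (vmod (gt j x) `^ p).
    by apply: Rintegral_ge0 => x _; exact: powR_ge0.
  rewrite [X in (_ <= _ * X)%E]LnormDE ?gt_eqF//; last by move=> x; exact: vmod_ge0.
  rewrite -(fineK Afin) poweR_EFin -EFinM => /(LnormD_le mD q0 _ _) H.
  have : (\int[mu]_(x in D) (cmod (ut j x) `^ q)%:E <=
     (k `^ q * (\int[mu]_(x in D) (vmod (gt j x) `^ p)) `^ m)%:E)%E.
    apply: le_trans (H _ _) _.
    - by rewrite mulr_ge0 ?(ltW k0)// powR_ge0.
    - by move=> x; exact: cmod_ge0.
    rewrite lee_fin powRM ?(ltW k0) ?powR_ge0// -powRrM.
    by rewrite /m [p^-1 * q]mulrC.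
  move=> h; rewrite -lee_fin fineK//.
  by rewrite ge0_fin_numE ?(le_lt_trans h) ?ltry//; apply: integral_ge0 => x _;
    rewrite lee_fin powR_ge0.
pose b := \int[mu]_(x in D) (cmod (u x) `^ (q - 2) * cdot (u x) (eta x)).
have uq : (\int[mu]_(x in D) (cmod (u x) `^ q)%:E = (k `^ q)%:E)%E.
  rewrite -(@LnormD_powR _ _ _ _ (cmod \o u)) ?gt_eqF// ?uK//.
  by move=> x; exact: cmod_ge0.
have B_ge j : k `^ q + q * t j * b <= \int[mu]_(x in D) (cmod (ut j x) `^ q).
  have iuq : mu.-integrable D (EFin \o (fun x => cmod (u x) `^ q)).
    by apply/integrable_powRP; rewrite ?uq ?ltry//; exact: cmeasurable_cmod.
  have [ietaq _] := test_function_integrable mD q0 teta.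
  pose U x : 'rV[R[i]]_1 := const_mx (u x); pose H x : 'rV[R[i]]_1 := const_mx (eta x).
  have mU i : cmeasurable D (fun x => U x ord0 i).
    by under eq_fun do rewrite mxE.
  have mH i : cmeasurable D (fun x => H x ord0 i).
    by under eq_fun do rewrite mxE.
  have UtE x : vmod (U x + (t j)%:C *: H x) = cmod (ut j x).
    by rewrite -vmod_const; congr vmod; apply/rowP => l; rewrite !mxE.
  have UE x : vmod (U x) = cmod (u x) by rewrite vmod_const.
  have HE x : vmod (H x) = cmod (eta x) by rewrite vmod_const.
  have LU : (LnormD D q%:E (fun x => vmod (U x)) <= k%:E)%E.
    by under eq_fun do rewrite UE; rewrite -uK.
  pose c := fine (LnormD D q%:E (cmod \o eta)).
  have cE : LnormD D q%:E (cmod \o eta) = c%:E.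
    rewrite fineK// ge0_fin_numE ?LnormD_ge0//.
    apply/(LnormD_lty mD q0); first by move=> x; exact: cmod_ge0.
    by apply/integrable_powRP => //; exact: cmeasurable_cmod.
  have c0 : 0 <= c by rewrite -lee_fin -cE LnormD_ge0.
  have LH : (LnormD D q%:E (fun x => vmod (H x)) <= c%:E)%E.
    by under eq_fun do rewrite HE; rewrite -cE.
  have [idU _] := dual_integral_le mD q1 (ltW k0) c0 mU mH LU LH.
  have mut : cmeasurable D (ut j) by exact: cmeasurableDZ.
  have iut : mu.-integrable D (EFin \o (fun x => cmod (ut j x) `^ q)).
    apply: (@integrable_powRD _ _ D q (fun x => cmod (u x)) (fun x => cmod (eta x))) => //.
    - exact: ltW.
    - exact: cmeasurable_cmod.
    - move=> x; rewrite cmod_ge0 -UtE -UE -HE/=.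
      apply: le_trans (ler_vmodD _ _) _; rewrite vmodZ lerD2l ger0_norm ?(ltW (t0 j))//.
      by rewrite ler_piMl ?vmod_ge0.
    - by move=> x; exact: cmod_ge0.
    - by move=> x; exact: cmod_ge0.
  have := @dual_tangent_integral 1%N D q (t j) (fun x => cmod (u x))
    (fun x => cmod (ut j x)) U H mD q1 (fun x => esym (UE x)) (fun x => esym (UtE x))
    iuq iut idU.
  have -> : \int[mu]_(x in D) (cmod (u x) `^ q) = k `^ q by rewrite /Rintegral uq.
  congr (_ + _ * _ <= _); apply: eq_Rintegral => x _.
  by rewrite /dual UE vdot_const.
pose x_ j := 1 + p * t j * a_ j.
have x_lim : x_ @ \oo --> (1 : R).
  have c1 : (p * t j) * a_ j @[j --> \oo] --> (p * 0) * a.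
    by apply: cvgM => //; apply: cvgMl_tmp.
  have cc : 1 @[_ --> \oo] --> (1 : R) by exact: cvg_cst.
  by have := cvgD cc c1; rewrite mulr0 mul0r addr0; exact.
have xm_lim : x_ j `^ (m - 1) @[j --> \oo] --> (1 : R).
  have : {for (1 : R), continuous (@powR R ^~ (m - 1))}.
    apply/differentiable_continuous; rewrite -derivable1_diffP.
    by apply: ex_derive; exact: is_derive1_powR.
  rewrite /prop_for/continuous_at powR1 => c1.
  exact: (@cvg_comp _ _ _ x_ (@powR R ^~ (m - 1)) _ _ _ x_lim c1).
have key : \forall j \near \oo, b <= k `^ q * (a_ j * x_ j `^ (m - 1)).
  near=> j.
  have x0 : 0 < x_ j by near: j; exact: (cvgr_gt _ x_lim _ ltr01).
  have kq0 : 0 < k `^ q by rewrite powR_gt0.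
  have h1 : k `^ q + q * t j * b <= k `^ q * (1 + m * (x_ j - 1) * x_ j `^ (m - 1)).
    apply: le_trans (B_ge j) _; apply: le_trans (B_le j) _.
    rewrite ler_pM2l//; apply: le_trans (powR_bernoulli m1 x0).
    apply: ge0_ler_powR; rewrite ?nnegrE ?(le_trans ler01 m1) ?(ltW x0) ?A_le//.
    by apply: Rintegral_ge0 => x _; exact: powR_ge0.
  have qt0 : 0 < q * t j by rewrite mulr_gt0.
  rewrite -(ler_pM2l qt0) -(lerD2l (k `^ q)); apply: le_trans h1 _.
  rewrite le_eqVlt; apply/orP; left; apply/eqP.
  have -> : x_ j - 1 = p * t j * a_ j by rewrite /x_ addrC addKr.
  by rewrite /m; field; rewrite gt_eqF.
have lim : k `^ q * (a_ j * x_ j `^ (m - 1)) @[j --> \oo] --> k `^ q * (a * 1).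
  by apply: cvgMl_tmp; exact: cvgM.
rewrite mulr1 in lim.
by apply: (cvgr_to_ge lim key).
Unshelve. all: by end_near. Qed.

End variation.

End euler_lagrange.


(** * The extremal potential *)

Section exponents.
Context {R : realType}.

Lemma conjugate_exponent (p q : R) (r : \bar R) : 0 < p -> (1 < r)%E ->
  (r^-1 + (p / q)%:E = 1)%E ->
  [/\ 0 < q, p <= q & r = +oo%E /\ q = p \/
    exists2 s : R, r = s%:E & 1 < s /\ (q - p) * s = q].
Proof.
move=> p0; case: r => [s| |]// s1.
  have s1' : 1 < s by rewrite -lte_fin.
  have s0 : 0 < s by rewrite (lt_trans _ s1').
  rewrite inver gt_eqF// -EFinD => -[rq].
  have pqE : p / q = 1 - s^-1 by rewrite -rq addrC addKr.
  have pq0 : 0 < p / q by rewrite pqE subr_gt0 invf_lt1.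
  have q0 : 0 < q by rewrite -invr_gt0 -(pmulr_rgt0 _ p0).
  have pE : p = q * (1 - s^-1) by rewrite -pqE mulrCA divff ?mulr1 ?gt_eqF.
  split=> //.
    by rewrite pE ler_piMr ?(ltW q0)// gerBl invr_ge0 ltW.
  right; exists s => //; split=> //; rewrite pE; field.
  by rewrite gt_eqF.
rewrite invey add0e => -[pq1].
have qN0 : q != 0.
  by apply/eqP => q0; move: pq1; rewrite q0 invr0 mulr0 => /eqP; rewrite eq_sym oner_eq0.
have qp : q = p by rewrite -[q]mul1r -pq1 divfK.
by rewrite qp; split=> //; left.
Qed.

Lemma subcritical_exponent m (p q : R) (r : \bar R) : 0 < p -> p < m.+2%:R ->
  ((m.+2%:R / p)%:E < r)%E -> (r^-1 + (p / q)%:E = 1)%E ->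
  (1 < r)%E /\ q <= sob_star m p.
Proof.
move=> p0 pn nr rq.
have r1 : (1 < r)%E.
  by apply: le_lt_trans nr; rewrite lee_fin ler_pdivlMr// mul1r ltW.
split=> //; have np : 0 < m.+2%:R - p by rewrite subr_gt0.
have [q0 pq [[_ ->]|[s rs [s1 qs]]]] := conjugate_exponent p0 r1 rq.
  by rewrite /sob_star ler_pdivlMr// mulrC ler_pM2r// lerBlDr lerDl ltW.
rewrite rs lte_fin ltr_pdivrMr// in nr.
rewrite /sob_star ler_pdivlMr//.
have qp0 : 0 <= q - p by rewrite subr_ge0.
have h : (q - p) * m.+2%:R <= (q - p) * (s * p) by rewrite ler_wpM2l// ltW.
by rewrite mulrA qs in h; rewrite mulrBr; rewrite mulrBl in h; rewrite [_ * p]mulrC in h; lra.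
Qed.

End exponents.

Section extremal_potential.
Context {R : realType} {n : nat}.
Local Notation mu := (@lebesgue_rV R n).
Local Notation Re := (@complex.Re R).
Local Notation Im := (@complex.Im R).
Local Notation cmod := (@ComplexField.Normc.normc R).

Lemma cmod_nonneg (z : R[i]) : 0 <= z -> 0 <= Re z /\ cmod z = Re z.
Proof.
rewrite lecE /= => /andP[/eqP iz rz]; split=> //.
by rewrite cmodE iz expr0n/= addr0 sqrtr_sqr ger0_norm.
Qed.

Variables (D : set 'rV[R]_n) (q p k : R) (r : \bar R).
Variables (u : 'rV[R]_n -> R[i]) (g : 'rV[R]_n -> 'rV[R[i]]_n).
Hypotheses (oD : open D) (Dfin : (mu D < +oo)%E) (p1 : 1 < p) (r1 : (1 < r)%E).
Hypotheses (rq : (r^-1 + (p / q)%:E = 1)%E) (k0 : 0 < k).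
Hypotheses (KE : sobolev_constant D q p = k%:E).
Hypotheses (ext : normalized_extremal D q p u g) (ntu : nontrivial D u).

Let mD : measurable D. Proof. exact: open_measurable_rV. Qed.
Let p0 : 0 < p. Proof. by rewrite (lt_trans _ p1). Qed.
Let q0 : 0 < q. Proof. by have [] := conjugate_exponent p0 r1 rq. Qed.
Let pq : p <= q. Proof. by have [] := conjugate_exponent p0 r1 rq. Qed.
Let q1 : 1 < q. Proof. exact: lt_le_trans pq. Qed.
Let uK : LnormD D q%:E (cmod \o u) = k%:E. Proof. by case: ext => _ _ _ ->. Qed.
Let mu_ : cmeasurable D u. Proof. by case: ext => -[[[]]]. Qed.
Let upos : {ae mu, forall x, D x -> 0 <= u x}. Proof. by case: ext. Qed.

Lemma Lnorm_infty_cst1 : LnormD D +oo%E (fun=> 1) = 1%E.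
Proof.
have muD0 : mu D != 0%E.
  apply/eqP => muD; apply: ntu; exists D; split=> //.
  by move=> x /= h; apply: contrapT => Dx; apply: h.
have muD : (0 < mu D)%E by rewrite lt0e muD0 measure_ge0.
have muT : (0 < mu setT)%E.
  by apply: lt_le_trans muD _; apply: le_measure => //; rewrite inE.
rewrite /LnormD unlock muT; apply/eqP; rewrite eq_le; apply/andP; split.
  apply/ess_supP; apply: aeW => x /=; rewrite patchE lee_fin.
  by case: ifPn => _; rewrite ?normr1 ?normr0.
rewrite leNgt; apply/negP => ess1; move/eqP: muD0; apply.
have [N [mN muN0 DN]] := ess_sup_ge mu (abse \o (EFin \o (fun=> 1 : R) \_ D)).
apply: (subset_measure0 mD mN _ muN0) => x Dx; apply: DN => /=.
rewrite patchE mem_set// normr1 => /le_lt_trans/(_ ess1).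
by rewrite ltxx.
Qed.

(** For finite r, the relation (q - p) r = q makes this norm a power of the q-norm of u.
    For infinite r it is the norm of the constant 1 on a set of positive measure. *)
Lemma Lnorm_extremal_power :
  LnormD D r (fun x => Re (u x) `^ (q - p)) = (k `^ (q - p))%:E.
Proof.
have [_ _ [[ry qp]|[s rs [s1 qs]]]] := conjugate_exponent p0 r1 rq.
  rewrite ry qp subrr powRr0.
  have -> : (fun x => Re (u x) `^ 0) = fun=> 1 by apply/funext => x; rewrite powRr0.
  exact: Lnorm_infty_cst1.
have s0 : 0 < s by rewrite (lt_trans _ s1).
rewrite rs LnormDE ?gt_eqF//; last by move=> x; exact: powR_ge0.
have -> : (\int[mu]_(x in D) ((Re (u x) `^ (q - p)) `^ s)%:E = (k `^ q)%:E)%E.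
  have [mr mi] := mu_.
  rewrite -poweR_EFin -uK (@LnormD_powR _ _ _ _ (cmod \o u)) ?gt_eqF//; last first.
    by move=> x; exact: cmod_ge0.
  apply: ae_eq_integral => //.
  - by apply/measurable_EFinP; do 2 apply: measurable_powR_comp.
  - by apply/measurable_EFinP; apply: measurable_powR_comp; exact: cmeasurable_cmod.
  - apply: filterS upos => x ux Dx; have [_ /= ->] := cmod_nonneg (ux Dx).
    by rewrite -powRrM qs.
by rewrite poweR_EFin -powRrM -{1}qs mulfK ?gt_eqF.
Qed.

Lemma extremal_potentialE x :
  extremal_potential D q p r u x = Re (u x) `^ (q - p) / k `^ (q - p).
Proof. by rewrite /extremal_potential Lnorm_extremal_power. Qed.

Lemma extremal_potential_class : potential_class D r (extremal_potential D q p r u).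
Proof.
have kqp : 0 < k `^ (q - p) by rewrite powR_gt0.
have VE : extremal_potential D q p r u = fun x => Re (u x) `^ (q - p) / k `^ (q - p).
  by apply/funext => x; exact: extremal_potentialE.
have [mr mi] := mu_.
have mw : measurable_fun D (fun x => Re (u x) `^ (q - p)) by exact: measurable_powR_comp.
have V0 x : 0 <= Re (u x) `^ (q - p) / k `^ (q - p).
  by rewrite divr_ge0 ?powR_ge0.
rewrite VE; split.
- exact: measurable_funM.
- by apply: aeW => x _.
have [_ _ [[ry qp]|[s rs [s1 qs]]]] := conjugate_exponent p0 r1 rq.
  rewrite ry qp subrr.
  have -> : (fun x => Re (u x) `^ 0 / k `^ 0) = fun=> 1.
    by apply/funext => x; rewrite !powRr0 divr1.
  exact: Lnorm_infty_cst1.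
have s0 : 0 < s by rewrite (lt_trans _ s1).
have := Lnorm_extremal_power; rewrite rs => normw.
have intw : (\int[mu]_(x in D) ((Re (u x) `^ (q - p)) `^ s)%:E = ((k `^ (q - p)) `^ s)%:E)%E.
  by rewrite -LnormD_powR ?gt_eqF ?normw// => x; exact: powR_ge0.
rewrite LnormDE ?gt_eqF//.
rewrite (eq_integral (fun x => (((k `^ (q - p))^-1 `^ s)%:E *
    ((Re (u x) `^ (q - p)) `^ s)%:E)%E)); last first.
  by move=> x _; rewrite -EFinM mulrC powRM ?powR_ge0// invr_ge0 ltW.
rewrite ge0_integralZl//; last 3 first.
- by apply/measurable_EFinP; exact: measurable_powR_comp.
- by move=> x _; rewrite lee_fin powR_ge0.
- by rewrite lee_fin powR_ge0.
rewrite intw -EFinM -powRM ?invr_ge0 ?(ltW kqp)// mulVf ?gt_eqF//.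
by rewrite powR1 poweR1r.
Qed.

(** The multiplier k^(-q) of the Euler-Lagrange equation is the product of k^(-p), the
    eigenvalue, and k^(-(q - p)), the normalization of the potential. *)
Lemma extremal_weak_solution :
  weak_solution D p (k `^ p)^-1 (extremal_potential D q p r u) u g.
Proof.
apply/weak_solutionP => eta teta.
have [sug _ g1 _] := ext.
have [[_ Lg _] _] := sug.
have [mg _] := Lg.
have kq0 : 0 < k `^ q by rewrite powR_gt0.
have [meta mgrad] := test_function_measurable D teta.
pose b := \int[mu]_(x in D) (cmod (u x) `^ (q - 2) * cdot (u x) (eta x)).
pose a := \int[mu]_(x in D) dual p (g x) (grad eta x).
have [igrad _] : mu.-integrable D (EFin \o (fun x => dual p (g x) (grad eta x))) /\ True.
  split=> //.
  have [[_ [_ gfin] _] _] := test_function_sobolev0 mD p1 teta.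
  have L0 : 0 <= fine (LnormD D p%:E (vmod \o grad eta)) by rewrite fine_ge0 ?LnormD_ge0.
  have [] := @dual_integral_le R n n D p 1 _ g (grad eta) mD p1 ler01 L0 mg mgrad => //.
    by rewrite -g1.
  by rewrite fineK// ge0_fin_numE ?LnormD_ge0.
have ieta : mu.-integrable D (EFin \o (fun x => cmod (u x) `^ (q - 2) * cdot (u x) (eta x))).
  have [[[_ gfin] _ _] _] := test_function_sobolev0 mD q1 teta.
  have L0 : 0 <= fine (LnormD D q%:E (cmod \o eta)) by rewrite fine_ge0 ?LnormD_ge0.
  pose U x : 'rV[R[i]]_1 := const_mx (u x); pose H x : 'rV[R[i]]_1 := const_mx (eta x).
  have mU i : cmeasurable D (fun x => U x ord0 i) by under eq_fun do rewrite mxE.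
  have mH i : cmeasurable D (fun x => H x ord0 i) by under eq_fun do rewrite mxE.
  have [||idU _] := @dual_integral_le R n 1 D q k _ U H mD q1 (ltW k0) L0 mU mH.
  - by under eq_fun do rewrite vmod_const; rewrite -uK.
  - by under eq_fun do rewrite vmod_const; rewrite fineK// ge0_fin_numE ?LnormD_ge0.
  apply: eq_integrable idU => // x _ /=.
  by rewrite /dual vmod_const vdot_const.
have el := @euler_lagrange_le _ _ D q p k u g mD Dfin p1 pq k0 KE sug g1 uK.
have aE : b = k `^ q * a.
  apply/eqP; rewrite eq_le (el _ teta)/=.
  (* The test function [eta - 2 eta] is the opposite of [eta]. *)
  have := el _ (test_functionDZ (-2) teta teta).
  have -> : \int[mu]_(x in D) (cmod (u x) `^ (q - 2) * cdot (u x) (eta x + (-2)%:C * eta x)) =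
      - b.
    rewrite -[RHS]mulN1r /b -RintegralZl//; apply: eq_Rintegral => x _.
    by rewrite /cdot !(cReD, cImD, cReZ, cImZ); ring.
  have -> : \int[mu]_(x in D) dual p (g x) (grad (fun x => eta x + (-2)%:C * eta x) x) =
      - a.
    rewrite -[RHS]mulN1r /a -RintegralZl//; apply: eq_Rintegral => x _.
    by rewrite (gradDZ _ _ teta teta) dualDr dualZr; ring.
  by rewrite mulrN lerN2.
rewrite -/a.
have -> : a = (k `^ q)^-1 * b by rewrite aE mulKf ?gt_eqF.
rewrite -RintegralZl//.
have [mr mi] := mu_.
have mcu : measurable_fun D (fun x => cmod (u x)) by apply: cmeasurable_cmod.
have mcdot : measurable_fun D (fun x => cdot (u x) (eta x)).
  by case: meta => mr' mi'; apply: measurable_funD; exact: measurable_funM.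
congr fine; apply: ae_eq_integral => //.
- apply/measurable_EFinP; apply: measurable_funM => //; apply: measurable_funM => //.
  exact: measurable_powR_comp.
- apply/measurable_EFinP; apply: measurable_funM => //; apply: measurable_funM => //.
    by apply: measurable_funM => //; have [] := extremal_potential_class.
  exact: measurable_powR_comp.
apply: filterS upos => x ux Dx; have [re0 cE] := cmod_nonneg (ux Dx).
congr EFin; rewrite extremal_potentialE cE.
have [y0|yN0] := eqVneq (Re (u x)) 0.
  have c0 : cdot (u x) (eta x) = 0.
    apply/eqP; rewrite -normr_le0; apply: le_trans (normr_cdot_le _ _) _.
    by rewrite cE y0 mul0r.
  by rewrite c0 !mulr0.
have y2 : Re (u x) `^ (q - 2) = Re (u x) `^ (q - p) * Re (u x) `^ (p - 2).
  by rewrite -powRD ?yN0 ?implybT//; congr (_ `^ _); ring.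
have kE : k `^ q = k `^ p * k `^ (q - p).
  by rewrite -powRD ?(gt_eqF k0) ?implybT//; congr (_ `^ _); ring.
by rewrite y2 kE invfM; ring.
Qed.

End extremal_potential.

(** * The eigenvalue inequality and its equality case *)

Theorem corollary1p3 (R : realType) (n : nat) (D : set 'rV[R]_n)
    (p q : R) (r : \bar R) :
  open D -> bounded_set D ->
  1 < p -> p < n%:R ->
  ((n%:R / p)%:E < r)%E -> (r^-1 + (p / q)%:E = 1)%E ->
  (forall (E : R) (V : 'rV[R]_n -> R),
    0 < E -> potential_class D r V -> has_nontrivial_solution D p E V ->
    ((sobolev_constant D q p `^ p)^-1 <= E%:E)%E)
  /\
  (forall (ustar : 'rV[R]_n -> R[i]) (gstar : 'rV[R]_n -> 'rV[R[i]]_n),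
    normalized_extremal D q p ustar gstar ->
    exists E : R,
      [/\ 0 < E, E%:E = ((sobolev_constant D q p `^ p)^-1)%E,
          potential_class D r (extremal_potential D q p r ustar),
          nontrivial D ustar &
          weak_solution D p E (extremal_potential D q p r ustar) ustar gstar]).
Proof.
move=> oD bD p1 pn nr rq; have p0 : 0 < p by rewrite (lt_trans _ p1).
case: n => [|[|m]] in D oD bD pn nr *.
- by have := lt_trans p0 pn; rewrite ltxx.
- by have := lt_trans p1 pn; rewrite ltxx.
have mD : measurable D by exact: open_measurable_rV.
have Dfin := lebesgue_bounded_lty mD bD.
have [r1 qs] := subcritical_exponent p0 pn nr rq.
have [q0 pq _] := conjugate_exponent p0 r1 rq.
split=> [E V E0 VG hV|u g ext].
  exact: (eigenvalue_lower_bound oD p1 q0 r1 rq E0 VG hV).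
have ntu := extremal_nontrivial oD p1 q0 ext.
have [sug upos g1 uK] := ext.
have Kpos := sobolev_constant_gt0 mD p0 q0 sug ntu.
have Kfin := sobolev0_Lq p1 pn mD Dfin pq qs sug.
rewrite uK in Kfin.
case KE : (sobolev_constant D q p) Kpos Kfin => [k| |]// kpos _.
rewrite lte_fin in kpos.
have kp0 : 0 < k `^ p by rewrite powR_gt0.
exists (k `^ p)^-1; split=> //.
- by rewrite invr_gt0.
- by rewrite poweR_EFin inver gt_eqF.
- exact: (extremal_potential_class oD p1 r1 rq kpos KE ext ntu).
- exact: (extremal_weak_solution oD Dfin p1 r1 rq kpos KE ext ntu).
Qed.
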